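(* Let $N\ge3$ and $4\nmid N$. Every entry of the crossing vector $\mathbf C_m^{(N)}(\beta)$ tends to zero as $m\to\infty$ when $\beta>\beta_{\mathrm c,N}$, and every entry tends to infinity when $\beta<\beta_{\mathrm c,N}$. At $\beta=\beta_{\mathrm c,N}$, the crossing vector has the following limits as $m\to\infty$. Put $\tau=(\sqrt5-1)/2$. (i) If $N=3$, then $(x_m,y_m)\to(\tau,0)$. (ii) If $N=5$, then $(\phi_{1,m},\phi_{2,m},\theta_{1,m},\theta_{2,m})\to(\phi_*,0,\theta_*,0)$, where $\theta_*>0$ satisfies $\theta_*^5+2\theta_*^4=1$ and $\phi_*=\dfrac1{\theta_*(1+\theta_* )}$. (iii) If $N\in\{6,9\}$, then $(X_m,Y_m)\to(t_*,t_* )$, where $t_*=\tau^{1/d_N}$ and $d_N=N/3$. (iv) If $N=4k+\ell\notin\{3,5,6,9\}$, where $\ell\in\{1,2,3\}$, then $(X_m,Y_m)\to(X_{*,N},Y_{*,N})$, where $Y_{*,N}\in(0,1)$ is the unique solution of $Y_{*,N}^{\,N}+2Y_{*,N}^{\,2k+2}=1$ and $$X_{*,N}=\bigl(Y_{*,N}^{\,k}+Y_{*,N}^{\,3k+\ell-2}\bigr)^{-1}.$$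
   Context: **Polygonal $N$-gasket.** Let $N\ge3$, $4\nmid N$. Identify $\mathbb R^2$ with $\mathbb C$; $q_j=e^{2\pi\mathrm i j/N}$, $V_0^{(N)}=\{q_j:j\in\mathbb Z/N\mathbb Z\}$, and $F_0^{(N)}$ is the $N$-cycle on $V_0^{(N)}$. Put $k_N=\lfloor N/4\rfloor$, $\ell_N=N-4k_N$, $s_N=k_N+1$, $$\rho_N=\frac{\sin(\pi/N)}{\sin(\pi/N)+\sin((2s_N-1)\pi/N)},\qquad \Psi_j^{(N)}(x)=q_j+\rho_N(x-q_j).$$ With $O=q_0$, $F_m=F_m^{(N)}=\bigcup_{w\in(\mathbb Z/N\mathbb Z)^m}\bigl((\Psi_0^{(N)})^{-m}\circ\Psi^{(N)}_{w_1}\circ\cdots\circ\Psi^{(N)}_{w_m}\bigr)(F_0^{(N)})$ (union of image graphs). Let $a_{j,m}=(\Psi_0^{(N)})^{-m}(q_j)$ and $\partial F_m=\{a_{j,m}:j\in\mathbb Z/N\mathbb Z\}$. **Crossing vector.** A self-avoiding walk $w$ with $L(w)$ edges has weight $e^{-\beta L(w)}$, $\beta\ge0$; a crossing is a self-avoiding walk in $F_m$ between two prescribed distinct vertices of $\partial F_m$; partition functions are sums of weights. - If $N\notin\{3,5\}$: $X_m(\beta)$ is the partition function of crossings from $a_{0,m}$ to $a_{s_N,m}$, $Y_m(\beta)$ that of crossings from $a_{-s_N,m}$ to $a_{s_N,m}$; $\mathbf C_m^{(N)}=(X_m,Y_m)$. - If $N=3$: $x_m$, $y_m$ are the partition functions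 of crossings between two fixed boundary vertices which respectively avoid and visit the third; $\mathbf C_m^{(3)}=(x_m,y_m)$. - If $N=5$: $\phi_{1,m},\phi_{2,m}$ are the partition functions of crossings from $a_{0,m}$ to $a_{2,m}$ which respectively avoid and visit $a_{-2,m}$; $\theta_{1,m},\theta_{2,m}$ those of crossings from $a_{-2,m}$ to $a_{2,m}$ which respectively avoid and visit $a_{0,m}$; $\mathbf C_m^{(5)}=(\phi_{1,m},\phi_{2,m},\theta_{1,m},\theta_{2,m})$. **Critical value $\beta_{\mathrm c,N}$.** A linear forest is an acyclic graph with all degrees at most two. A boundary forest in $F_m$ is a nonempty edge subgraph $\Gamma\subset F_m$ that is a linear forest, all of whose degree-one vertices lie in $\partial F_m$ and each of whose components contains an edge. $\mathcal S$ is the finite set of nonempty linear forests with vertex set in $V_0^{(N)}$ and no isolated vertices. The trace $\operatorname{tr}_m(\Gamma)\in\mathcal S$ is obtained, for each component (a path), by listing the vertices of $\partial F_m$ in the order the path meets them, keeping only these, replacing each portion between consecutive listed vertices by one abstract edge, and relabeling $a_{j,m}$ as $q_j$. For $\sigma\in\mathcal S$, $Z_m^\sigma(\beta)=\sum e^{-\beta\#E(\Gamma)}$ over boundary forests $\Gamma\subset F_m$ with $\operatorname{tr}_m(\Gamma)=\sigma$, $\mathbf Z_m=(Z_m^\sigma)_{\sigma\in\mathcal S}$, and $\beta_{\mathrm c,N}=\inf\{\beta\ge0:\sup_{m\ge0}\|\mathbf Z_m(\beta)\|_\infty<\infty\}$. *)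

(* Defs.v *)
From HB Require Import structures.
From mathcomp Require Import all_boot all_order all_algebra finmap complex.
From mathcomp Require Import all_classical all_reals all_analysis.
Set Implicit Arguments.
Unset Strict Implicit.
Unset Printing Implicit Defensive.
Import Order.TTheory GRing.Theory Num.Theory numFieldNormedType.Exports.

Local Open Scope classical_set_scope.
Local Open Scope fset_scope.
Local Open Scope complex_scope.
Local Open Scope ring_scope.

Section Gasket.
Variables (R : realType) (N : nat).
Implicit Types (m : nat) (j : int) (beta : R).

(* Vertices are indexed by integers; [gq] and [ga] are N-periodic in [j]. *)
Definition gq j : R[i] :=
  cos (2 * pi * j%:~R / N%:R) +i* sin (2 * pi * j%:~R / N%:R).

Definition V0 : {fset R[i]} := [fset gq (Posz (nat_of_ord j)) | j : 'I_N].

Definition gk : nat := (N %/ 4)%N.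
Definition gs : nat := gk.+1.

Definition rho : R :=
  sin (pi / N%:R) / (sin (pi / N%:R) + sin ((2 * gs%:R - 1) * pi / N%:R)).

Definition Psi j (x : R[i]) : R[i] := gq j + rho%:C * (x - gq j).
Definition Psi_inv j (y : R[i]) : R[i] := gq j + rho^-1%:C * (y - gq j).

Definition Psi_word m (w : m.-tuple 'I_N) (x : R[i]) : R[i] :=
  foldr (fun (j : 'I_N) y => Psi (Posz j) y) x w.

Definition ga m j : R[i] := iter m (Psi_inv 0) (gq j).

Definition boundary m : {fset R[i]} := [fset ga m (Posz (nat_of_ord j)) | j : 'I_N].

(* A graph without isolated vertices is encoded by its set of edges, an edge
   being the set of its two endpoints. *)
Definition graph := {fset {fset R[i]}}.
Implicit Types (G s : graph).

Definition F_edge m (w : m.-tuple 'I_N) (j : 'I_N) : {fset R[i]} :=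
  [fset iter m (Psi_inv 0) (Psi_word w (gq (Posz j)));
        iter m (Psi_inv 0) (Psi_word w (gq (Posz j + 1)))].

Definition F m : graph := [fset F_edge w j | w : m.-tuple 'I_N, j : 'I_N].

Definition adj G : rel R[i] := fun x y => [fset x; y] \in G.

(* The walk [a :: p] has [size p] edges. *)
Definition crossing m (a b : R[i]) (p : seq R[i]) : Prop :=
  [/\ path (adj (F m)) a p, uniq (a :: p) & last a p = b].

(* Sums [\sum_(x \in A)] over a classical set range over its finite support;
   [crossing m a b] and the set of boundary forests are finite. *)
Definition cross_pf m beta (a b : R[i]) (P : seq R[i] -> Prop) : R :=
  \sum_(p \in [set p | crossing m a b p /\ P (a :: p)])
    expR (- beta * (size p)%:R).

Definition avoids (c : R[i]) (w : seq R[i]) : Prop := c \notin w.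
Definition visits (c : R[i]) (w : seq R[i]) : Prop := c \in w.

Definition degree G (x : R[i]) : nat := #|` [fset e in G | x \in e]|.

Definition acyclic G : Prop :=
  ~ exists c : seq R[i], [/\ (3 <= size c)%N, uniq c & cycle (adj G) c].

Definition linear_forest G : Prop :=
  [/\ forall e, e \in G -> #|` e| = 2%N,
      forall x, (degree G x <= 2)%N & acyclic G].

Definition boundary_forest m G : Prop :=
  [/\ G != fset0, G `<=` F m, linear_forest G
    & forall x, degree G x = 1%N -> x \in boundary m].

(* [p] lists the vertices of a component of [G] in the order of traversal. *)
Definition component_path G (p : seq R[i]) : Prop :=
  [/\ (1 < size p)%N, uniq p, sorted (adj G) p
    & forall u v, u \in p -> adj G u v -> v \in p].

Definition trace m G : graph :=
  [fset e in fpowerset V0 |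
    `[< exists p (j k : int),
          [/\ component_path G p,
              infix [:: ga m j; ga m k] [seq x <- p | x \in boundary m]
            & e = [fset gq j; gq k]] >]].

Definition S_ : set graph :=
  [set s | [/\ s != fset0, linear_forest s & forall e, e \in s -> e `<=` V0]].

Definition Z m s beta : R :=
  \sum_(G \in [set G | boundary_forest m G /\ trace m G = s])
    expR (- beta * #|` G|%:R).

Definition Z_norm m beta : \bar R := ereal_sup [set `|Z m s beta|%:E | s in S_].

Definition beta_c : R :=
  inf [set beta | 0 <= beta /\
                  (ereal_sup [set Z_norm m beta | m in [set: nat]] < +oo)%E].

End Gasket.

Section CrossingVector.
Variable R : realType.
Implicit Type beta : R.

Definition X_ N beta : R^nat := fun m =>
  cross_pf N m beta (ga R N m 0) (ga R N m (Posz (gs N))) (fun=> True).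
Definition Y_ N beta : R^nat := fun m =>
  cross_pf N m beta (ga R N m (- Posz (gs N))) (ga R N m (Posz (gs N)))
    (fun=> True).

(* The endpoints are [a_{u,m}], [a_{v,m}] and the third vertex is [a_{t,m}]. *)
Definition x3 (u v t : 'I_3) beta : R^nat := fun m =>
  cross_pf 3 m beta (ga R 3 m (Posz u)) (ga R 3 m (Posz v))
    (avoids (ga R 3 m (Posz t))).
Definition y3 (u v t : 'I_3) beta : R^nat := fun m =>
  cross_pf 3 m beta (ga R 3 m (Posz u)) (ga R 3 m (Posz v))
    (visits (ga R 3 m (Posz t))).

Definition phi1 beta : R^nat := fun m =>
  cross_pf 5 m beta (ga R 5 m 0) (ga R 5 m 2) (avoids (ga R 5 m (- 2))).
Definition phi2 beta : R^nat := fun m =>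
  cross_pf 5 m beta (ga R 5 m 0) (ga R 5 m 2) (visits (ga R 5 m (- 2))).
Definition theta1 beta : R^nat := fun m =>
  cross_pf 5 m beta (ga R 5 m (- 2)) (ga R 5 m 2) (avoids (ga R 5 m 0)).
Definition theta2 beta : R^nat := fun m =>
  cross_pf 5 m beta (ga R 5 m (- 2)) (ga R 5 m 2) (visits (ga R 5 m 0)).

(* [u], [v], [t] enumerate the boundary vertices for N = 3 and are unused
   otherwise. *)
Definition crossing_vector N (u v t : 'I_3) beta : seq (R^nat) :=
  if N == 3 then [:: x3 u v t beta; y3 u v t beta]
  else if N == 5 then [:: phi1 beta; phi2 beta; theta1 beta; theta2 beta]
  else [:: X_ N beta; Y_ N beta].

Definition tau : R := (Num.sqrt 5 - 1) / 2.

End CrossingVector.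

(* Main.v *)
(** A crossing of [F_(m+1)] runs along the ring of the [N] cells in one of the two directions,
because two cells meet only if they are adjacent, and then in one vertex.  Cutting it at the
contact vertices yields a polynomial recursion for the crossing partition functions.  Every
positive orbit of the recursion escapes to infinity, vanishes, or converges to the unique
positive fixed point.  For [N >= 6] this holds because [X_(m+1) / Y_(m+1)] is a decreasing
function of [Y_m < 1], so that a bounded orbit is eventually monotone in each coordinate; for
[N = 3] and [N = 5] the proportion of crossings through the third corner decays geometrically
along a bounded orbit, which reduces the recursion to a one-dimensional one.

Escaping and vanishing are open conditions on [beta], and
[X_m(beta') <= exp (- (beta' - beta)) X_m(beta)] for [beta <= beta'], since walks have positive
length; hence exactly one [beta] gives the fixed point.  In a cell, a boundary forest has its
leaves among three corners, so it is empty or a single crossing of the cell.  Therefore the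
[Z_m] are bounded if and only if the crossing partition functions are, and the exceptional
[beta] is [beta_c]. *)

Require Import Defs.
From HB Require Import structures.
From mathcomp Require Import all_boot all_order all_algebra finmap complex.
From mathcomp Require Import all_classical all_reals all_analysis.
From mathcomp Require Import zify ring lra.
Set Implicit Arguments.
Unset Strict Implicit.
Unset Printing Implicit Defensive.
Import Order.TTheory GRing.Theory Num.Theory numFieldNormedType.Exports.

Local Open Scope classical_set_scope.
Local Open Scope ring_scope.

(** * Decomposition of walks through the cells *)

(** The geometry enters only through the record [one_step]: each cell has one corner of its own and
    two contact corners, and there is no other contact. The main use of 4 not dividing N is here: in
    the direction that separates two adjacent cells the extreme vertex is then unique, so they touch
    in a single point.

    The two ways round the ring take k and N - k steps from cell to cell, and the delicate number of
    steps is N - 1. Then the first and the last cell also share a vertex off the route, the two end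
    pieces are no longer independent, and the weights of crossings avoiding a corner enter the
    recursion. The steps that occur are [gs N], [2 * gs N] and their complements to N, and one of
    them equals N - 1 only for N = 3 and N = 5. This is why these two cases carry a finer crossing
    vector and have a dynamics of their own.

    The forest sums need no recursion: for weights at most one, the sum over the boundary forests of
    level m + 1 is at most the N-th power of 1 + 4 X_m + 2 Y_m. *)

Section SelfAvoiding.
Variables (V : choiceType) (e : rel V).
Implicit Types (x y : V) (p : seq V).

Definition saw x p y := [&& path e x p, uniq (x :: p) & last x p == y].

Lemma saw_in (vs : seq V) x p : (forall u v, e u v -> v \in vs) ->
  path e x p -> {subset p <= vs}.
Proof.
move=> evs; elim: p x => [|z p IH] x //= /andP[xz zp] u.
by rewrite inE => /predU1P[->|/(IH _ zp)]; first exact: evs xz.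
Qed.

Lemma saw_ne x p y : saw x p y -> x != y -> p != [::].
Proof. by case: p => [|//] /and3P[_ _ /eqP/= ->]; rewrite eqxx. Qed.

Lemma saw_index x p y : saw x p y -> x != y -> (index y p).+1 = size p.
Proof.
move=> h xy; have pn := saw_ne h xy; move: h => /and3P[_ /= /andP[_ up] /eqP <-].
case/lastP: p pn up => [//|p z] _ up; rewrite last_rcons size_rcons; congr _.+1.
rewrite -cats1 index_cat; move: up; rewrite rcons_uniq => /andP[/negPf -> _].
by rewrite /= eqxx addn0.
Qed.

End SelfAvoiding.

(** The walk visits [y] only at its end, so the index of [f y] in the concatenation gives the length
    of the first piece: the point where a walk was cut can be recovered. *)
Lemma saw_cat_size (V : choiceType) (e : rel V) (f : V -> V) x y p q p' q' :
  injective f -> x != y -> saw e x p y -> saw e x q y ->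
  map f p ++ p' = map f q ++ q' -> size p = size q.
Proof.
move=> fi xy hp hq /(congr1 (index (f y))).
have mem r : saw e x r y -> y \in r.
  by move=> hr; rewrite -index_mem; have := saw_index hr xy; move: (size r) => ? <-.
rewrite !index_cat !(mem_map fi) !mem // !(index_map fi) => E.
by rewrite -(saw_index hp xy) -(saw_index hq xy) E.
Qed.

Lemma finite_seq_bounded (V : choiceType) (vs : seq V) (n : nat) :
  finite_set [set p : seq V | (size p <= n)%N /\ {subset p <= vs}].
Proof.
elim: n => [|n IH].
  by apply: (@sub_finite_set _ _ [set [::]]) => [[|? ?] [] //|]; exact: finite_set1.
pose f (xp : V * seq V) := xp.1 :: xp.2.
apply: (sub_finite_set (B := [set [::]] `|`
   f @` ([set` vs] `*` [set p | (size p <= n)%N /\ {subset p <= vs}]))).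
  move=> [|x p] [/= sp hp]; [by left | right; exists (x, p) => //=].
  by split; [apply: hp; rewrite mem_head | split=> // y yp; apply: hp; rewrite inE yp orbT].
by rewrite finite_setU; split=> //; apply: finite_image; apply: finite_setX => //;
  apply: finite_seq.
Qed.

Lemma finite_saw (V : choiceType) (e : rel V) (vs : seq V) x y :
  (forall u v, e u v -> v \in vs) -> finite_set [set p | saw e x p y].
Proof.
move=> evs; apply: sub_finite_set (finite_seq_bounded vs (size vs)) => p /and3P[pp /= /andP[_
  up] _].
by have sub := saw_in evs pp; split=> //; apply: uniq_leq_size.
Qed.

(** * Generating sums of finite sets of walks *)

Section WalkSums.
Variables (R : realType) (w : R) (V : choiceType).
Implicit Types (S T : set (seq V)).

Definition pf S : R := \sum_(p \in S) w ^+ size p.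

(** The last hypothesis makes the cutting point a function of the concatenation; concatenation is
    then injective on pairs and the weights multiply. *)
Lemma pf_cat S T (f : V -> V) : injective f -> finite_set S -> finite_set T ->
  (forall p q p' q', S p -> S q -> T p' -> T q' ->
      map f p ++ p' = map f q ++ q' -> size p = size q) ->
  pf [set p | exists p0 p1, [/\ S p0, T p1 & p = map f p0 ++ p1]] = pf S * pf T.
Proof.
move=> fi fS fT uS; rewrite /pf mulr_fsuml //.
rewrite [RHS](eq_fsbigr (fun p => \sum_(p1 \in T) w ^+ size p * w ^+ size p1)); last first.
  by move=> p _; rewrite mulr_fsumr.
rewrite pair_fsbig //=.
pose h (u : seq V * seq V) := map f u.1 ++ u.2.
have -> : [set p | exists p0 p1, [/\ S p0, T p1 & p = map f p0 ++ p1]] = h @` (S `*` T).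
  apply/seteqP; split=> p.
    by case=> p0 [p1 [Sp Tp ->]]; exists (p0, p1).
  by case=> [[p0 p1] /= [Sp Tp] <-]; exists p0, p1.
rewrite fsbig_image.
  by apply: eq_fsbigr => -[p p'] _ /=; rewrite size_cat size_map exprD.
move=> [p p'] [q q']; rewrite !inE /= => -[Sp Tp] [Sq Tq] E.
have sz := uS _ _ _ _ Sp Sq Tp Tq E.
move/eqP: E; rewrite /h /= eqseq_cat ?size_map // => /andP[/eqP/(inj_map fi) -> /eqP ->].
by [].
Qed.

Lemma pfID S (P : set (seq V)) : finite_set S ->
  pf S = pf (S `&` P) + pf (S `&` ~` P).
Proof. by move=> fS; rewrite /pf (fsbigID P). Qed.

Lemma pf_ge0 S : 0 <= w -> finite_set S -> 0 <= pf S.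
Proof. by move=> w0 fS; rewrite /pf; apply: fsumr_ge0 => // p _; apply: exprn_ge0. Qed.

Lemma pfU S T : finite_set S -> finite_set T -> (forall p, S p -> T p -> False) ->
  pf (S `|` T) = pf S + pf T.
Proof.
by move=> fS fT ST; rewrite /pf fsbigU0 // => p [/ST h /h].
Qed.

Lemma finite_cat S T (f : V -> V) : finite_set S -> finite_set T ->
  finite_set [set p | exists p0 p1, [/\ S p0, T p1 & p = map f p0 ++ p1]].
Proof.
move=> fS fT; pose h (u : seq V * seq V) := map f u.1 ++ u.2.
apply: (@sub_finite_set _ _ (h @` (S `*` T))).
  by move=> p [p0 [p1 [Sp Tp ->]]]; exists (p0, p1).
by apply: finite_image; apply: finite_setX.
Qed.

End WalkSums.

(** * Self-avoiding walks on a necklace of cells *)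

Section OneStep.
Variables (V : choiceType) (I : comNzRingType) (N : nat) (s : I).
Variables (e0 e1 : rel V) (vs : seq V) (A : I -> V -> V) (a b : I -> V).
Implicit Types (i j : I) (k l : nat) (p : seq V).

(* [e1] is a necklace of [N] copies [A i] of the graph [e0] with corners [a]: the copy [i]
   owns the new corner [b i] and meets the copy [i + 1] in the image of the corner [i + s]. *)
Record one_step : Prop := OneStep {
  os_N : (2 < N)%N;
  os_char : forall k, (k%:R == 0 :> I) = (N %| k)%N;
  os_s : s != 0;
  os_2s : s != - s;
  os_vs : forall x y, e0 x y -> x \in vs /\ y \in vs;
  os_a : forall i, a i \in vs;
  os_ainj : injective a;
  os_Ainj : forall i, injective (A i);
  os_e1 : forall x y, e1 x y <-> exists i x' y', [/\ x = A i x', y = A i y' & e0 x' y'];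
  os_own : forall i, A i (a i) = b i;
  os_meet : forall i, A i (a (i + s)) = A (i + 1) (a (i + 1 - s));
  os_contact : forall i j x y, x \in vs -> y \in vs -> A i x = A j y ->
    [\/ i = j, [/\ j = i + 1, x = a (i + s) & y = a (i + 1 - s)]
      | [/\ i = j + 1, y = a (j + s) & x = a (j + 1 - s)]]
}.

Hypothesis OS : one_step.

(** The vertex shared by the cells [i - 1] and [i], in the coordinates of the cell [i]. As for all
    walks here, the lists described by [chain] and [turn] omit their starting vertex. *)
Definition entry i := A i (a (i - s)).

Fixpoint chain k i p : Prop :=
  if k is k'.+1 then
    exists p0 p1, [/\ saw e0 (a (i - s)) p0 (a (i + s)), chain k' (i + 1) p1
                    & p = map (A i) p0 ++ p1]
  else exists2 p0, saw e0 (a (i - s)) p0 (a i) & p = map (A i) p0.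

(* The crossings from [b i] through the cells [i], ..., [i + k]; when [k = N - 1] the last
   cell is adjacent to the first one, and only one piece may use their contact vertex. *)
Definition turn k i p : Prop :=
  exists p0 p1, [/\ saw e0 (a i) p0 (a (i + s)), chain k.-1 (i + 1) p1,
     p = map (A i) p0 ++ p1 & ~~ ((entry i \in map (A i) p0) && (entry i \in p1))].

Lemma entryS i : entry (i + 1) = A i (a (i + s)).
Proof. by rewrite (os_meet OS). Qed.

Lemma natI_inj k l : (k < N)%N -> (l < N)%N -> k%:R = l%:R :> I -> k = l.
Proof.
wlog kl : k l / (k <= l)%N => [H|] kN lN E.
  by case: (leqP k l) => h; [apply: H | apply/esym/H => //; apply: ltnW].
have : (l - k)%:R == 0 :> I by rewrite natrB // E subrr.
rewrite (os_char OS) => d; case: (posnP (l - k)%N) => [|l0]; first by lia.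
by have := dvdn_leq l0 d; lia.
Qed.

Lemma run_exists p i x : path e1 (A i x) p -> exists p0 p2,
  [/\ p = map (A i) p0 ++ p2, path e0 x p0
    & p2 = [::] \/ exists j z y p3, [/\ j != i, p2 = A j y :: p3, e0 z y
                                     & A j z = A i (last x p0)]].
Proof.
elim: p x => [|y p IH] x /=; first by exists [::], [::]; split=> //; left.
case/andP=> /(os_e1 OS)[j [x' [y' [Ex -> xy]]]] pp.
case: (eqVneq j i) => [ji|ji].
  move: Ex xy pp; rewrite ji => /(os_Ainj OS) <- xy /IH[p0 [p2 [-> p0p H]]].
  by exists (y' :: p0), p2; split=> //=; rewrite xy.
exists [::], (A j y' :: p); split=> //; right.
by exists j, x', y', p; rewrite Ex.
Qed.

Let vsP x p : x \in vs -> path e0 x p -> {subset x :: p <= vs}.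
Proof.
move=> xv pp y; rewrite inE => /predU1P[-> //|].
by apply: (saw_in _ pp) => u v /(os_vs OS)[].
Qed.

Let mem_last_vs x p : x \in vs -> path e0 x p -> last x p \in vs.
Proof. by move=> xv pp; apply: (vsP xv pp); apply: mem_last. Qed.

(** Contact vertices sit at corners [k + s] or [k - s] of the cell [k], which differ from [k] since
    [s] is not zero. So a new corner lies in one cell only. *)
Lemma own_cell i j x : x \in vs -> A i x = b j -> i = j /\ x = a j.
Proof.
move=> xv; rewrite -(os_own OS) => E; have s0 := os_s OS.
case: (os_contact OS xv (os_a OS j) E) => [ij|[ji _ /(os_ainj OS)]|[_ /(os_ainj OS) E2 _]].
- by move: E; rewrite ij => /(os_Ainj OS).
- by rewrite -ji => E2; case/eqP: s0; apply: (@addrI _ (j - s)); rewrite subrK addr0.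
- by case/eqP: s0; apply: (@addrI _ j); rewrite addr0.
Qed.

Lemma chain_start k i p : chain k i p -> exists y p', p = A i y :: p' /\ e0 (a (i - s)) y.
Proof.
have s0 := os_s OS; have s2 := os_2s OS.
case: k => [|k] /= => [[p0 h ->]|[p0 [p1 [h _ ->]]]].
  have /(saw_ne h) : a (i - s) != a i.
    apply/eqP => /(os_ainj OS) E; case/eqP: s0; apply: (@addrI _ (i - s)).
    by rewrite subrK addr0.
  case: p0 h => // y p0 /and3P[/= /andP[h _] _ _] _.
  by exists y, (map (A i) p0).
have /(saw_ne h) : a (i - s) != a (i + s).
  by apply/eqP => /(os_ainj OS) /addrI E; rewrite E eqxx in s2.
case: p0 h => // y p0 /and3P[/= /andP[h _] _ _] _.
by exists y, (map (A i) p0 ++ p1).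
Qed.

(** Having entered through [entry i], a self-avoiding walk can leave the cell [i] only through its
    contact with [i + 1], so the cells follow each other in increasing order. The last conclusion
    records the contacts passed; it will exclude more than one round. [m] only bounds the length for
    the induction. *)
Lemma chain_complete (m : nat) i y p1 j : (size p1 <= m)%N ->
  e0 (a (i - s)) y -> path e1 (A i y) p1 -> uniq [:: entry i, A i y & p1] ->
  last (A i y) p1 = b j ->
  exists k, [/\ j = i + k%:R, chain k i (A i y :: p1)
     & forall l, (0 < l <= k)%N -> entry (i + l%:R) \in A i y :: p1].
Proof.
elim: m i y p1 => [|m IH] i y p1 szp ey pp up lp.
  move: pp up lp; case: p1 szp => //= _ _ up /(own_cell (proj2 (os_vs OS ey)))[ij yE].
  exists 0%N; split; [by rewrite addr0 | | by case].
  subst j; exists [:: y] => //; rewrite /saw /= ey -yE eqxx andbT /=.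
  by move: up; rewrite !andbT !inE; apply: contra => /eqP yE'; rewrite -yE'.
have yv := proj2 (os_vs OS ey).
have [p0 [p2 [p1E pp0 H]]] := run_exists pp.
have sp0 : path e0 (a (i - s)) (y :: p0) by rewrite /= ey.
have up0 : uniq (a (i - s) :: y :: p0).
  rewrite -(map_inj_uniq (os_Ainj OS (i := i))); move: up; rewrite p1E.
  by rewrite -!cat_cons cat_uniq => /andP[].
have zv := mem_last_vs yv pp0.
case: H => [p20|[j' [z [y' [p3 [j'i p2E ezy zE]]]]]].
  move: lp; rewrite p1E p20 cats0 last_map => /(own_cell zv)[ij yE].
  exists 0%N; split; [by rewrite addr0 | | by case].
  by exists (y :: p0) => //; rewrite /saw sp0 up0 /= yE ij.
have zv' := proj1 (os_vs OS ezy).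
case: (os_contact OS zv zv' (esym zE)) => [ij|[jE lE zE2]|[iE zE2 lE]].
- by rewrite ij eqxx in j'i.
- have szp3 : (size p3 <= m)%N.
    by move: szp; rewrite p1E p2E size_cat /= addnS ltnS; apply: leq_trans; exact: leq_addl.
  have ent : A (i + 1) z = entry (i + 1) by rewrite zE2.
  have entl : entry (i + 1) = last (A i y) (map (A i) p0).
    by rewrite last_map -ent -jE.
  have [||||k [jk ck Hk]] := IH (i + 1) y' p3 szp3.
  - by rewrite -zE2.
  - by move: pp; rewrite p1E cat_path p2E jE /= => /and3P[].
  - rewrite entl; move: up; rewrite p1E p2E jE; case/lastP: (p0) => [|q x].
      by rewrite /= inE negb_or -!andbA => /and5P[_ _ -> -> ->].
    rewrite map_rcons last_rcons -cat_cons -cat_cons cat_uniq -rcons_cons -rcons_cons.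
    case/and3P=> _ /hasPn h /andP[h1 h2]; apply/and3P; split=> //.
    apply/negP => h3; have := h _ h3; by rewrite mem_rcons inE eqxx.
  - by move: lp; rewrite p1E last_cat p2E jE.
  exists k.+1; split.
  - by rewrite jk -natr1 -addrA [1 + _]addrC.
  - exists (y :: p0), p2; split=> //; [| by rewrite p2E jE | by rewrite p1E].
    by rewrite /saw sp0 up0 /= lE.
  case=> [//|l]; case: l => [_|l lk].
    by rewrite entl p1E -cat_cons mem_cat mem_last.
  rewrite p1E -cat_cons mem_cat p2E jE; apply/orP; right.
  rewrite -natr1 addrC -addrA [1 + i]addrC [_ + (i + 1)]addrC.
  by apply: Hk; case/andP: lk => _; rewrite ltnS => ->.
(* Leaving towards the cell [i - 1] would go through [entry i] a second time. *)
- move: up => /= /andP[]; rewrite p1E -cat_cons mem_cat negb_or => /andP[h _] _.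
  by case/negP: h; rewrite /entry [in a (i - s)]iE -lE -last_map mem_last.
Qed.

Let muniq i p : uniq (map (A i) p) = uniq p.
Proof. exact: (map_inj_uniq (os_Ainj OS (i := i))). Qed.

Lemma cell_path i x p : path e0 x p -> path e1 (A i x) (map (A i) p).
Proof.
elim: p x => [|y p IH] x //= /andP[xy /IH ->]; rewrite andbT.
by apply/(os_e1 OS); exists i, x, y.
Qed.

Let add1r i l : i + 1 + l%:R = i + l.+1%:R.
Proof. by rewrite -addrA -natr1 [1 + _]addrC. Qed.

(** On a ring of [N] cells, [i + l] is a neighbour of [i] only for [l = 1] or, from the other side,
    for [l = N - 1]. *)
Lemma cell_overlap i l x y : x \in vs -> y \in vs -> (0 < l < N)%N ->
  A i x = A (i + l%:R) y ->
  (l = 1%N /\ x = a (i + s)) \/ (l.+1 = N /\ x = a (i - s)).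
Proof.
move=> xv yv /andP[l0 lN] E.
case: (os_contact OS xv yv E) => [ij|[ij xE _]|[ij _ xE]].
- have : l%:R == 0 :> I by apply/eqP/(@addrI _ i); rewrite -ij addr0.
  by rewrite (os_char OS) => /(dvdn_leq l0); rewrite leqNgt lN.
- left; split=> //; apply: natI_inj => //; first by have := os_N OS; lia.
  by apply/(@addrI _ i).
- right; split; last by rewrite xE -ij.
  have : l.+1%:R == 0 :> I by apply/eqP/(@addrI _ i); rewrite addr0 [RHS]ij -addrA natr1.
  by rewrite (os_char OS) => /(dvdn_leq (ltn0Sn l)); lia.
Qed.

Definition in_cells i k x := exists l z, [/\ (l <= k)%N, z \in vs & x = A (i + l%:R) z].

(** The bound on [k] keeps the cell [i - 1] out of the chain. The first cell then meets the later
    ones only at [entry (i + 1)], which the remaining list omits. *)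
Lemma chain_sound k i p : chain k i p -> (k.+1 < N)%N ->
  [/\ path e1 (entry i) p, uniq (entry i :: p), last (entry i) p = b (i + k%:R)
    & forall x, x \in entry i :: p -> in_cells i k x].
Proof.
elim: k i p => [|k IH] i p /=.
  case=> p0 /and3P[pp up /eqP lp] -> _; split.
  - exact: cell_path.
  - have : uniq (map (A i) (a (i - s) :: p0)) by rewrite muniq.
    by [].
  - by rewrite /entry last_map lp addr0 (os_own OS).
  - move=> x; rewrite -[_ :: _]/(map (A i) (_ :: p0)) => /mapP[z zp ->].
    by exists 0%N, z; rewrite addr0; split=> //; apply: (vsP _ pp) => //; apply: (os_a OS).
case=> p0 [p1 [/and3P[pp up /eqP lp] cp ->]] kN.
have [|ppa upa lpa inp] := IH _ _ cp; first exact: ltnW.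
have sub0 := vsP (os_a OS (i - s)) pp.
have E : entry (i + 1) = last (entry i) (map (A i) p0) by rewrite /entry last_map lp -entryS.
have up1 : uniq (map (A i) (a (i - s) :: p0)) by rewrite muniq.
split.
- by rewrite cat_path cell_path //= -E.
- rewrite -[_ && _]/(uniq (map (A i) (a (i - s) :: p0) ++ p1)) cat_uniq up1 /=.
  move: upa => /= /andP[upa1 ->]; rewrite andbT; apply/hasPn => x xp1; apply/negP => xp0.
  have [l [z [lk zv xE]]] : in_cells (i + 1) k x by apply: inp; rewrite inE xp1 orbT.
  move: xp0; rewrite -map_cons => /mapP[z0 z0p xE0].
  move: (xE0); rewrite xE add1r => /esym /(cell_overlap (sub0 _ z0p) zv)[|[_ z0E]|[lN _]].
  + by rewrite /= (leq_ltn_trans _ (ltnW kN)).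
  + by move: upa1; rewrite entryS -z0E -xE0 xp1.
  + by move: kN lk; lia.
- by rewrite last_cat -E lpa add1r.
- move=> x; rewrite -cat_cons mem_cat => /orP[|xp1].
    rewrite -[_ :: _]/(map (A i) (_ :: p0)) => /mapP[z zp ->].
    by exists 0%N, z; rewrite addr0; split=> //; apply: sub0.
  have [l [z [lk zv ->]]] : in_cells (i + 1) k x by apply: inp; rewrite inE xp1 orbT.
  by exists l.+1, z; rewrite add1r.
Qed.

Lemma own_ninI i : a i != a (i + s) /\ a (i - s) != a i.
Proof.
by split; apply/eqP => /(os_ainj OS) E; case/eqP: (os_s OS);
  [apply: (@addrI _ i); rewrite -E addr0 | apply: (@addrI _ (i - s)); rewrite subrK addr0].
Qed.

Lemma turn_sound k i p : (0 < k < N)%N -> turn k i p -> saw e1 (b i) p (b (i + k%:R)).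
Proof.
case: k => // k /= kN [p0 [p1 [/and3P[pp up /eqP lp] /= cp -> nb]]].
have [//|ppa upa lpa inp] := chain_sound cp.
have sub0 := vsP (os_a OS i) pp.
have E : entry (i + 1) = last (b i) (map (A i) p0) by rewrite -(os_own OS) last_map lp entryS.
have up1 : uniq (map (A i) (a i :: p0)) by rewrite muniq.
apply/and3P; split.
- by rewrite cat_path -E ppa -(os_own OS) cell_path.
- rewrite -cat_cons -(os_own OS) cat_uniq -map_cons up1 /=.
  move: upa => /= /andP[upa1 ->]; rewrite andbT; apply/hasPn => x xp1; apply/negP => xp0.
  have [l [z [lk zv xE]]] : in_cells (i + 1) k x by apply: inp; rewrite inE xp1 orbT.
  move: (xp0); rewrite -map_cons => /mapP[z0 z0p xE0].
  move: (xE0); rewrite xE add1r => /esym /(cell_overlap (sub0 _ z0p) zv)[|[_ z0E]|[lN z0E]].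
  + by rewrite /= (leq_ltn_trans _ kN).
  + by move: upa1; rewrite entryS -z0E -xE0 xp1.
  (* Here [k = N - 1] and the common vertex is [entry i]; the side condition of [turn] is there for
     this case. *)
  + move: nb xp0; rewrite /entry -z0E -xE0 xp1 andbT inE => /negPf ->; rewrite orbF xE0.
    move=> /eqP/(os_Ainj OS); rewrite z0E; apply/eqP; exact: (own_ninI i).2.
- by rewrite last_cat -E lpa add1r.
Qed.

Lemma turn_head k i p : turn k i p -> exists p0 y r,
  [/\ p = map (A i) p0 ++ A (i + 1) y :: r, e0 (a (i + 1 - s)) y, path e0 (a i) p0,
     last (a i) p0 = a (i + s) & p0 != [::]].
Proof.
case=> p0 [p1 [h /chain_start[y [p' [-> ey]]] -> _]].
exists p0, y, p'; split=> //; first by case/and3P: h.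
  by case/and3P: h => _ _ /eqP.
exact: (saw_ne h (own_ninI i).1).
Qed.

(* A self-avoiding walk that leaves its first cell through the next one can only go
   on to the following cells: each contact vertex is used at most once. *)
Lemma turn_complete i j p0 y p3 :
  let p := map (A i) p0 ++ A (i + 1) y :: p3 in
  i != j -> path e0 (a i) p0 -> last (a i) p0 = a (i + s) -> e0 (a (i + 1 - s)) y ->
  saw e1 (b i) p (b j) -> exists k, [/\ (0 < k < N)%N, j = i + k%:R & turn k i p].
Proof.
move=> p ij pp0 lp0 ey /and3P[pp up /eqP lp].
have E : entry (i + 1) = last (b i) (map (A i) p0) by rewrite -(os_own OS) last_map lp0 entryS.
have pne : p0 != [::].
  by case: (p0) lp0 => //= h; have := (own_ninI i).1; rewrite -h eqxx.
have Emem : entry (i + 1) \in map (A i) p0.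
  by rewrite E; case: (p0) pne => //= z q _; apply: mem_last.
have [|||k [jk ck Hk]] := @chain_complete _ _ _ _ j (leqnn (size p3)) ey.
- by move: pp; rewrite /p cat_path /= => /and3P[].
- move: up; rewrite /p -cat_cons cat_uniq => /and3P[_ /hasPn h /= h']; rewrite /= h' andbT.
  by apply/negP => h3; have := h _ h3; rewrite inE Emem orbT.
- by move: lp; rewrite /p last_cat.
have disj x : x \in map (A i) p0 -> x \in A (i + 1) y :: p3 -> False.
  move: up; rewrite /p -cat_cons cat_uniq => /and3P[_ /hasPn h _] xp0 xp1.
  by have := h _ xp1; rewrite inE xp0 orbT.
(* A full round would come back to [entry (i + 1)], where the first piece ended. *)
have kN : (k < N)%N.
  rewrite ltnNge; apply/negP => Nk; apply: (disj (entry (i + 1))) => //.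
  have -> : entry (i + 1) = entry (i + 1 + N%:R).
    by have /eqP -> : N%:R == 0 :> I; [rewrite (os_char OS) | rewrite addr0].
  by apply: Hk; rewrite Nk andbT; have := os_N OS; lia.
exists k.+1; split; [|by rewrite jk add1r|].
  rewrite /= ltn_neqAle kN andbT; apply: contra ij => /eqP kNE; rewrite jk add1r kNE.
  by have /eqP -> : N%:R == 0 :> I; [rewrite (os_char OS) | rewrite addr0].
exists p0, (A (i + 1) y :: p3); split=> //; last by apply/negP => /andP[/disj].
rewrite /saw pp0 lp0 eqxx andbT /= -(map_inj_uniq (os_Ainj OS (i := i))) /=.
rewrite -(mem_map (os_Ainj OS (i := i))) (os_own OS).
by move: up; rewrite /p -cat_cons cat_uniq => /and3P[].
Qed.

(** The walk cannot end inside the cell [i], because [b j] lies in the cell [j] alone; hence the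
    first cut is a contact with one of the two neighbours. *)
Lemma exit_cases i j p : i != j -> saw e1 (b i) p (b j) ->
  exists p0 j' y p3, [/\ p = map (A i) p0 ++ A j' y :: p3, path e0 (a i) p0 &
    (j' = i + 1 /\ last (a i) p0 = a (i + s) /\ e0 (a (i + 1 - s)) y) \/
    (i = j' + 1 /\ last (a i) p0 = a (i - s) /\ e0 (a (j' + s)) y)].
Proof.
move=> ij /and3P[]; rewrite -(os_own OS) => pp up /eqP lp.
have [p0 [p2 [pE pp0 H]]] := run_exists pp.
have zv := mem_last_vs (os_a OS i) pp0.
case: H => [p20|[j' [z [y [p3 [j'i p2E ezy zE]]]]]].
  move: lp; rewrite pE p20 cats0 last_map => /(own_cell zv)[ij' _].
  by rewrite ij' eqxx in ij.
exists p0, j', y, p3; split=> //; first by rewrite pE p2E.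
case: (os_contact OS zv (proj1 (os_vs OS ezy)) (esym zE)) => [ij'|[-> lE zE2]|[iE zE2 lE]].
- by rewrite ij' eqxx in j'i.
- by left; rewrite -zE2.
- by right; rewrite -zE2 {3}iE.
Qed.

End OneStep.

(** Negating the indices reverses the orientation of the ring and exchanges the contact corners
    [i + s] and [i - s]. Walks that turn backwards become walks that turn forwards, so every result
    is proved for one direction only. *)
Lemma one_step_opp (V : choiceType) (I : comNzRingType) (N : nat) (s : I)
  (e0 e1 : rel V) (vs : seq V) (A : I -> V -> V) (a b : I -> V) :
  one_step N s e0 e1 vs A a b ->
  one_step N s e0 e1 vs (A \o -%R) (a \o -%R) (b \o -%R).
Proof.
case=> h1 h2 h3 h4 h5 h6 h7 h8 h9 h10 h11 h12; split=> //=.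
- by apply: inj_comp h7 oppr_inj.
- move=> x y; rewrite h9; split=> -[i [x' [y' [-> -> e]]]]; last by exists (- i), x', y'.
  by exists (- i), x', y'; rewrite opprK.
- move=> i; have := h11 (- (i + 1)).
  have -> : - (i + 1) + 1 = - i by ring.
  have -> : - (i + 1) + s = - (i + 1 - s) by ring.
  by have -> : - i - s = - (i + s) by ring.
- move=> i j x y xv yv /(h12 _ _ _ _ xv yv)[/oppr_inj ->|[ji -> ->]|[ij -> ->]].
  + by constructor 1.
  + have E : i = j + 1 by rewrite -[j]opprK ji; ring.
    by constructor 3; split; rewrite ?E //; congr a; ring.
  + have E : j = i + 1 by rewrite -[i ]opprK ij; ring.
    by constructor 2; split; rewrite ?E //; congr a; ring.
Qed.

Section Crossings.
Variables (V : choiceType) (I : comNzRingType) (N : nat) (s : I).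
Variables (e0 e1 : rel V) (vs : seq V) (A : I -> V -> V) (a b : I -> V).
Hypothesis OS : one_step N s e0 e1 vs A a b.
Implicit Types (i j : I) (k l : nat) (p : seq V).

Local Notation turnP := (turn s e0 A a).
Local Notation turnN := (turn s e0 (A \o -%R) (a \o -%R)).

(** The direction is decided at the first exit. In the reflected necklace [N - k] steps lead from
    [- i] to [- (i + k)], since [N] vanishes in the ring of indices. *)
Lemma crossing_iff i k p : (0 < k < N)%N ->
  saw e1 (b i) p (b (i + k%:R)) <-> turnP k i p \/ turnN (N - k) (- i) p.
Proof.
move=> kN; have OS' := one_step_opp OS.
have NE : (N - k)%:R = - k%:R :> I.
  have /eqP e : N%:R == 0 :> I by rewrite (os_char OS).
  by rewrite natrB ?e ?sub0r //; case/andP: kN => _ /ltnW.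
have kN' : (0 < N - k < N)%N by lia.
have ne : i != i + k%:R.
  apply/eqP => /esym/eqP; rewrite -subr_eq0 addrAC subrr add0r (os_char OS).
  by move=> /dvdn_leq; lia.
split=> [h|[/(turn_sound OS kN)//|/(turn_sound OS' kN')]]; last first.
  by rewrite /= opprK NE !opprD !opprK.
have [p0 [j' [y [p3 [pE pp0 [[jE [lE ey]]|[iE [lE ey]]]]]]]] := exit_cases OS ne h.
- left; rewrite jE in pE.
  rewrite pE in h *; have [k' [k'N /addrI jk t]] := turn_complete OS ne pp0 lE ey h.
  by rewrite (natI_inj OS _ _ jk) //; [case/andP: kN | case/andP: k'N].
- right; rewrite pE in h *.
  have E : - i + 1 = - j' by rewrite iE; ring.
  have [|||||k' [k'N jk t]] := @turn_complete _ _ _ _ _ _ _ _ _ _ OS' (- i) (- (i + k%:R)) p0 y p3.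
  + by rewrite (inj_eq oppr_inj).
  + by rewrite /= opprK.
  + by rewrite /= opprK lE; congr a; ring.
  + by rewrite /= E; have -> : - (- j' - s) = j' + s by ring.
  + by rewrite /= E !opprK.
  have jk' : (N - k)%:R = k'%:R :> I by rewrite NE; apply: (@addrI _ (- i)); rewrite -jk opprD.
  rewrite (natI_inj OS _ _ jk') //; [|by case/andP: kN'|by case/andP: k'N].
  by move: t; rewrite /= !opprK E opprK.
Qed.

(** Both descriptions cut the walk at its first exit. If the first pieces differ in length, the
    vertex just after the shorter one lies in two adjacent cells, so it is the contact vertex at
    which that piece ended, already visited. If they have the same length, they coincide and would
    end both at [i + s] and at [i - s]. *)
Lemma turn_disjoint i k k' p : uniq (b i :: p) -> turnP k i p -> turnN k' (- i) p -> False.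
Proof.
move=> up tP tN; have OS' := one_step_opp OS.
have [p0 [y [r [pE ey pp lp pn]]]] := turn_head OS tP.
have [q0 [y' [r' [pE' ey' qq lq qn]]]] := turn_head OS' tN.
move: pE' ey' qq lq; rewrite /= !opprK.
have -> : - (- i + 1) = i - 1 by ring.
have -> : - (- i + 1 - s) = i - 1 + s by ring.
have -> : - (- i + s) = i - s by ring.
move=> pE' ey' qq lq.
have sub0 := saw_in (fun u v h => proj2 (os_vs OS h)) pp.
have subq := saw_in (fun u v h => proj2 (os_vs OS h)) qq.
have yv := proj2 (os_vs OS ey); have yv' := proj2 (os_vs OS ey').
case: (ltngtP (size p0) (size q0)) => sz.
- have E : nth (b i) p (size p0) = A i (nth (a i) q0 (size p0)).
    by rewrite pE' nth_cat size_map sz (nth_map (a i)).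
  move: E; rewrite pE nth_cat size_map ltnn subnn /= => /esym E.
  have zv : nth (a i) q0 (size p0) \in vs by apply: subq; apply: mem_nth.
  have N2 := os_N OS.
  have [||[_ zE]|[N2' _]] := @cell_overlap _ _ _ _ _ _ _ _ _ _ OS i 1 _ y zv yv; rewrite ?E //.
  + exact: ltnW N2.
  + move: up; rewrite pE -cat_cons cat_uniq => /and3P[_ /hasPn /= h _].
    have := h (A (i + 1) y); rewrite mem_head => /(_ isT); case/negP.
    rewrite -E zE -lp inE -last_map; apply/orP; right.
    by case: (p0) pn => // z q _; rewrite /= mem_last.
  + by move: N2; rewrite -N2'.
- have E : nth (b i) p (size q0) = A i (nth (a i) p0 (size q0)).
    by rewrite pE nth_cat size_map sz (nth_map (a i)).
  move: E; rewrite pE' nth_cat size_map ltnn subnn /= => E.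
  have zv : nth (a i) p0 (size q0) \in vs by apply: sub0; apply: mem_nth.
  have N2 := os_N OS.
  have [||[_ zE]|[N2' _]] := @cell_overlap _ _ _ _ _ _ _ _ _ _ OS' (- i) 1 _ y' zv yv'.
  + exact: ltnW N2.
  + by rewrite /= !opprK -E; congr (A _ y'); ring.
  + move: up; rewrite pE' -cat_cons cat_uniq => /and3P[_ /hasPn /= h _].
    have := h (A (i - 1) y'); rewrite mem_head => /(_ isT); case/negP.
    rewrite E zE /= ; have -> : - (- i + s) = i - s by ring.
    rewrite -lq inE -last_map; apply/orP; right.
    by case: (q0) qn => // z q _; rewrite /= mem_last.
  + by move: N2; rewrite -N2'.
- have : map (A i) p0 = map (A i) q0.
    have := congr1 (take (size p0)) pE; rewrite {1}pE' !take_size_cat ?size_map //.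
  move=> /(inj_map (os_Ainj OS (i := i))) E; move: lq; rewrite -E lp => /(os_ainj OS)/addrI.
  by apply/eqP; apply: os_2s OS.
Qed.

Section Sums.
Variables (R : realType) (w : R).

(** The set [B] is not tested at the starting vertex, which the list omits; along a chain that
    vertex was tested as the end of the preceding piece. *)
Definition avw u v (B : pred V) := [set p | saw e0 u p v /\ ~~ has B p].

Lemma finite_avw u v B : finite_set (avw u v B).
Proof.
have evs x y : e0 x y -> y \in vs by move=> /(os_vs OS)[].
by apply: sub_finite_set (finite_saw u v evs) => p [].
Qed.

Definition chain_weight k i (B : pred V) : R :=
  (\prod_(l < k) pf w (avw (a (i + l%:R - s)) (a (i + l%:R + s)) (B \o A (i + l%:R)))) *
  pf w (avw (a (i + k%:R - s)) (a (i + k%:R)) (B \o A (i + k%:R))).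

Let chainB k i B := [set p | chain s e0 A a k i p /\ ~~ has B p].

Let a_ne i : a (i - s) != a (i + s).
Proof. by apply/eqP => /(os_ainj OS)/addrI E; have := os_2s OS; rewrite E eqxx. Qed.

Let chainBS k i B : chainB k.+1 i B =
  [set p | exists p0 p1, [/\ avw (a (i - s)) (a (i + s)) (B \o A i) p0,
     chainB k (i + 1) B p1 & p = map (A i) p0 ++ p1]].
Proof.
apply/seteqP; split=> p /=.
  case=> [[p0 [p1 [h0 h1 ->]]]]; rewrite has_cat has_map negb_or => /andP[n0 n1].
  by exists p0, p1.
case=> p0 [p1 [[h0 n0] [h1 n1] ->]].
by split; [exists p0, p1 | rewrite has_cat has_map negb_or n0].
Qed.

Let chainB0 i B : chainB 0 i B = map (A i) @` avw (a (i - s)) (a i) (B \o A i).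
Proof.
apply/seteqP; split=> p /=.
  by case=> [[p0 h ->]]; rewrite has_map => n; exists p0.
by case=> p0 [h n] <-; split; [exists p0 | rewrite has_map].
Qed.

Lemma chain_pf k i B : finite_set (chainB k i B) /\
  pf w (chainB k i B) = chain_weight k i B.
Proof.
elim: k i => [|k IH] i.
  rewrite chainB0; split; first by apply: finite_image; apply: finite_avw.
  rewrite /chain_weight big_ord0 mul1r addr0 /pf fsbig_image; last first.
    by move=> p q _ _ /(inj_map (os_Ainj OS (i := i))).
  by apply: eq_fsbigr => p _; rewrite size_map.
have [fC EC] := IH (i + 1); rewrite chainBS; split.
  by apply: finite_cat => //; apply: finite_avw.
rewrite (@pf_cat R w V _ _ (A i)) //; first last.
- by move=> p q p' q' [hp _] [hq _] _ _; apply: saw_cat_size hp hq;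
  [apply: os_Ainj OS _ | apply: a_ne].
- exact: finite_avw.
- exact: os_Ainj OS _.
rewrite EC /chain_weight big_ord_recl addr0 mulrA; congr (_ * _ * _).
  apply: eq_bigr => l _.
  by have -> : i + 1 + l%:R = i + (lift ord0 l)%:R by rewrite lift0 -natr1; ring.
by have -> : i + 1 + k%:R = i + k.+1%:R by rewrite -natr1; ring.
Qed.

(** Two disjoint cases for the contact vertex [entry s A a i]: the chain avoids it and the first
    piece is free, or the chain visits it (a difference of two chain weights) and the first piece
    avoids it. *)
Definition turn_weight k i (B : pred V) : R :=
  let B' := predU B (pred1 (entry s A a i)) in
  pf w (avw (a i) (a (i + s)) (B \o A i)) * chain_weight k.-1 (i + 1) B' +
  pf w (avw (a i) (a (i + s)) (B' \o A i)) *
    (chain_weight k.-1 (i + 1) B - chain_weight k.-1 (i + 1) B').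

Lemma turn_pf k i B : finite_set [set p | turnP k i p /\ ~~ has B p] /\
  pf w [set p | turnP k i p /\ ~~ has B p] = turn_weight k i B.
Proof.
pose c := entry s A a i; pose B' := predU B (pred1 c).
pose S B0 := avw (a i) (a (i + s)) (B0 \o A i); pose T B0 := chainB k.-1 (i + 1) B0.
pose cat S0 T0 := [set p | exists p0 p1, [/\ S0 p0, T0 p1 & p = map (A i) p0 ++ p1]] : set (seq V).
have hasU p : has B' p = has B p || (c \in p).
  by rewrite /B' has_predU has_pred1.
have cvis T1 : ~~ has B' T1 = ~~ has B T1 && (c \notin T1) by rewrite hasU negb_or.
have ne := (own_ninI OS i).1.
have uq p q p' q' : saw e0 (a i) p (a (i + s)) -> saw e0 (a i) q (a (i + s)) ->
    map (A i) p ++ p' = map (A i) q ++ q' -> p' = q'.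
  move=> hp hq E; have sz := saw_cat_size (os_Ainj OS (i := i)) ne hp hq E.
  by move/eqP: E; rewrite eqseq_cat ?size_map // => /andP[_ /eqP].
have [fT ET] := chain_pf k.-1 (i + 1) B; have [fT' ET'] := chain_pf k.-1 (i + 1) B'.
have fS := finite_avw (a i) (a (i + s)).
pose T1 := T B `&` [set p : seq V | c \in p].
have fT1 : finite_set T1 by apply: sub_finite_set fT => p [].
have E : [set p | turnP k i p /\ ~~ has B p] = cat (S B) (T B') `|` cat (S B') T1.
  apply/seteqP; split=> p /=.
    case=> -[p0 [p1 [h0 h1 -> nb]]]; rewrite has_cat has_map negb_or => /andP[n0 n1].
    case: (boolP (c \in p1)) => cp1.
      right; exists p0, p1; split=> //; split=> //=.
      by rewrite -has_map cvis has_map n0 /=; move: nb; rewrite -/c cp1 andbT.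
    by left; exists p0, p1; split=> //; split=> //; rewrite cvis n1.
  case=> [[p0 [p1 [[h0 n0] [h1 n1] ->]]]|[p0 [p1 [[h0 n0] [[h1 n1] cp1] ->]]]].
    move: n1; rewrite cvis => /andP[n1 cp1]; split; last by rewrite has_cat has_map negb_or n0.
    by exists p0, p1; split=> //; rewrite -/c (negPf cp1) andbF.
  move: n0; rewrite /= -has_map cvis => /andP[n0 cp0]; split.
    by exists p0, p1; split=> //; rewrite -/c (negPf cp0).
  by rewrite has_cat negb_or n0.
have f1 : finite_set (cat (S B) (T B')) by apply: finite_cat; [apply: fS | apply: fT'].
have f2 : finite_set (cat (S B') T1) by apply: finite_cat; [apply: fS | apply: fT1].
rewrite E; split; first by rewrite finite_setU.
have catE S0 T0 : finite_set S0 -> finite_set T0 ->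
   (forall p, S0 p -> saw e0 (a i) p (a (i + s))) -> pf w (cat S0 T0) = pf w S0 * pf w T0.
  move=> g1 g2 hS; apply: pf_cat => //; first exact: os_Ainj OS _.
  by move=> p q p' q' /hS hp /hS hq _ _; apply: saw_cat_size hp hq => //; apply: os_Ainj OS _.
rewrite pfU //; last first.
  move=> p [p0 [p1 [[h0 _] [_ n1] ->]]] [q0 [q1 [[g0 _] [_ /= cq] E']]].
  by move: n1; rewrite cvis (uq _ _ _ _ h0 g0 E') cq andbF.
have hS B0 p : S B0 p -> saw e0 (a i) p (a (i + s)) by case.
rewrite (catE (S B) (T B') (fS _) fT' (hS B)) (catE (S B') T1 (fS _) fT1 (hS B')).
rewrite ET' /turn_weight; congr (_ + _ * _).
rewrite -ET -ET' (pfID w [set p : seq V | c \in p] fT) -/T1.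
have -> : T B `&` ~` [set p : seq V | c \in p] = T B'.
  apply/seteqP; split=> p /=; first by case=> -[h n] /negP cp; split=> //; rewrite cvis n.
  by case=> h; rewrite cvis => /andP[n /negP cp].
by rewrite addrK.
Qed.

End Sums.
End Crossings.

Lemma crossing_pf (V : choiceType) (I : comNzRingType) (N : nat) (s : I)
  (e0 e1 : rel V) (vs : seq V) (A : I -> V -> V) (a b : I -> V) (R : realType) (w : R) i k B :
  one_step N s e0 e1 vs A a b -> (0 < k < N)%N ->
  pf w [set p | saw e1 (b i) p (b (i + k%:R)) /\ ~~ has B p] =
  turn_weight s e0 A a w k i B + turn_weight s e0 (A \o -%R) (a \o -%R) w (N - k) (- i) B.
Proof.
move=> OS kN; have OS' := one_step_opp OS.
have [f1 <-] := turn_pf OS w k i B; have [f2 <-] := turn_pf OS' w (N - k) (- i) B.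
rewrite -pfU //.
  congr pf; apply/seteqP; split=> p /=.
    by case=> /(crossing_iff OS _ _ kN)[h|h] n; [left | right].
  by case=> -[h n]; split=> //; apply/(crossing_iff OS _ _ kN); [left | right].
move=> p [h _] [h' _].
have /(crossing_iff OS _ _ kN)/and3P[_ up _] : turn s e0 A a k i p \/
  turn s e0 (A \o -%R) (a \o -%R) (N - k) (- i) p by left.
exact: (turn_disjoint OS up h h').
Qed.

Section Symmetry.
Variables (R : realType) (w : R) (V : choiceType) (e : rel V).
Implicit Types (u v : V) (B : pred V) (p : seq V).

Lemma pf_avw_ext (vs : seq V) u v B B' : (forall x y, e x y -> y \in vs) ->
  {in vs, B =1 B'} -> pf w (avw e u v B) = pf w (avw e u v B').
Proof.
move=> evs BB'; congr pf; apply/seteqP.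
have H p : saw e u p v -> has B p = has B' p.
  by case/and3P=> pp _ _; apply: eq_in_has => x /(saw_in evs pp)/BB'.
by split=> p [h]; rewrite ?H // => n; split; rewrite // ?H.
Qed.

Lemma saw_map (f : V -> V) u p v : injective f -> (forall x y, e x y -> e (f x) (f y)) ->
  saw e u p v -> saw e (f u) (map f p) (f v).
Proof.
move=> fi fe /and3P[pp up /eqP lp]; apply/and3P; split.
- by rewrite path_map; apply: sub_path pp => x y; apply: fe.
- by rewrite -map_cons map_inj_uniq.
- by rewrite last_map lp.
Qed.

Lemma pf_avw_sym (f g : V -> V) u v B : cancel f g -> cancel g f ->
  (forall x y, e x y -> e (f x) (f y)) -> (forall x y, e x y -> e (g x) (g y)) ->
  pf w (avw e (f u) (f v) B) = pf w (avw e u v (B \o f)).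
Proof.
move=> fK gK fe ge; rewrite /pf.
have -> : avw e (f u) (f v) B = map f @` avw e u v (B \o f).
  apply/seteqP; split=> p /=.
    move=> [h n]; exists (map g p); last by rewrite mapK.
    split; last by rewrite -has_map mapK.
    by rewrite -[u]fK -[v]fK; apply: saw_map h => //; apply: can_inj gK.
  case=> q [h n] <-; split; last by rewrite has_map.
  by apply: saw_map h => //; apply: can_inj fK.
rewrite fsbig_image; last by move=> p q _ _; apply: inj_map; apply: can_inj fK.
by apply: eq_fsbigr => p _; rewrite size_map.
Qed.

(** [B] has to miss both endpoints, because reversing a walk changes which of them is omitted from
    its list. *)
Lemma pf_avw_rev u v B : symmetric e -> ~~ B u -> ~~ B v ->
  pf w (avw e u v B) = pf w (avw e v u B).
Proof.
move=> es Bu Bv.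
pose g x p := rev (belast x p).
have gP x y p : saw e x p y -> ~~ B x -> ~~ B y ->
    [/\ saw e y (g x p) x, has B (g x p) = has B p, g y (g x p) = p & size (g x p) = size p].
  case/and3P=> pp up /eqP lp nx ny.
  have E : x :: p = rcons (belast x p) y by rewrite lastI lp.
  have E' : y :: g x p = rev (x :: p) by rewrite E rev_rcons.
  split.
  - apply/and3P; split.
    + by rewrite /g -lp rev_path; apply: sub_path pp => a b; rewrite es.
    + by rewrite E' rev_uniq.
    + by rewrite -[last _ _]/(last y (y :: g x p)) E' rev_cons last_rcons.
  - have := congr1 (has B) E'; rewrite has_rev /= (negPf nx) (negPf ny) /=.
    by [].
  - rewrite /g; have := congr1 (belast y) E'; rewrite rev_cons => Eb.
    have : rcons (belast y (g x p)) (last y (g x p)) = rcons (rev p) x.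
      by rewrite -lastI E' rev_cons.
    by move/rcons_inj => [-> _]; rewrite revK.
  - by rewrite /g size_rev size_belast.
rewrite /pf.
have -> : avw e v u B = g u @` avw e u v B.
  apply/seteqP; split=> p /=.
    case=> h n; have [h1 h2 h3 h4] := gP _ _ _ h Bv Bu.
    by exists (g v p) => //; split=> //; rewrite h2.
  by case=> q [h n] <-; have [h1 h2 h3 h4] := gP _ _ _ h Bu Bv; split; rewrite // h2.
rewrite fsbig_image.
  apply: eq_fsbigr => p; rewrite inE => -[h n].
  by have [_ _ _ ->] := gP _ _ _ h Bu Bv.
move=> p q; rewrite !inE => -[h _] [h' _] E.
have [_ _ <- _] := gP _ _ _ h Bu Bv.
by rewrite E; have [_ _ ? _] := gP _ _ _ h' Bu Bv.
Qed.

End Symmetry.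

(** * The weight of a turn as a polynomial in the corner weights of a cell *)

Section Evaluation.
Variables (V : choiceType) (I : comNzRingType) (N : nat) (s : I).
Variables (e0 e1 : rel V) (vs : seq V) (A : I -> V -> V) (a b : I -> V).
Hypothesis OS : one_step N s e0 e1 vs A a b.
Variables (R : realType) (w gX gx gY gy : R).
Implicit Types (i j : I) (k l : nat).

Local Notation wt u v B := (pf w (avw e0 u v B)).

(** A crossing of the necklace uses the cell [i] only between two of the corners [i], [i + s],
    [i - s]. Capitals weigh all walks between two of them, small letters those that avoid the
    third. *)
Record symmetric_weights : Prop := SymmetricWeights {
  sw_X : forall i, wt (a i) (a (i + s)) pred0 = gX;
  sw_X' : forall i, wt (a (i - s)) (a i) pred0 = gX;
  sw_x : forall i, wt (a i) (a (i + s)) (pred1 (a (i - s))) = gx;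
  sw_x' : forall i, wt (a (i - s)) (a i) (pred1 (a (i + s))) = gx;
  sw_Y : forall i, wt (a (i - s)) (a (i + s)) pred0 = gY;
  sw_y : forall i, wt (a (i - s)) (a (i + s)) (pred1 (a i)) = gy
}.

Hypothesis SW : symmetric_weights.

Let evs x y : e0 x y -> y \in vs. Proof. by move=> /(os_vs OS)[]. Qed.

Let own_pred j (T : seq I) x : x \in vs ->
  (A j x \in map b T) = (j \in T) && (x == a j).
Proof.
move=> xv; apply/mapP/andP => [[t tT E]|[jT /eqP ->]].
  by have [jt xE] := own_cell OS xv E; rewrite jt xE.
by exists j => //; rewrite (os_own OS).
Qed.

(** Among the cells [i + l] only the first one and, when the ring is full, the last one
    ([l = N - 1]) contain the vertex [entry i]. *)
Let entry_pred i l x : x \in vs -> (l < N)%N ->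
  (A (i + l%:R) x == entry s A a i) =
  ((l == 0%N) && (x == a (i - s))) || ((l.+1 == N) && (x == a (i + l%:R + s))).
Proof.
move=> xv lN; have s2 := os_2s OS; have N2 := os_N OS.
have /eqP N0 : N%:R == 0 :> I by rewrite (os_char OS).
apply/eqP/orP => [E|[/andP[/eqP -> /eqP ->]|/andP[/eqP lE /eqP ->]]]; last 2 first.
- by rewrite addr0.
- have E1 : i + l%:R + 1 = i by rewrite -addrA natr1 lE N0 addr0.
  by rewrite (os_meet OS) E1.
case: (os_contact OS xv (os_a OS _) E) => [ij|[ij xE aE]|[ij aE xE]].
- have /eqP l0 : l%:R == 0 :> I by apply/eqP/(@addrI _ i); rewrite ij addr0.
  left; move: l0 E => /eqP; rewrite (os_char OS) => /dvdnP[[|q] lq]; last by move: lN;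
    rewrite lq mulSn; lia.
  by rewrite lq addr0 => /(os_Ainj OS) ->; rewrite !eqxx.
- right; have E1 : l.+1%:R == 0 :> I.
    by apply/eqP/(@addrI _ i); rewrite addr0 [RHS]ij -addrA natr1.
  move: E1; rewrite (os_char OS) => /(dvdn_leq (ltn0Sn _)) h.
  by rewrite xE eqxx andbT eqn_leq lN h.
- by case/eqP: s2; apply: (@addrI _ i); move/(os_ainj OS): aE => <-.
Qed.

(** Each cell strictly between the ends is crossed from contact to contact, with weight [gy] when
    its own corner is forbidden. The end pieces are independent unless [k = N - 1]; then at least
    one of them has to avoid the common vertex, which gives [2 * gX * gx - gx ^+ 2]. *)
Lemma turn_eval k i (T : seq I) : (0 < k < N)%N -> i \notin T -> i + k%:R \notin T ->
  turn_weight s e0 A a w k i (fun x => x \in map b T) =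
  (\prod_(0 <= l < k.-1) (if i + l.+1%:R \in T then gy else gY)) *
  (if k == N.-1 then gX * gx + gx * (gX - gx) else gX * gX).
Proof.
move=> /andP[k0 kN] iT ikT; set B := fun x => x \in map b T.
have N2 := os_N OS.
pose B' := predU B (pred1 (entry s A a i)).
have own_off j : j \notin T -> {in vs, B \o A j =1 pred0}.
  by move=> jT x xv; rewrite /= /B own_pred // (negPf jT).
have own_on j : j \in T -> {in vs, B \o A j =1 pred1 (a j)}.
  by move=> jT x xv; rewrite /= /B own_pred // jT.
have step l : i + 1 + l%:R = i + l.+1%:R by rewrite -addrA -natr1 [1 + _]addrC.
have mid l D : (forall x, x \in vs ->
  D (A (i + l.+1%:R) x) = (i + l.+1%:R \in T) && (x == a (i + l.+1%:R))) ->
    wt (a (i + l.+1%:R - s)) (a (i + l.+1%:R + s)) (D \o A (i + l.+1%:R)) =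
    (if i + l.+1%:R \in T then gy else gY).
  move=> HD; case: ifP => jT; [rewrite -(sw_y SW (i + l.+1%:R)) | rewrite -(sw_Y SW (i + l.+1%:R))];
  by apply: pf_avw_ext evs _ => x xv /=; rewrite HD // jT.
have B'E l x : x \in vs -> (l.+1 < N)%N -> B' (A (i + l.+1%:R) x) =
   (B (A (i + l.+1%:R) x)) || ((l.+2 == N) && (x == a (i + l.+1%:R + s))).
  by move=> xv lN; rewrite /B' /= entry_pred.
have kk : k.-1.+1 = k by rewrite prednK.
have midB l : (l < k.-1)%N -> forall x,
  x \in vs -> B' (A (i + l.+1%:R) x) = (i + l.+1%:R \in T) && (x == a (i + l.+1%:R)).
  move=> lk x xv; rewrite B'E //; last by lia.
  have /negPf -> : l.+2 != N by apply/eqP; lia.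
  by rewrite orbF /B own_pred.
rewrite /turn_weight -/B -/B' /chain_weight !step kk.
have -> : wt (a i) (a (i + s)) (B \o A i) = gX.
  by rewrite -(sw_X SW i); apply: pf_avw_ext evs _; apply: own_off.
have -> : wt (a i) (a (i + s)) (B' \o A i) = gx.
  rewrite -(sw_x SW i); apply: pf_avw_ext evs _ => x xv.
  rewrite /B' /= -[in RHS]/(x == _); have := own_off _ iT x xv; rewrite /= => ->.
  by have := entry_pred i xv (ltn_trans (ltn0Sn 1) N2); rewrite addr0 => ->; rewrite /=;
    have /negPf -> : 1%N != N by [apply/eqP; lia]; rewrite orbF.
have -> : wt (a (i + k%:R - s)) (a (i + k%:R)) (B \o A (i + k%:R)) = gX.
  by rewrite -(sw_X' SW (i + k%:R)); apply: pf_avw_ext evs _; apply: own_off.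
have -> : wt (a (i + k%:R - s)) (a (i + k%:R)) (B' \o A (i + k%:R)) = if k == N.-1 then gx else gX.
  have HB x : x \in vs -> B' (A (i + k%:R) x) = (k == N.-1) && (x == a (i + k%:R + s)).
    move=> xv; rewrite -kk B'E ?kk //; have := own_off _ ikT x xv => /= ->; congr (_ && _).
    by apply/eqP/eqP; lia.
  case: ifP => kE; [rewrite -(sw_x' SW (i + k%:R)) | rewrite -(sw_X' SW (i + k%:R))];
  by apply: pf_avw_ext evs _ => x xv; rewrite [LHS](HB x xv) kE.
have PE D : (forall l, (l < k.-1)%N -> forall x,
  x \in vs -> D (A (i + l.+1%:R) x) = (i + l.+1%:R \in T) && (x == a (i + l.+1%:R))) ->
   \prod_(l < k.-1) wt (a (i + 1 + l%:R - s)) (a (i + 1 + l%:R + s)) (D \o A (i + 1 + l%:R)) =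
   \prod_(0 <= l < k.-1) (if i + l.+1%:R \in T then gy else gY).
  by move=> HD; rewrite big_mkord; apply: eq_bigr => l _; rewrite step; apply: mid => x; apply: HD.
rewrite !PE //; last by move=> l _ x xv; rewrite /B own_pred.
set Q := \prod_(0 <= l < k.-1) _.
by case: ifP => _; ring.
Qed.

End Evaluation.

(** * The limiting dynamics *)

Section Limits.
Variable R : realType.
Implicit Types (u v : R^nat).

Lemma cvg_shiftE u m (l : R) : u @ \oo --> l <-> (fun j => u (j + m)%N) @ \oo --> l.
Proof. by rewrite -[X in _ <-> X]/([sequence u (n + m)%N]_n @ \oo --> l) cvg_shiftn. Qed.

(** Bernoulli's inequality reduces geometric growth to arithmetic growth. *)
Lemma geo_infty' u m (a g : R) : 0 < a -> 1 < g -> (forall j,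
  a * g ^+ j <= u (j + m)%N) -> u @ \oo --> +oo.
Proof.
move=> a0 g1 H; suff : [sequence u (n + m)%N]_n @ \oo --> +oo by rewrite cvg_shiftn.
have ag0 : 0 < a * (g - 1) by rewrite mulr_gt0 // subr_gt0.
apply: (@ger_cvgy _ _ _ _ (arithmetic 0 (a * (g - 1)))); last exact: cvg_arithmetic.
apply: nearW => j /=; apply: le_trans (H j); rewrite add0r -mulr_natr -mulrA ler_pM2l //.
elim: j => [|j IH]; first by rewrite mulr0 expr0.
rewrite exprS -natr1 mulrDr mulr1.
have : 1 <= g ^+ j by rewrite exprn_ege1 // ltW.
by move: IH; move: (g ^+ j) => G; nra.
Qed.

Lemma geo_infty u m (a : R) : 0 < a -> (forall j, a * 2 ^+ j <= u (j + m)%N) -> u @ \oo --> +oo.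
Proof. by move=> a0; apply: geo_infty' => //; rewrite ltr1n. Qed.

Lemma infty_eventually_gt u (a : R) : u @ \oo --> +oo -> exists m, forall j, (m <= j)%N -> a < u j.
Proof. by move=> /cvgryPgt /(_ a) [m _ H]; exists m. Qed.

Lemma geo_zero u m (a r : R) : 0 <= r < 1 -> (forall j, 0 <= u (j + m)%N <= a * r ^+ j) ->
  u @ \oo --> (0 : R).
Proof.
move=> /andP[r0 r1] H; apply/(cvg_shiftE u m).
apply: (@squeeze_cvgr _ _ _ _ (cst 0) (geometric a r)); last 2 first.
- exact: cvg_cst.
- by apply: cvg_geometric; rewrite ger0_norm.
exact: nearW.
Qed.

Lemma ndec_cvg u m (M : R) : (forall j, u (j + m)%N <= u (j.+1 + m)%N) ->
  (forall j, u (j + m)%N <= M) -> exists2 l, u @ \oo --> l & forall j, u (j + m)%N <= l.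
Proof.
move=> nd ub; pose v j := u (j + m)%N.
have ndv : nondecreasing_seq v by apply/nondecreasing_seqP.
have cv : cvgn v by apply: nondecreasing_is_cvgn => //; exists M => _ [j _ <-]; exact: ub.
exists (limn v); first by apply/(cvg_shiftE u m).
by move=> j; apply: (nondecreasing_cvgn_le ndv cv).
Qed.

Lemma ninc_cvg u m (M : R) : (forall j, u (j.+1 + m)%N <= u (j + m)%N) ->
  (forall j, M <= u (j + m)%N) -> exists2 l, u @ \oo --> l & forall j, l <= u (j + m)%N.
Proof.
move=> nd ub; pose v j := u (j + m)%N.
have ndv : nonincreasing_seq v by apply/nonincreasing_seqP.
have cv : cvgn v by apply: nonincreasing_is_cvgn => //; exists M => _ [j _ <-]; exact: ub.
exists (limn v); first by apply/(cvg_shiftE u m).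
by move=> j; apply: (nonincreasing_cvgn_ge ndv cv).
Qed.

Lemma cvg_exprn u (l : R) k : u @ \oo --> l -> (fun m => u m ^+ k) @ \oo --> l ^+ k.
Proof.
move=> ul; elim: k => [|k IH]; first by rewrite expr0; exact: cvg_cst.
under eq_fun do rewrite exprS; rewrite exprS; exact: cvgM.
Qed.

Lemma cvg_eventually_lt u (l a : R) : u @ \oo --> l -> l < a -> exists m, forall j,
  (m <= j)%N -> u j < a.
Proof. by move=> ul la; have [m _ H] := cvgr_lt l ul a la; exists m. Qed.

Lemma cvgr_unique u (l l' : R) : u @ \oo --> l -> u @ \oo --> l' -> l = l'.
Proof. by move=> ul ul'; rewrite -(cvg_lim _ ul) ?(cvg_lim _ ul'). Qed.

Lemma cvgS u (l : R) : u @ \oo --> l -> (fun m => u m.+1) @ \oo --> l.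
Proof. by move=> /(cvg_shiftE u 1); under eq_fun do rewrite addn1. Qed.

End Limits.

(** * The recursion for N at least 6 *)

Section CyclicDynamics.
Variables (R : realType) (p1 p2 q1 q2 : nat) (X Y : R^nat).
(** For [N = 4 k + l] these are used with [p1 = k], [p2 = 3 k + l - 2], [q1 = 2 k + 1],
    [q2 = 2 k + l - 3], the numbers of intermediate cells on the two ways round. *)
Hypotheses (hp1 : (0 < p1)%N) (hsum : (p1 + p2 = q1 + q2)%N) (hq1 : (p1 <= q1)%N)
  (hq2 : (p1 <= q2)%N) (hq : q1 = (2 * p1).+1) (hq21 : (q2 < q1)%N).
Hypotheses (X0 : 0 < X 0%N) (Y0 : 0 < Y 0%N).
Hypothesis XS : forall m, X m.+1 = X m ^+ 2 * (Y m ^+ p1 + Y m ^+ p2).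
Hypothesis YS : forall m, Y m.+1 = X m ^+ 2 * (Y m ^+ q1 + Y m ^+ q2).

Let hp2 : (0 < p2)%N. Proof. by lia. Qed.
Let hq1' : (0 < q1)%N. Proof. by lia. Qed.
Let hq2' : (0 < q2)%N. Proof. by lia. Qed.

Let pos m : 0 < X m /\ 0 < Y m.
Proof.
elim: m => [//|m [Xm Ym]]; rewrite XS YS.
by split; rewrite mulr_gt0 ?addr_gt0 ?exprn_gt0.
Qed.

(** For [Y >= 1] each of the two powers is at least [Y]; their sum supplies a factor 2 in both
    coordinates. *)
Lemma cyclic_escape m : 1 < X m -> 1 < Y m -> X @ \oo --> +oo /\ Y @ \oo --> +oo.
Proof.
move=> X1 Y1.
have key j : 2 ^+ j <= X (j + m)%N /\ 2 ^+ j <= Y (j + m)%N.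
  elim: j => [|j [IX IY]]; first by rewrite expr0 add0n !ltW.
  rewrite addSn XS YS exprS; set x := X _ in IX *; set y := Y _ in IY *.
  have two : 1 <= 2 ^+ j :> R by apply: exprn_ege1; rewrite ler1n.
  have y1 : 1 <= y by apply: le_trans IY.
  have x1 : 1 <= x by apply: le_trans IX.
  have yk k : (0 < k)%N -> y <= y ^+ k by move=> k0; rewrite -{1}[y]expr1; apply: ler_weXn2l.
  have xx : x <= x ^+ 2 by rewrite -{1}[x]expr1; apply: ler_weXn2l.
  have P1 := yk _ hp1; have P2 := yk _ hp2; have Q1 := yk _ hq1'; have Q2 := yk _ hq2'.
  by split; nra.
split; apply: (@geo_infty _ _ m 1) => // j; rewrite mul1r; [exact: (key j).1 | exact: (key j).2].
Qed.

(** Below 1 both sums of powers are at most [Y + Y], so the image is at most [X ^+ 2 * (Y + Y)]. The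
    threshold [1 / 4] is a convenient one for which both coordinates are halved. *)
Lemma cyclic_vanish m : X m < 1 / 4 -> Y m < 1 / 4 -> X @ \oo --> (0 : R) /\ Y @ \oo --> (0 : R).
Proof.
move=> X1 Y1.
have key j : X (j + m)%N <= 1 / 4 * (1 / 2) ^+ j /\ Y (j + m)%N <= 1 / 4 * (1 / 2) ^+ j.
  elim: j => [|j [IX IY]]; first by rewrite expr0 mulr1 add0n !ltW.
  have [] := pos (j + m); rewrite addSn XS YS [in X in _ -> _ -> X](exprS (1 / 2) j);
    set x := X _ in IX *; set y := Y _ in IY * => x0 y0.
  have h0 : 0 <= (1 / 2) ^+ j :> R by apply: exprn_ge0; rewrite divr_ge0.
  have h1 : (1 / 2) ^+ j <= 1 :> R by apply: exprn_ile1; lra.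
  have y1 : y <= 1 by nra.
  have yk k : (0 < k)%N -> y ^+ k <= y by move=> k0; rewrite -{2}[y]expr1; apply: ler_wiXn2l;
    rewrite // ltW.
  have yp k : 0 <= y ^+ k by rewrite exprn_ge0 // ltW.
  have P1 := yk _ hp1; have P2 := yk _ hp2; have Q1 := yk _ hq1'; have Q2 := yk _ hq2'.
  have xq : x ^+ 2 <= 1 / 4 * (1 / 4 * (1 / 2) ^+ j) by rewrite expr2; nra.
  have x2 : 0 <= x ^+ 2 by apply: sqr_ge0.
  have p1' := yp p1; have p2' := yp p2; have q1' := yp q1; have q2' := yp q2.
  have bd A : 0 <= A -> A <= y + y -> x ^+ 2 * A <= 1 / 4 * (1 / 2 * (1 / 2) ^+ j).
    move=> A0 Ay; have A1 : A <= 1 / 2 by nra.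
    by apply: (@le_trans _ _ (x ^+ 2 * (1 / 2))); [apply: ler_wpM2l | lra].
  by split; apply: bd; rewrite ?addr_ge0 // lerD.
split; apply: (@geo_zero _ _ m (1 / 4) (1 / 2)); try (apply/andP; lra).
  by move=> j; rewrite (key j).1 ltW //; exact: (pos _).1.
by move=> j; rewrite (key j).2 ltW //; exact: (pos _).2.
Qed.

(** The last equation eliminates [x]: the fixed point satisfies [y * (y ^+ p1 + y ^+ p2) ^+ 2 = y ^+
    q1 + y ^+ q2]. By [hq] the term [y ^+ q1] cancels, and the rest is divided by [y ^+ q2]. *)
Definition cyclic_fixed (x y : R) := [/\ 0 < x, 0 < y, x * (y ^+ p1 + y ^+ p2) = 1
  & y ^+ (p2 + q1 - p1 - q2) + y ^+ (p2 + q1 - p1 - q2) + y ^+ (2 * (p2 - p1) + q1 - q2) = 1].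

(** With [A = y ^+ (q1 - p1)] and [B = y ^+ (q2 - p1)], [hsum] turns the quotient of the two sums
    into [(1 + A * B) / (A + B)], which decreases in [A] and in [B] on (0, 1]. *)
Let ratio (y1 y2 : R) : 0 < y1 -> y1 <= y2 -> y2 <= 1 ->
  (y2 ^+ p1 + y2 ^+ p2) * (y1 ^+ q1 + y1 ^+ q2) <= (y1 ^+ p1 + y1 ^+ p2) * (y2 ^+ q1 + y2 ^+ q2).
Proof.
move=> y10 y12 y21; have y20 := lt_le_trans y10 y12.
have E (y : R) : y ^+ p1 + y ^+ p2 = y ^+ p1 * (1 + y ^+ (q1 - p1) * y ^+ (q2 - p1)).
  by rewrite mulrDr mulr1 mulrA -!exprD; congr (_ + y ^+ _); lia.
have E' (y : R) : y ^+ q1 + y ^+ q2 = y ^+ p1 * (y ^+ (q1 - p1) + y ^+ (q2 - p1)).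
  by rewrite mulrDr -!exprD; congr (y ^+ _ + y ^+ _); lia.
rewrite !E !E'.
have mono k : 0 < y1 ^+ k /\ y1 ^+ k <= y2 ^+ k /\ y2 ^+ k <= 1.
  by rewrite exprn_gt0 // exprn_ile1 ?(ltW y20) // lerXn2r // nnegrE ltW.
have [a0 [a1 a2]] := mono (q1 - p1)%N; have [b0 [b1 b2]] := mono (q2 - p1)%N.
have [c0 [c1 c2]] := mono p1.
move: (y1 ^+ (q1 - p1)) (y2 ^+ (q1 - p1)) (y1 ^+ (q2 - p1)) (y2 ^+ (q2 - p1)) a0 a1 a2 b0 b1 b2.
move=> A1 A2 B1 B2 a0 a1 a2 b0 b1 b2.
have c20 : 0 < y2 ^+ p1 by apply: lt_le_trans c1.
have key : 0 <= (1 + A1 * B1) * (A2 + B2) - (1 + A2 * B2) * (A1 + B1).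
  have -> : (1 + A1 * B1) * (A2 + B2) - (1 + A2 * B2) * (A1 + B1) =
    (A2 - A1) * (1 - B1 * B2) + (B2 - B1) * (1 - A1 * A2) by ring.
  by rewrite addr_ge0 // mulr_ge0 ?subr_ge0 //; nra.
rewrite -subr_ge0.
have -> : y1 ^+ p1 * (1 + A1 * B1) * (y2 ^+ p1 * (A2 + B2)) - y2 ^+ p1 * (1 + A2 * B2) * (y1 ^+
  p1 * (A1 + B1)) =
  (y1 ^+ p1 * y2 ^+ p1) * ((1 + A1 * B1) * (A2 + B2) - (1 + A2 * B2) * (A1 + B1)) by ring.
by rewrite mulr_ge0 // ltW // mulr_gt0.
Qed.

(** This keeps [Y] away from zero while it decreases and [X] increases. Eliminating [x] leaves
    [1 + y ^+ (q1 - q2) <= 4 * y ^+ (q1 - q2)], since [1 + y ^+ (p2 - p1)] is at most 2; and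
    [y ^+ (q1 - q2) <= y]. *)
Let third (x y : R) : 0 < x -> 0 < y -> y <= 1 -> x <= x ^+ 2 * (y ^+ p1 + y ^+ p2) ->
  x ^+ 2 * (y ^+ q1 + y ^+ q2) <= y -> 1 / 3 <= y.
Proof.
have qd : (0 < q1 - q2)%N by rewrite subn_gt0.
have p12 : (p1 + (p2 - p1) = p2)%N by rewrite subnKC //; lia.
have q12 : (q2 + (q1 - q2) = q1)%N by rewrite subnKC // ltnW.
move=> x0 y0 y1 hx hy.
have E : y * (y ^+ p1 + y ^+ p2) ^+ 2 = y ^+ q1 * (1 + y ^+ (p2 - p1)) ^+ 2.
  have -> : y ^+ p2 = y ^+ p1 * y ^+ (p2 - p1) by rewrite -exprD p12.
  by rewrite hq (exprS y (2 * p1)) mulnC exprM; ring.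
have d1 : y ^+ (p2 - p1) <= 1 by rewrite exprn_ile1 // ltW.
have d0 : 0 <= y ^+ (p2 - p1) by rewrite exprn_ge0 // ltW.
have P1 : 1 <= x * (y ^+ p1 + y ^+ p2).
  by rewrite -(ler_pM2l x0) mulr1 mulrA -expr2.
have Q1 : y ^+ q1 + y ^+ q2 <= y * (y ^+ p1 + y ^+ p2) ^+ 2.
  apply: (@le_trans _ _ (x ^+ 2 * (y ^+ q1 + y ^+ q2) * (y ^+ p1 + y ^+ p2) ^+ 2)).
    have -> : x ^+ 2 * (y ^+ q1 + y ^+ q2) * (y ^+ p1 + y ^+ p2) ^+ 2 =
      (y ^+ q1 + y ^+ q2) * (x * (y ^+ p1 + y ^+ p2)) ^+ 2 by ring.
    by rewrite ler_peMr ?exprn_ege1 // addr_ge0 // exprn_ge0 // ltW.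
  by rewrite ler_wpM2r // sqr_ge0.
have qq : y ^+ q1 = y ^+ q2 * y ^+ (q1 - q2) by rewrite -exprD q12.
have q20 : 0 < y ^+ q2 by apply: exprn_gt0.
have yd : y ^+ (q1 - q2) <= y.
  by rewrite -{2}[y]expr1; apply: ler_wiXn2l; rewrite ?(ltW y0).
have yd0 : 0 < y ^+ (q1 - q2) by apply: exprn_gt0.
move: Q1; rewrite E qq -mulrA -{2}[y ^+ q2]mulr1 -mulrDr ler_pM2l //; nra.
Qed.

(** The difference of the two sums is [y ^+ p1 * ((1 - A) * (1 - B))] with the notation of [ratio],
    and both brackets have the sign of [1 - y]. *)
Let XgeY m : Y m.+1 <= X m.+1.
Proof.
have [Xm Ym] := pos m; rewrite XS YS ler_pM2l ?exprn_gt0 // -subr_ge0.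
have -> : Y m ^+ p1 + Y m ^+ p2 - (Y m ^+ q1 + Y m ^+ q2) =
   Y m ^+ p1 * ((1 - Y m ^+ (q1 - p1)) * (1 - Y m ^+ (q2 - p1))).
  have -> : Y m ^+ p2 = Y m ^+ p1 * (Y m ^+ (q1 - p1) * Y m ^+ (q2 - p1)).
    by rewrite -!exprD; congr (Y m ^+ _); lia.
  have -> : Y m ^+ q1 = Y m ^+ p1 * Y m ^+ (q1 - p1) by rewrite -exprD subnKC.
  have -> : Y m ^+ q2 = Y m ^+ p1 * Y m ^+ (q2 - p1) by rewrite -exprD subnKC.
  by ring.
rewrite mulr_ge0 ?exprn_ge0 ?(ltW Ym) //.
case: (leP (Y m) 1) => h.
  by rewrite mulr_ge0 // subr_ge0 exprn_ile1 // ltW.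
by rewrite mulr_le0 // subr_le0 exprn_ege1 // ltW.
Qed.

Section NonEscape.
Hypothesis nesc : forall m, ~ (1 < X m /\ 1 < Y m).

(** If [Y >= 1] then also [X >= 1] by [XgeY], and the sums of two powers push both coordinates to at
    least 2 at the next step. *)
Let Ylt1 m : Y m.+1 < 1.
Proof.
rewrite ltNge; apply/negP => Y1; have X1 := le_trans Y1 (XgeY m).
apply: (nesc (m := m.+2)); rewrite !(XS m.+1) !(YS m.+1);
  move: (X m.+1) (Y m.+1) X1 Y1 => x y x1 y1.
have yk k : 1 <= y ^+ k by apply: exprn_ege1.
have xx : 1 <= x ^+ 2 by apply: exprn_ege1.
have := yk p1; have := yk p2; have := yk q1; have := yk q2.
by split; nra.
Qed.

Let mono (x1 x2 y1 y2 : R) (a b : nat) : 0 < x1 -> 0 < y1 -> x1 <= x2 -> y1 <= y2 ->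
  x1 ^+ 2 * (y1 ^+ a + y1 ^+ b) <= x2 ^+ 2 * (y2 ^+ a + y2 ^+ b).
Proof.
move=> x0 y0 x12 y12; apply: ler_pM; rewrite ?exprn_ge0 ?addr_ge0 ?exprn_ge0 ?(ltW y0) ?(ltW x0) //.
  by rewrite lerXn2r // nnegrE ltW // (lt_le_trans x0).
by rewrite lerD // lerXn2r // nnegrE ltW // (lt_le_trans y0).
Qed.

Let conv := exists x y : R, X @ \oo --> x /\ Y @ \oo --> y.

(** The map is increasing in both coordinates, so a step that decreases both is followed by another
    such step; [step_up] is the mirror statement. *)
Let step_down k : X k.+1 <= X k -> Y k.+1 <= Y k -> X k.+2 <= X k.+1 /\ Y k.+2 <= Y k.+1.
Proof.
move=> hx hy; have [x0 y0] := pos k.+1.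
by rewrite (XS k.+1) (YS k.+1) [X in _ <= X /\ _]XS [X in _ /\ _ <= X]YS; split; apply: mono.
Qed.

Let step_up k : X k <= X k.+1 -> Y k <= Y k.+1 -> X k.+1 <= X k.+2 /\ Y k.+1 <= Y k.+2.
Proof.
move=> hx hy; have [x0 y0] := pos k.
by rewrite (XS k.+1) (YS k.+1) [X in X <= _ /\ _]XS [X in _ /\ X <= _]YS; split; apply: mono.
Qed.

Let conv_down m : X m.+1 <= X m -> Y m.+1 <= Y m -> conv.
Proof.
move=> dX dY.
have key j : X (j.+1 + m)%N <= X (j + m)%N /\ Y (j.+1 + m)%N <= Y (j + m)%N.
  by elim: j => [//|j]; rewrite !addSn => -[]; apply: step_down.
have [x Xx _] := ninc_cvg (fun j => (key j).1) (fun j => ltW (pos (j + m)%N).1).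
have [y Yy _] := ninc_cvg (fun j => (key j).2) (fun j => ltW (pos (j + m)%N).2).
by exists x, y.
Qed.

Let conv_up m : X m.+2 >= X m.+1 -> Y m.+2 >= Y m.+1 -> conv.
Proof.
move=> dX dY.
have key j : X (j + m.+1)%N <= X (j.+1 + m.+1)%N /\ Y (j + m.+1)%N <= Y (j.+1 + m.+1)%N.
  by elim: j => [//|j]; rewrite !(addSn _ m.+1) => -[]; apply: step_up.
have [Xm Ym] := pos m.+1.
have Yge j : Y m.+1 <= Y (j + m.+1)%N by elim: j => // j IH; apply: le_trans IH (key j).2.
pose c := Y m.+1 ^+ q1; have c0 : 0 < c by apply: exprn_gt0.
have [y Yy _] := ndec_cvg (fun j => (key j).2) (M := 1)
   (fun j => ltW (eq_ind _ (fun k => Y k < 1) (Ylt1 (j + m)) _ (esym (addnS j m)))).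
(* [X ^+ 2 * c] is at most the next [Y], hence at most 1; and a real is at most [1 +] its square. *)
have Xb j : X (j + m.+1)%N <= 1 + c^-1.
  have [x0 y0] := pos (j + m.+1).
  have h1 : X (j + m.+1)%N ^+ 2 * c <= 1.
    apply: le_trans (ltW (Ylt1 (j + m.+1))); rewrite YS ler_pM2l ?exprn_gt0 //.
    apply: (@le_trans _ _ (Y (j + m.+1)%N ^+ q1)); last by rewrite lerDl exprn_ge0 // ltW.
    by rewrite lerXn2r // nnegrE ltW.
  have h2 : X (j + m.+1)%N ^+ 2 <= c^-1 by rewrite -[c^-1]mul1r ler_pdivlMr.
  have := sqr_ge0 (X (j + m.+1)%N - 1); lra.
have [x Xx _] := ndec_cvg (fun j => (key j).1) Xb.
by exists x, y.
Qed.

Let conv_any : conv.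
Proof.
have [[m [h1 h2]]|nd] := pselect (exists m, X m.+2 <= X m.+1 /\ Y m.+2 <= Y m.+1);
  first exact: conv_down h1 h2.
have [[m [h1 h2]]|nu] := pselect (exists m, X m.+2 >= X m.+1 /\ Y m.+2 >= Y m.+1);
  first exact: conv_up h1 h2.
(* From here on every step moves the two coordinates in opposite directions; [tA] is the type in
   which [X] grows and [Y] shrinks. *)
pose tA m := X m.+1 <= X m.+2 /\ Y m.+2 <= Y m.+1.
have AB m : tA m \/ (X m.+2 <= X m.+1 /\ Y m.+1 <= Y m.+2).
  case: (lerP (X m.+1) (X m.+2)) => hx; case: (lerP (Y m.+1) (Y m.+2)) => hy.
  - by exfalso; apply: nu; exists m.
  - by left; split=> //; apply: ltW.
  - by right; split=> //; apply: ltW.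
  - by exfalso; apply: nd; exists m; split; apply: ltW.
have PQ m k l : 0 < Y m ^+ k + Y m ^+ l by rewrite addr_gt0 ?exprn_gt0 // (pos m).2.
have rE m : X m.+1 * (Y m ^+ q1 + Y m ^+ q2) = Y m.+1 * (Y m ^+ p1 + Y m ^+ p2).
  by rewrite XS YS; ring.
have cancelc (c u v : R) : 0 < c -> u * c <= v * c -> u <= v by move=> c0; rewrite ler_pM2r.
(* X / Y at the next step is a decreasing function of Y, so the type of a step persists *)
have cmpA m : Y m.+2 <= Y m.+1 -> X m.+2 * Y m.+3 <= X m.+3 * Y m.+2.
  move=> hy; have rr := ratio (pos m.+2).2 hy (ltW (Ylt1 m)).
  have r1 := rE m.+1; have r2 := rE m.+2; have c1 := PQ m.+1 q1 q2; have c2 := PQ m.+2 p1 p2.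
  apply: (cancelc ((Y m.+1 ^+ q1 + Y m.+1 ^+ q2) * (Y m.+2 ^+ p1 + Y m.+2 ^+ p2)));
    first exact: mulr_gt0.
  have -> : X m.+2 * Y m.+3 * ((Y m.+1 ^+ q1 + Y m.+1 ^+ q2) * (Y m.+2 ^+ p1 + Y m.+2 ^+ p2)) =
    (X m.+2 * (Y m.+1 ^+ q1 + Y m.+1 ^+ q2)) * (Y m.+3 * (Y m.+2 ^+ p1 + Y m.+2 ^+ p2)) by ring.
  rewrite r1 -r2.
  have -> : Y m.+2 * (Y m.+1 ^+ p1 + Y m.+1 ^+ p2) * (X m.+3 * (Y m.+2 ^+ q1 + Y m.+2 ^+ q2)) =
    X m.+3 * Y m.+2 * ((Y m.+1 ^+ p1 + Y m.+1 ^+ p2) * (Y m.+2 ^+ q1 + Y m.+2 ^+ q2)) by ring.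
  by rewrite [X in _ <= _ * X]mulrC ler_pM2l // mulr_gt0 ?(pos _).1 ?(pos _).2.
have cmpB m : Y m.+1 <= Y m.+2 -> X m.+3 * Y m.+2 <= X m.+2 * Y m.+3.
  move=> hy; have rr := ratio (pos m.+1).2 hy (ltW (Ylt1 m.+1)).
  have r1 := rE m.+1; have r2 := rE m.+2; have c1 := PQ m.+1 p1 p2; have c2 := PQ m.+2 q1 q2.
  apply: (cancelc ((Y m.+1 ^+ p1 + Y m.+1 ^+ p2) * (Y m.+2 ^+ q1 + Y m.+2 ^+ q2)));
    first exact: mulr_gt0.
  have -> : X m.+3 * Y m.+2 * ((Y m.+1 ^+ p1 + Y m.+1 ^+ p2) * (Y m.+2 ^+ q1 + Y m.+2 ^+ q2)) =
    (Y m.+2 * (Y m.+1 ^+ p1 + Y m.+1 ^+ p2)) * (X m.+3 * (Y m.+2 ^+ q1 + Y m.+2 ^+ q2)) by ring.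
  rewrite -r1 r2.
  have -> : X m.+2 * (Y m.+1 ^+ q1 + Y m.+1 ^+ q2) * (Y m.+3 * (Y m.+2 ^+ p1 + Y m.+2 ^+ p2)) =
    X m.+2 * Y m.+3 * ((Y m.+2 ^+ p1 + Y m.+2 ^+ p2) * (Y m.+1 ^+ q1 + Y m.+1 ^+ q2)) by ring.
  by rewrite ler_pM2l // mulr_gt0 ?(pos _).1 ?(pos _).2.
have stepA m : tA m -> tA m.+1.
  move=> [hx hy]; case: (AB m.+1) => // -[hx' hy']; exfalso; apply: nd; exists m.+1; split=> //.
  have [x2 y2] := pos m.+2; have h := cmpA m hy.
  rewrite leNgt; apply/negP => lt; have : X m.+3 * Y m.+2 < X m.+2 * Y m.+3.
    apply: (@le_lt_trans _ _ (X m.+2 * Y m.+2)); first by rewrite ler_pM2r.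
    by rewrite ltr_pM2l.
  by rewrite ltNge h.
have stepB m : X m.+2 <= X m.+1 /\ Y m.+1 <= Y m.+2 -> X m.+3 <= X m.+2 /\ Y m.+2 <= Y m.+3.
  move=> [hx hy]; case: (AB m.+1) => // -[hx' hy']; exfalso; apply: nd; exists m.+1; split=> //.
  have [x2 y2] := pos m.+2; have [x3 y3] := pos m.+3; have h := cmpB m hy.
  rewrite leNgt; apply/negP => lt; have : X m.+2 * Y m.+3 < X m.+3 * Y m.+2.
    apply: (@le_lt_trans _ _ (X m.+2 * Y m.+2)); first by rewrite ler_pM2l.
    by rewrite ltr_pM2r.
  by rewrite ltNge h.
have s1 j : (j + 1)%N = j.+1 by rewrite addn1.
case: (AB 0%N) => h0.
  have allA j : tA j by elim: j => // j; apply: stepA.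
  (* In this case the lower bound on [Y] is also what bounds [X] from above. *)
  have Yb j : 1 / 3 <= Y j.+1.
    have [hx hy] := allA j; have [x0 y0] := pos j.+1; rewrite (XS j.+1) in hx;
      rewrite (YS j.+1) in hy.
    exact: (third x0 y0 (ltW (Ylt1 j)) hx hy).
  pose c : R := (1 / 3) ^+ q2; have c0 : 0 < c by apply: exprn_gt0; lra.
  have Xb j : X (j + 1)%N <= 1 + c^-1.
    rewrite s1; have [_ hy] := allA j; have [x0 y0] := pos j.+1; rewrite YS in hy.
    have h1 : X j.+1 ^+ 2 * c <= 1.
      apply: le_trans (ltW (Ylt1 j)); apply: le_trans hy; rewrite ler_pM2l ?exprn_gt0 //.
      apply: (@le_trans _ _ (Y j.+1 ^+ q2)); last by rewrite lerDr exprn_ge0 // ltW.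
      by rewrite lerXn2r // nnegrE ?ltW //; lra.
    have h2 : X j.+1 ^+ 2 <= c^-1 by rewrite -[c^-1]mul1r ler_pdivlMr.
    have := sqr_ge0 (X j.+1 - 1); lra.
  have [x Xx _] : exists2 x, X @ \oo --> x & forall j, X (j + 1)%N <= x.
    by apply: ndec_cvg Xb => j; rewrite !s1; exact: (allA j).1.
  have [y Yy _] : exists2 y, Y @ \oo --> y & forall j, y <= Y (j + 1)%N.
    apply: (ninc_cvg (M := 0)) => j; rewrite !s1; first exact: (allA j).2.
    exact: ltW (pos _).2.
  by exists x, y.
have allB j : X j.+2 <= X j.+1 /\ Y j.+1 <= Y j.+2 by elim: j => // j; apply: stepB.
have [x Xx _] : exists2 x, X @ \oo --> x & forall j, x <= X (j + 1)%N.
  apply: (ninc_cvg (M := 0)) => j; rewrite !s1; first exact: (allB j).1.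
  exact: ltW (pos _).1.
have [y Yy _] : exists2 y, Y @ \oo --> y & forall j, Y (j + 1)%N <= y.
  apply: (ndec_cvg (M := 1)) => j; rewrite !s1; first exact: (allB j).2.
  exact: ltW (Ylt1 j).
by exists x, y.
Qed.

Lemma cyclic_limit : (forall m, ~ (X m < 1 / 4 /\ Y m < 1 / 4)) ->
  exists x y : R, [/\ X @ \oo --> x, Y @ \oo --> y & cyclic_fixed x y].
Proof.
move=> nsm; have [x [y [Xx Yy]]] := conv_any; exists x, y; split=> //.
have x0 : 0 <= x by apply: (cvgr_to_ge Xx); apply: nearW => m; rewrite ltW // (pos m).1.
have y0 : 0 <= y by apply: (cvgr_to_ge Yy); apply: nearW => m; rewrite ltW // (pos m).2.
have cvgP_ a b : (fun m => X m ^+ 2 * (Y m ^+ a + Y m ^+ b)) @ \oo --> x ^+ 2 * (y ^+ a + y ^+ b).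
  by apply: cvgM; [exact: cvg_exprn | apply: cvgD; exact: cvg_exprn].
have xE : x = x ^+ 2 * (y ^+ p1 + y ^+ p2).
  by apply: (cvgr_unique (cvgS Xx)); rewrite (funext XS); exact: cvgP_.
have yE : y = x ^+ 2 * (y ^+ q1 + y ^+ q2).
  by apply: (cvgr_unique (cvgS Yy)); rewrite (funext YS); exact: cvgP_.
have xp : 0 < x.
  (* If [x] vanished, [y] would vanish too, and the orbit would fall below the threshold [1 / 4]. *)
  rewrite lt_neqAle x0 andbT; apply/negP => /eqP x00.
  have y00 : y = 0 by rewrite yE -x00 expr0n mul0r.
  have q4 : 0 < 1 / 4 :> R by lra.
  have [m1 h1] : exists m, forall j, (m <= j)%N -> X j < 1 / 4.
    by apply: cvg_eventually_lt Xx _; rewrite -x00.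
  have [m2 h2] : exists m, forall j, (m <= j)%N -> Y j < 1 / 4.
    by apply: cvg_eventually_lt Yy _; rewrite y00.
  by apply: (nsm (m1 + m2)%N); rewrite h1 ?leq_addr // h2 // leq_addl.
have yp : 0 < y.
  rewrite lt_neqAle y0 andbT; apply/negP => /eqP y00; move: xE.
  rewrite -y00 !expr0n; have /negPf -> : p1 != 0%N by lia.
  have /negPf -> : p2 != 0%N by lia.
  by rewrite addr0 mulr0 => xz; rewrite xz ltxx in xp.
have P1 : x * (y ^+ p1 + y ^+ p2) = 1.
  have xn : x != 0 by rewrite gt_eqF.
  by apply: (mulfI xn); rewrite mulr1 mulrA -expr2 -xE.
split=> //.
have Q1 : y * (y ^+ p1 + y ^+ p2) ^+ 2 = y ^+ q1 + y ^+ q2.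
  rewrite {1}yE mulrAC -exprMn P1 expr1n mul1r; by [].
set d := (p2 - p1)%N; set f := (q1 - q2)%N.
have E1 : (p2 + q1 - p1 - q2)%N = (d + f)%N by rewrite /d /f; lia.
have E2 : (2 * d + q1 - q2)%N = (2 * d + f)%N by rewrite /f; lia.
have yn : y ^+ q2 != 0 by rewrite gt_eqF ?exprn_gt0.
rewrite E1 E2; apply: (mulfI yn); rewrite mulr1.
have E3 : y * (y ^+ p1 + y ^+ p2) ^+ 2 = y ^+ q2 * (y ^+ f * (1 + y ^+ d) ^+ 2).
  have -> : y ^+ p2 = y ^+ p1 * y ^+ d by rewrite -exprD; congr (y ^+ _); rewrite /d; lia.
  have -> : y ^+ q2 * (y ^+ f * (1 + y ^+ d) ^+ 2) = y ^+ q1 * (1 + y ^+ d) ^+ 2.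
    by rewrite mulrA -exprD; congr (y ^+ _ * _); rewrite /f; lia.
  by rewrite hq (exprS y (2 * p1)) mulnC exprM; ring.
have E4 : y ^+ q1 = y ^+ q2 * y ^+ f by rewrite -exprD; congr (y ^+ _); rewrite /f; lia.
move: Q1; rewrite E3 E4 exprD [y ^+ (2 * d + f)]exprD mulnC exprM => Q1.
have {}Q1 : y ^+ q2 * (y ^+ f * (1 + y ^+ d) ^+ 2) - y ^+ q2 * y ^+ f = y ^+ q2 by rewrite Q1; ring.
by rewrite -{2}Q1; ring.
Qed.

End NonEscape.
Lemma cyclic_trichotomy :
  [\/ exists m, 1 < X m /\ 1 < Y m,
      exists m, X m < 1 / 4 /\ Y m < 1 / 4
    | exists x y : R, [/\ X @ \oo --> x, Y @ \oo --> y & cyclic_fixed x y]].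
Proof.
have [h|nesc] := pselect (exists m, 1 < X m /\ 1 < Y m); first by constructor 1.
have [h|nsm] := pselect (exists m, X m < 1 / 4 /\ Y m < 1 / 4); first by constructor 2.
constructor 3; apply: cyclic_limit => m h; [by apply: nesc; exists m | by apply: nsm; exists m].
Qed.

End CyclicDynamics.

(** * The recursion for N = 3 *)

Section TriangleDynamics.
Variables (R : realType) (X x : R^nat).
Hypotheses (x0 : 0 < x 0%N) (xX : x 0%N < X 0%N).
Hypothesis XS : forall m, X m.+1 = X m ^+ 2 + X m * (2 * x m * X m - x m ^+ 2).
Hypothesis xS : forall m, x m.+1 = X m ^+ 2 + x m * (2 * x m * X m - x m ^+ 2).

Let pos m : 0 < x m < X m.
Proof.
elim: m => [|m]; first by rewrite x0.
rewrite XS xS; move: (X m) (x m) => a b /andP[b0 ba].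
have c0 : 0 < 2 * b * a - b ^+ 2 by nra.
by apply/andP; split; nra.
Qed.

(** [X - x] counts the crossings through the third corner. It is multiplied by one factor, which
    lies between [x ^+ 2] and [X ^+ 2]. *)
Let visitS m : X m.+1 - x m.+1 = (X m - x m) * (2 * x m * X m - x m ^+ 2).
Proof. by rewrite XS xS; ring. Qed.

(** By the lower bound on the factor in [visitS], [x] is multiplied by at least [x + x ^+ 2]. *)
Lemma triangle_escape m : 1 < x m + x m ^+ 2 ->
  x @ \oo --> +oo /\ (fun k => X k - x k) @ \oo --> +oo.
Proof.
set g := x m + x m ^+ 2 => g1.
have growS k : x k * (x k + x k ^+ 2) <= x k.+1.
  by have /andP[] := pos k; rewrite xS; move: (X k) (x k) => a b b0 ba; nra.
have key j : x m * g ^+ j <= x (j + m)%N.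
  elim: j => [|j IH]; first by rewrite mulr1.
  have /andP[p0 _] := pos (j + m); have /andP[pm _] := pos m.
  have le : x m <= x (j + m)%N.
    by apply: le_trans IH; rewrite ler_peMr ?(ltW pm) // exprn_ege1 // ltW.
  rewrite addSn; apply: le_trans (growS _); rewrite exprSr mulrA; apply: ler_pM => //.
  - by rewrite mulr_ge0 ?exprn_ge0 // ?ltW // (lt_trans _ g1).
  - by rewrite ltW // (lt_trans _ g1).
  - by rewrite lerD // lerXn2r // nnegrE ltW.
have xoo : x @ \oo --> +oo.
  apply: (@geo_infty' _ x m (x m) g) => //; by have /andP[] := pos m.
split=> //.
have [M HM] := infty_eventually_gt 2 xoo.
have /andP[xM xXM] := pos M; have yM : 0 < X M - x M by rewrite subr_gt0.
apply: (@geo_infty _ _ M (X M - x M)) => // j; elim: j => [|j IH]; first by rewrite mulr1.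
rewrite addSn visitS; have := HM (j + M)%N (leq_addl _ _); have /andP[p0 p1] := pos (j + M).
rewrite exprSr mulrA; move: IH p0 p1; move: (X (j + M)%N) (x (j + M)%N) => a b IH b0 ba b2.
by apply: ler_pM => //; [rewrite mulr_ge0 ?exprn_ge0 ?ltW | nra].
Qed.

(** By the upper bound on the factor in [visitS], [X] is multiplied by at most [X + X ^+ 2]. *)
Lemma triangle_vanish m : X m + X m ^+ 2 < 1 ->
  x @ \oo --> (0 : R) /\ (fun k => X k - x k) @ \oo --> (0 : R).
Proof.
set g := X m + X m ^+ 2 => g1; have /andP[xm xXm] := pos m; have Xm := lt_trans xm xXm.
have g0 : 0 < g by rewrite /g addr_gt0 ?exprn_gt0.
have key j : X (j + m)%N <= X m * g ^+ j.
  elim: j => [|j IH]; first by rewrite mulr1.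
  have /andP[p0 p1] := pos (j + m); have p2 := lt_trans p0 p1.
  have le : X (j + m)%N <= X m.
    by apply: le_trans IH _; rewrite ler_piMr ?(ltW Xm) // exprn_ile1 ?(ltW g0) ?(ltW g1).
  have H : X (j + m).+1 <= X (j + m)%N * (X (j + m)%N + X (j + m)%N ^+ 2).
    rewrite XS; move: (X _) (x (j + m)%N) p0 p1 {IH le p2} => a b b0 ba.
    have : 0 <= (a - b) ^+ 2 * a by rewrite mulr_ge0 ?sqr_ge0 // ltW // (lt_trans b0).
    by lra.
  rewrite addSn; apply: le_trans H _; rewrite (exprSr g) mulrA; apply: ler_pM => //.
  - exact: ltW.
  - by rewrite addr_ge0 ?exprn_ge0 // ltW.
  - by rewrite lerD // lerXn2r // nnegrE ltW.
have gr : 0 <= g < 1 by rewrite g1 ltW.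
by split; apply: (@geo_zero _ _ m (X m) g) => // j; apply/andP; have /andP[] := pos (j + m);
  have := key j; lra.
Qed.

(** The two assumptions enclose the orbit, [x <= t <= X]. The ratio [(X - x) / x] is at least halved
    at each step, because [x <= 1] and the factor in [visitS] is at most [X ^+ 2]. So [X - x] tends
    to zero, which squeezes [x] to [t]. *)
Lemma triangle_limit (t : R) : 0 < t -> t + t ^+ 2 = 1 ->
  (forall m, ~ 1 < x m + x m ^+ 2) -> (forall m, ~ X m + X m ^+ 2 < 1) ->
  x @ \oo --> t /\ (fun k => X k - x k) @ \oo --> (0 : R).
Proof.
move=> t0 tE nesc nsm.
have xt m : x m <= t.
  have /andP[p0 _] := pos m; rewrite leNgt; apply/negP => tx; apply: (nesc m).
  by rewrite -tE ltrD // ltrXn2r // ?nnegrE ltW.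
have tX m : t <= X m.
  have /andP[p0 p1] := pos m; rewrite leNgt; apply/negP => Xt; apply: (nsm m).
  by rewrite -tE ltrD // ltrXn2r // ?nnegrE ltW // (lt_trans p0).
have t1 : t <= 1 by have := sqr_ge0 t; lra.
have key j : X j - x j <= x j * ((X 0%N - x 0%N) / x 0%N) * (1 / 2) ^+ j.
  elim: j => [|j IH]; first by rewrite mulr1 mulrCA divff ?mulr1 // gt_eqF.
  set K := (X 0%N - _) / _ in IH *; set h := (1 / 2) ^+ j in IH.
  have h0 : 0 <= h by rewrite exprn_ge0 // divr_ge0.
  have K0 : 0 <= K by rewrite divr_ge0 ?subr_ge0 ?(ltW xX) ?(ltW x0).
  rewrite visitS xS; have := xt j; have /andP[] := pos j.
  move: IH; move: (X j) (x j) => a b IH b0 ba bt.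
  set c := 2 * b * a - b ^+ 2.
  have c0 : 0 < c by rewrite /c; nra.
  have ca : c <= a ^+ 2 by rewrite /c; have := sqr_ge0 (a - b); lra.
  have Kh : 0 <= K * h by rewrite mulr_ge0.
  apply: (@le_trans _ _ (b * K * h * c)); first by rewrite ler_pM2r.
  have bc : b * c <= c by rewrite ler_piMl ?(ltW c0) //; lra.
  have h2 : 2 * (b * c) <= a ^+ 2 + b * c by lra.
  by rewrite (exprSr (1 / 2)) -/h; have := ler_wpM2l Kh h2; lra.
have yto : (fun k => X k - x k) @ \oo --> (0 : R).
  apply: (@geo_zero _ _ 0 (t * ((X 0%N - x 0%N) / x 0%N)) (1 / 2)); first by apply/andP; lra.
  move=> j; rewrite addn0; have /andP[p0 p1] := pos j; rewrite subr_ge0 ltW //=.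
  apply: le_trans (key j) _; rewrite ler_wpM2r ?exprn_ge0 ?divr_ge0 //.
  by rewrite ler_wpM2r // divr_ge0 ?subr_ge0 // ltW.
split=> //.
apply: (@squeeze_cvgr _ _ _ _ (fun k => t - (X k - x k)) (cst t)); last exact: cvg_cst.
  by apply: nearW => m /=; have := xt m; have := tX m; move=> ? ?; apply/andP; split; lra.
by rewrite -[X in _ --> X]subr0; apply: cvgB => //; exact: cvg_cst.
Qed.

End TriangleDynamics.

Lemma contract_cvg0 (R : realType) (d : R^nat) (K r : R) : 0 <= r < 1 ->
  (forall e, 0 < e -> exists m, forall j, (m <= j)%N -> 0 <= d j <= K /\ d j.+1 <= r * d j + e) ->
  d @ \oo --> (0 : R).
Proof.
move=> /andP[r0 r1] H; apply/cvgr0Pnorm_lt => e e0.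
(* Errors of this size, summed against the powers of [r], accumulate to at most [e / 2]. *)
have e1 : 0 < e * (1 - r) / 2 by rewrite divr_gt0 // mulr_gt0 // subr_gt0.
have [m Hm] := H _ e1.
have K0 : 0 <= K by have [/andP[h1 h2] _] := Hm m (leqnn m); apply: le_trans h2.
have key j : d (j + m)%N <= K * r ^+ j + e / 2.
  elim: j => [|j IH].
    by have [/andP[_ h] _] := Hm m (leqnn m); rewrite add0n mulr1; lra.
  have [_ h] := Hm (j + m)%N (leq_addl _ _); apply: le_trans h _.
  have := ler_wpM2l r0 IH; rewrite (exprS r) => h; lra.
have g0 : geometric K r @ \oo --> 0 by apply: cvg_geometric; rewrite ger0_norm.
have e2 : 0 < e / 2 by rewrite divr_gt0.
have [M HM] := cvg_eventually_lt g0 e2.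
exists (M + m)%N => //= j /= Mj.
have [/andP[h1 _] _] := Hm j (leq_trans (leq_addl _ _) Mj).
rewrite ger0_norm //; have mj : (m <= j)%N by apply: leq_trans (leq_addl _ _) Mj.
have := key (j - m)%N; rewrite subnK // => h.
have := HM (j - m)%N; rewrite leq_subRL // addnC => /(_ Mj) /= h'; lra.
Qed.

(** * The recursion for N = 5 *)

Section PentagonDynamics.
Variables (R : realType) (X Y x y : R^nat).
Hypotheses (x0 : 0 < x 0%N) (xX : x 0%N < X 0%N) (y0 : 0 < y 0%N) (yY : y 0%N < Y 0%N).
Hypothesis XS : forall m, X m.+1 = X m ^+ 2 * (Y m + Y m ^+ 2).
Hypothesis YS : forall m, Y m.+1 = Y m ^+ 3 * (2 * x m * X m - x m ^+ 2) + X m ^+ 2.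
Hypothesis xS : forall m, x m.+1 = X m ^+ 2 * (Y m + Y m * y m).
Hypothesis yS : forall m, y m.+1 = Y m ^+ 2 * y m * (2 * x m * X m - x m ^+ 2) + X m ^+ 2.

Let pos m : 0 < x m < X m /\ 0 < y m < Y m.
Proof.
elim: m => [|m]; first by rewrite x0 y0.
rewrite XS YS xS yS; move: (X m) (x m) (Y m) (y m) => A a B b [/andP[a0 aA] /andP[b0 bB]].
have A0 := lt_trans a0 aA; have B0 := lt_trans b0 bB.
have A2 : 0 < A ^+ 2 by apply: exprn_gt0.
have c0 : 0 < 2 * a * A - a ^+ 2 by nra.
have B2 : 0 < B ^+ 2 * (2 * a * A - a ^+ 2) by rewrite mulr_gt0 ?exprn_gt0.
split; apply/andP; split.
- by rewrite mulr_gt0 // addr_gt0 // mulr_gt0.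
- by rewrite ltr_pM2l // expr2 ltrD2l ltr_pM2l.
- by rewrite addr_gt0 // mulr_gt0 // mulr_gt0 ?exprn_gt0.
- by rewrite ltrD2r ltr_pM2r // (exprSr B 2) ltr_pM2l ?exprn_gt0.
Qed.

(** [t] is the proportion of the crossings counted by [Y] that visit the third corner, and [c] is
    the weight of the dependent end pieces relative to [X ^+ 2]. The totals follow
    [X' = X ^+ 2 * (Y + Y ^+ 2)], [Y' = X ^+ 2 * (1 + c * Y ^+ 3)]; as [t] tends to zero, [c] tends
    to 1 and the system becomes autonomous. *)
Let c m := 1 - (1 - x m / X m) ^+ 2.
Let t m := 1 - y m / Y m.

Let X_gt0 m : 0 < X m. Proof. by have [/andP[h /(lt_trans h)]] := pos m. Qed.
Let Y_gt0 m : 0 < Y m. Proof. by have [_ /andP[h /(lt_trans h)]] := pos m. Qed.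

Let xE m : x m = X m * (x m / X m).
Proof. by rewrite mulrC divfK // gt_eqF. Qed.

Let yE m : y m = Y m * (1 - t m).
Proof. by rewrite /t opprB addrCA subrr addr0 mulrC divfK // gt_eqF. Qed.

Let t_bd m : 0 < t m < 1.
Proof.
have [_ /andP[h1 h2]] := pos m; rewrite /t; apply/andP; split.
  by rewrite subr_gt0 ltr_pdivrMr // mul1r.
by rewrite ltrBlDr ltrDl divr_gt0.
Qed.

Let c_bd m : 0 < c m < 1.
Proof.
have [/andP[h1 h2] _] := pos m.
have q0 : 0 < x m / X m by rewrite divr_gt0.
have q1 : x m / X m < 1 by rewrite ltr_pdivrMr // mul1r.
by rewrite /c; move: (x m / X m) q0 q1 => q q0 q1; apply/andP; split; nra.
Qed.

Let cE m : 2 * x m * X m - x m ^+ 2 = X m ^+ 2 * c m.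
Proof. by rewrite [x m]xE /c; ring. Qed.

Let YSc m : Y m.+1 = X m ^+ 2 * (1 + c m * Y m ^+ 3).
Proof. by rewrite YS cE; ring. Qed.

Let cS m : c m.+1 = 1 - (Y m * t m / (1 + Y m)) ^+ 2.
Proof.
have Y0 := Y_gt0 m; have X0 := X_gt0 m; rewrite /c; congr (1 - _ ^+ 2).
rewrite xS XS [y m]yE; field; apply/and3P; split; rewrite ?gt_eqF //; first by lra.
by rewrite addr_gt0 // exprn_gt0.
Qed.

Let tS m : t m.+1 = t m * (c m * Y m ^+ 3 / (1 + c m * Y m ^+ 3)).
Proof.
have Y0 := Y_gt0 m; have X0 := X_gt0 m; have /andP[c0 c1] := c_bd m.
have cY : 0 < c m * Y m ^+ 3 by rewrite mulr_gt0 // exprn_gt0.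
rewrite {1}/t YSc yS cE [y m]yE; field; rewrite ?gt_eqF //=; lra.
Qed.

Let tS_le m : t m.+1 <= t m.
Proof.
have /andP[t0 t1] := t_bd m; have /andP[c0 c1] := c_bd m.
rewrite tS ler_piMr // ?(ltW t0) //.
have cY : 0 < c m * Y m ^+ 3 by rewrite mulr_gt0 // exprn_gt0.
by rewrite ler_pdivrMr ?mul1r ?lerDr //; lra.
Qed.

(** The deficit [1 - c] is the square of a number at most [t], and [t] never increases; so [c] stays
    away from zero. *)
Let c_ge m : 1 - t 0%N <= c m.+1.
Proof.
have tm : t m <= t 0%N by elim: m => // m; apply: le_trans.
have /andP[t0 t1] := t_bd 0; have /andP[s0 s1] := t_bd m; have Y0 := Y_gt0 m.
have q0 : 0 < Y m * t m / (1 + Y m) by rewrite divr_gt0 ?mulr_gt0 //; lra.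
have q1 : Y m * t m / (1 + Y m) <= t m.
  by rewrite ler_pdivrMr; [nra | lra].
by rewrite cS; move: (Y m * _ / _) q0 q1 => q q0 q1; nra.
Qed.

Let yS_ge m : X m ^+ 2 <= y m.+1.
Proof.
have [/andP[h1 h2] /andP[h3 h4]] := pos m; have /andP[c0 c1] := c_bd m.
by rewrite yS cE lerDr !mulr_ge0 ?exprn_ge0 ?ltW.
Qed.

Let visitX m : X m.+1 - x m.+1 = X m ^+ 2 * Y m * (Y m - y m).
Proof. by rewrite XS xS; ring. Qed.

Let visitY m : Y m.+1 - y m.+1 = X m ^+ 2 * c m * Y m ^+ 2 * (Y m - y m).
Proof. by rewrite YS yS cE; ring. Qed.

Definition pentagon_infinite := [/\ x @ \oo --> +oo, (fun m => X m - x m) @ \oo --> +oo,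
  y @ \oo --> +oo & (fun m => Y m - y m) @ \oo --> +oo].
Definition pentagon_cvg (a b : R) := [/\ x @ \oo --> a, (fun m => X m - x m) @ \oo --> (0 : R),
  y @ \oo --> b & (fun m => Y m - y m) @ \oo --> (0 : R)].

(** As long as [Y >= 1], [X] at least doubles. The other sequences are then eventually bounded below
    by [X], except [Y - y], which grows by its own recursion [visitY]. *)
Lemma pentagon_escape m : 1 < X m -> 1 < Y m -> pentagon_infinite.
Proof.
move=> X1 Y1; have mul1 (p q : R) : 1 <= p -> 1 <= q -> 1 <= p * q by nra.
have key j : 2 ^+ j <= X (j + m.+1)%N /\ 1 <= Y (j + m.+1)%N.
  elim: j => [|j [IX IY]].
    rewrite expr0 !add0n XS YSc; have /andP[c0 c1] := c_bd m.
    have := exprn_ege1 3 (ltW Y1); have := exprn_ege1 2 (ltW X1).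
    have := exprn_ege1 2 (ltW Y1).
    move: (X m ^+ 2) (Y m ^+ 3) (Y m ^+ 2) => u v w hw hu hv.
    by split; apply: mul1 => //; nra.
  rewrite addSn XS YSc (exprS 2); have /andP[c0 c1] := c_bd (j + m.+1).
  move: (X _) (Y _) IX IY => a b IX IY.
  have two : 1 <= 2 ^+ j :> R by apply: exprn_ege1; rewrite ler1n.
  have a1 : 1 <= a by apply: le_trans IX.
  have := exprn_ege1 3 IY; have := exprn_ege1 2 IY.
  move: (b ^+ 3) (b ^+ 2) => b3 b2 h2 h3.
  have aa : a <= a ^+ 2 by rewrite expr2; nra.
  split; last by apply: mul1; nra.
  by rewrite mulrC; apply: ler_pM => //; lra.
have Xoo : X @ \oo --> +oo.
  by apply: (@geo_infty _ _ m.+1 1) => // j; rewrite mul1r; exact: (key j).1.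
have Y1' j : (m.+1 <= j)%N -> 1 <= Y j.
  by move=> mj; have [_] := key (j - m.+1)%N; rewrite subnK.
have /andP[t0 t1] := t_bd 0; have d0 : 0 < 1 - t 0%N by lra.
have lower u M : (forall j, (M <= j)%N -> X j <= u j.+1) -> u @ \oo --> +oo.
  move=> H; apply/cvgryPge => A; have [M' HM'] := infty_eventually_gt A Xoo.
  exists (M + M').+1 => //= -[//|j]; rewrite /= ltnS => Mj.
  apply: le_trans (H j (leq_trans (leq_addr _ _) Mj)).
  by apply: ltW; apply: HM'; apply: leq_trans (leq_addl _ _) Mj.
have Yyoo : (fun m => Y m - y m) @ \oo --> +oo.
  (* This threshold makes the factor [X ^+ 2 * c * Y ^+ 2] of [visitY] at least 2, given
     [c >= 1 - t 0] and [Y >= 1]. *)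
  have [M HM] := infty_eventually_gt (1 + 2 / (1 - t 0%N)) Xoo.
  have [_ /andP[_ yYM]] := pos (M + m.+1).
  apply: (@geo_infty _ _ (M + m.+1) (Y (M + m.+1)%N - y (M + m.+1)%N)) => //.
    by rewrite subr_gt0.
  elim=> [|j IH]; first by rewrite mulr1.
  rewrite addSn visitY (exprSr 2) mulrA; set k := (j + (M + m.+1))%N in IH *.
  have Mk : (M <= k)%N by apply: leq_trans (leq_addr m.+1 _) (leq_addl _ _).
  have mk : (m.+1 <= k)%N by apply: leq_trans (leq_addl M _) (leq_addl _ _).
  have hY := Y1' k mk; have hX := HM k Mk.
  have hc := c_ge k.-1; rewrite prednK in hc; last exact: leq_trans mk.
  have [_ /andP[_ yYk]] := pos k.
  have q0 : 0 < 2 / (1 - t 0%N) by rewrite divr_gt0.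
  have X1k : 1 <= X k by lra.
  have Xc : 2 <= X k ^+ 2 * c k * Y k ^+ 2.
    have h1 : 2 <= X k * c k.
      apply: (@le_trans _ _ (2 / (1 - t 0%N) * (1 - t 0%N))); first by rewrite divfK ?gt_eqF.
      by apply: ler_pM => //; lra.
    have h2 : X k * c k <= X k ^+ 2 * c k by rewrite ler_pM2r ?(andP (c_bd k)).1 // expr2
      ler_peMr // ltW.
    have h3 := exprn_ege1 2 hY.
    by move: (X k ^+ 2 * c k) (X k * c k) (Y k ^+ 2) h1 h2 h3 => u v w; nra.
  rewrite mulrC; apply: ler_pM => //.
  by rewrite mulr_ge0 ?exprn_ge0 // subr_ge0 ltW.
have Xsq j : (m.+1 <= j)%N -> X j <= X j ^+ 2.
  move=> mj; have := (key (j - m.+1)%N).1; rewrite subnK // => h.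
  have two : 1 <= 2 ^+ (j - m.+1) :> R by apply: exprn_ege1; rewrite ler1n.
  by rewrite expr2 ler_peMr ?(ltW (X_gt0 _)) //; apply: le_trans h.
split=> //.
- apply: (lower _ m.+1) => j mj; rewrite xS; have := Xsq j mj; have := Y1' j mj.
  have [_ /andP[]] := pos j; have := X_gt0 j; move: (X j) (Y j) (y j) => a b e a0 e0 eb b1 aa.
  by apply: le_trans aa _; rewrite ler_peMr ?exprn_ge0 ?ltW //; nra.
- have [M HM] := infty_eventually_gt 1 Yyoo.
  apply: (lower _ (M + m.+1)%N) => j mj; rewrite visitX.
  have Mj : (M <= j)%N by apply: leq_trans (leq_addr m.+1 _) mj.
  have {}mj : (m.+1 <= j)%N by apply: leq_trans (leq_addl M _) mj.
  have hX := Xsq j mj; have hY := Y1' j mj; have hM := HM j Mj.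
  by apply: le_trans hX _; rewrite -mulrA ler_peMr ?exprn_ge0 ?(ltW (X_gt0 _)) //; nra.
- by apply: (lower _ m.+1) => j mj; apply: le_trans (Xsq j mj) (yS_ge j).
Qed.

Variables (a b : R).
Hypotheses (b0 : 0 < b) (bE : b ^+ 5 + 2 * b ^+ 4 = 1) (aE : a = (b * (1 + b))^-1).

(** This enclosure, and the bound [a < 3 / 4] drawn from it, feed the slope estimate of
    [contraction]. *)
Let b_bd : 77 / 100 < b < 78 / 100.
Proof.
have m4 u v : 0 <= u -> u <= v -> u ^+ 5 + 2 * u ^+ 4 <= v ^+ 5 + 2 * v ^+ 4 :> R.
  move=> u0 uv; have v0 := le_trans u0 uv.
  by apply: lerD; rewrite ?ler_pM2l // lerXn2r.
apply/andP; split; rewrite ltNge; apply/negP => h.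
  have := m4 _ _ (ltW b0) h; rewrite bE; lra.
have h0 : 0 <= 78 / 100 :> R by lra.
have := m4 _ _ h0 h; rewrite bE; lra.
Qed.

Let a_bd : 0 < a < 3 / 4.
Proof.
have /andP[h1 h2] := b_bd; have bb : 0 < b * (1 + b) by nra.
rewrite aE invr_gt0 bb /=.
by rewrite -[X in X < _]mul1r ltr_pdivrMr //; nra.
Qed.

Let a_fix : a ^+ 2 * (b + b ^+ 2) = a.
Proof.
have /andP[h1 h2] := b_bd; rewrite aE; field; rewrite !gt_eqF //; lra.
Qed.

Let ab1 : a * (b * (1 + b)) = 1.
Proof. by have /andP[h1 h2] := b_bd; rewrite aE mulVf // gt_eqF // mulr_gt0 //; lra. Qed.

Let b_fix : a ^+ 2 * (1 + b ^+ 3) = b.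
Proof.
have E : b * (b * (1 + b)) ^+ 2 = 1 + b ^+ 3.
  have -> : 1 + b ^+ 3 = b ^+ 5 + 2 * b ^+ 4 + b ^+ 3 by rewrite bE.
  by ring.
rewrite -E; have -> : a ^+ 2 * (b * (b * (1 + b)) ^+ 2) = b * (a * (b * (1 + b))) ^+ 2 by ring.
by rewrite ab1 expr1n mulr1.
Qed.

(** The map with [c = 1] dominates the true one and fixes [(a, b)]. Both components carry a factor
    [X ^+ 2], so below [(a, b)] a relative bound [s] improves to [s * s]. *)
Lemma pentagon_vanish m : X m < a -> Y m < b -> pentagon_cvg 0 0.
Proof.
move=> Xa Yb; have /andP[a0 a1] := a_bd; have /andP[b1 b2] := b_bd.
pose r := Num.max (X m / a) (Y m / b).
have r0 : 0 < r by rewrite lt_max divr_gt0.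
have r1 : r < 1 by rewrite gt_max !ltr_pdivrMr // !mul1r Xa.
have key j : X (j + m)%N <= a * r ^+ j.+1 /\ Y (j + m)%N <= b * r ^+ j.+1.
  elim: j => [|j [IX IY]].
    by rewrite !add0n expr1 ![_ * r]mulrC -!ler_pdivrMr // !le_max !lexx orbT.
  set s := r ^+ j.+1 in IX IY *.
  have s0 : 0 < s by apply: exprn_gt0.
  have sr : s <= r by rewrite /s exprS ler_piMr ?exprn_ile1 ?(ltW r0) ?(ltW r1).
  have /andP[c0 c1] := c_bd (j + m).
  have XX : X (j + m)%N ^+ 2 <= a ^+ 2 * (s * s).
    rewrite -expr2 -exprMn lerXn2r // nnegrE; first exact: ltW.
    by rewrite mulr_ge0 // ltW.
  have Y0 := Y_gt0 (j + m); have s1 : s < 1 by apply: le_lt_trans r1.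
  have Yb' : Y (j + m)%N <= b by apply: le_trans IY _; rewrite ler_piMr ?ltW.
  have Y2 : Y (j + m)%N ^+ 2 <= b ^+ 2 by rewrite lerXn2r // nnegrE ltW.
  have Y3 : Y (j + m)%N ^+ 3 <= b ^+ 3 by rewrite lerXn2r // nnegrE ltW.
  have Y3' : 0 <= Y (j + m)%N ^+ 3 by rewrite exprn_ge0 // ltW.
  have ss : s * s <= r ^+ j.+2 by rewrite exprS -/s ler_pM2r.
  rewrite addSn XS YSc; split.
    apply: (@le_trans _ _ (a ^+ 2 * (s * s) * (b + b ^+ 2))).
      by apply: ler_pM => //; rewrite ?exprn_ge0 ?addr_ge0 ?exprn_ge0 ?(ltW (X_gt0 _)) ?(ltW Y0)
        // lerD.
    by rewrite mulrAC a_fix ler_pM2l.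
  apply: (@le_trans _ _ (a ^+ 2 * (s * s) * (1 + b ^+ 3))).
    apply: ler_pM => //; rewrite ?exprn_ge0 ?(ltW (X_gt0 _)) //;
      first by rewrite addr_ge0 // mulr_ge0 // ltW.
    rewrite lerD2l; by apply: le_trans Y3; rewrite ler_piMl ?(ltW c1).
  by rewrite mulrAC b_fix ler_pM2l.
have gr : 0 <= r < 1 by rewrite r1 ltW.
have sm j : r ^+ j.+1 <= r ^+ j by rewrite exprS ler_piMl ?exprn_ge0 // ltW.
have bX j : X (j + m)%N <= a * r ^+ j by apply: le_trans (key j).1 _; rewrite ler_pM2l.
have bY j : Y (j + m)%N <= b * r ^+ j by apply: le_trans (key j).2 _; rewrite ler_pM2l.
by split; [apply: (@geo_zero _ _ m a r)|apply: (@geo_zero _ _ m a r)|apply: (@geo_zero _ _ m b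
  r)|apply: (@geo_zero _ _ m b r)] => // j;
  have [/andP[? ?] /andP[? ?]] := pos (j + m); have := bX j; have := bY j => ? ?; apply/andP;
    split; lra.
Qed.

Section PentagonLimit.
Hypothesis nesc : forall m, ~ (1 < X m /\ 1 < Y m).
Hypothesis nsm : forall m, ~ (X m < a /\ Y m < b).

Let dich m : a <= X m \/ b <= Y m.
Proof.
case: (leP a (X m)) => [|h1]; first by left.
by case: (leP b (Y m)) => [|h2]; [right | case: (nsm (conj h1 h2))].
Qed.

(** Dividing the two recursions eliminates [X m]. Once [X m.+1] is controlled, this is a
    one-dimensional recursion for [Y]. *)
Let rat m : Y m.+1 * (Y m * (1 + Y m)) = X m.+1 * (1 + c m * Y m ^+ 3).
Proof. by rewrite XS YSc; ring. Qed.

(** By [dich], either [Y >= b], or [X >= a] and [rat] applies, where [1 + Y ^+ 3 >= Y * (1 + Y)]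
    since the difference is [(1 + Y) * (1 - Y) ^+ 2]. *)
Let Y_lower (e : R) m : 0 < e -> e <= c m.+1 -> a * e <= Y m.+2.
Proof.
move=> e0 ec; have /andP[a0 a1] := a_bd; have /andP[b1 b2] := b_bd.
have /andP[c0 c1] := c_bd m.+1.
case: (dich m.+2) => [aX|bY]; last by apply: le_trans bY; nra.
have Y0 := Y_gt0 m.+1; have P0 : 0 < Y m.+1 * (1 + Y m.+1) by nra.
have r := rat m.+1; rewrite -(ler_pM2r P0) r -mulrA.
have h : Y m.+1 * (1 + Y m.+1) <= 1 + Y m.+1 ^+ 3.
  by rewrite !exprS expr0; have := sqr_ge0 (Y m.+1 - 1); nra.
have h2 : e * (1 + Y m.+1 ^+ 3) <= 1 + c m.+1 * Y m.+1 ^+ 3.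
  have : e * Y m.+1 ^+ 3 <= c m.+1 * Y m.+1 ^+ 3 by rewrite ler_wpM2r // exprn_ge0 // ltW.
  lra.
apply: ler_pM => //; first exact: ltW.
  by rewrite mulr_ge0 // ltW.
by apply: le_trans h2; rewrite ler_pM2l.
Qed.

(** When the new [Y] exceeds 1, non-escape forces [X <= 1], and [rat] bounds it by [Y - 1 + Y^-1].
    This is at most [Y] if [Y >= 1], and at most [Y^-1] otherwise, which [Y_lower] controls. *)
Let Y_bounded : exists2 K : R, 0 < K & forall m, Y m.+2 <= K.
Proof.
have /andP[t0 t1] := t_bd 0; have /andP[a0 a1] := a_bd.
have e0 : 0 < 1 - t 0%N by lra.
have lb m := Y_lower e0 (c_ge m); set l := a * _ in lb.
have l0 : 0 < l by apply: mulr_gt0.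
have l1 : 1 <= l^-1.
  have ln : l != 0 by rewrite gt_eqF.
  by rewrite -[X in X <= _](divff ln) ler_piMl ?invr_ge0 ?(ltW l0) // /l; nra.
exists (Num.max (Y 2) l^-1); first by rewrite lt_max Y_gt0.
elim=> [|m IH]; first by rewrite le_max lexx.
have Y0 := Y_gt0 m.+2; have Y0' := Y_gt0 m.+3; have /andP[c0 c1] := c_bd m.+2.
case: (leP (Y m.+3) 1) => Y1; first by apply: (le_trans Y1); rewrite le_max l1 orbT.
have X1 : X m.+3 <= 1 by rewrite leNgt; apply/negP => h; apply: (nesc (conj h Y1)).
have P0 : 0 < 1 + Y m.+2 by lra.
have r : Y m.+3 * Y m.+2 <= 1 - Y m.+2 + Y m.+2 ^+ 2.
  rewrite -(ler_pM2r P0) -mulrA rat.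
  have -> : (1 - Y m.+2 + Y m.+2 ^+ 2) * (1 + Y m.+2) = 1 * (1 + Y m.+2 ^+ 3) by ring.
  have Y3 : 0 < Y m.+2 ^+ 3 by apply: exprn_gt0.
  by apply: ler_pM; rewrite ?(ltW (X_gt0 _)) //; nra.
case: (leP 1 (Y m.+2)) => Y2; first by apply: le_trans IH; rewrite -(ler_pM2r Y0) -expr2; lra.
rewrite le_max; apply/orP; right; apply: (@le_trans _ _ (Y m.+2)^-1).
  by rewrite -[leRHS]mul1r ler_pdivlMr //; nra.
by rewrite lef_pV2 ?posrE.
Qed.

(** Boundedness of [Y] keeps the factor [c * Y ^+ 3 / (1 + c * Y ^+ 3)] of [tS] away from 1. *)
Let t_cvg0 : t @ \oo --> (0 : R).
Proof.
have [K K0 YK] := Y_bounded.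
have K3 : 0 < K ^+ 3 by apply: exprn_gt0.
have /andP[t2 _] := t_bd 2.
have r1 : 0 <= K ^+ 3 / (1 + K ^+ 3) < 1.
  by rewrite divr_ge0 ?ltr_pdivrMr ?mul1r ?ltrDr //; lra.
apply: (@geo_zero _ _ 2 (t 2) (K ^+ 3 / (1 + K ^+ 3))) => // j.
have /andP[tj _] := t_bd (j + 2); rewrite (ltW tj) /=.
elim: j {tj} => [|j IH]; first by rewrite mulr1.
rewrite addSn tS (exprSr (K ^+ 3 / _)) [leRHS]mulrA.
have YKj : Y (j + 2)%N <= K by rewrite addn2.
have Y0 := Y_gt0 (j + 2); have /andP[c0 c1] := c_bd (j + 2); have /andP[t0 t1] := t_bd (j + 2).
have Y3 : 0 < Y (j + 2)%N ^+ 3 by apply: exprn_gt0.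
have Y3K : Y (j + 2)%N ^+ 3 <= K ^+ 3 by rewrite lerXn2r // nnegrE ltW.
have cY : 0 < c (j + 2)%N * Y (j + 2)%N ^+ 3 by apply: mulr_gt0.
apply: ler_pM => //; first exact: ltW.
  by rewrite divr_ge0 ?(ltW cY) //; lra.
rewrite ler_pdivrMr; last lra.
rewrite mulrAC ler_pdivlMr; last lra.
by nra.
Qed.

Let c_late (e : R) : 0 < e -> exists m, forall j, (m <= j)%N -> 1 - e <= c j.
Proof.
move=> e0; have [m H] := cvg_eventually_lt t_cvg0 e0.
exists m.+1 => -[//|j]; rewrite ltnS => /H tj.
have /andP[s0 s1] := t_bd j; have Y0 := Y_gt0 j.
have q0 : 0 < Y j * t j / (1 + Y j) by rewrite divr_gt0 ?mulr_gt0 //; lra.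
have q1 : Y j * t j / (1 + Y j) <= t j by rewrite ler_pdivrMr; [nra | lra].
by rewrite cS; move: (Y j * _ / _) q0 q1 => q q0 q1; nra.
Qed.

(** An orbit that is late above [(a, b)] by the factor [1 + e] in both coordinates would grow
    geometrically: the map is quadratic in [X], and one factor [1 + e] more than pays for [c < 1].
    The rate [g] splits this gain. *)
Let not_above (e : R) : 0 < e -> exists m, forall j, (m <= j)%N ->
  ~ ((1 + e) * a <= X j /\ (1 + e) * b <= Y j).
Proof.
move=> e0; have /andP[a0 a1] := a_bd; have /andP[b1 b2] := b_bd.
pose g : R := 1 + e / 2; have g1 : 1 < g by rewrite /g; lra.
have f0 : 0 < 1 - g / (1 + e) by rewrite subr_gt0 ltr_pdivrMr /g; lra.
have [m Hm] := c_late f0; exists m => k mk [hX hY].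
have key j : a * (1 + e) * g ^+ j <= X (j + k)%N /\ b * (1 + e) * g ^+ j <= Y (j + k)%N.
  elim: j => [|j [IX IY]]; first by rewrite !mulr1 ![_ * (1 + e)]mulrC.
  have hc := Hm (j + k)%N (leq_trans mk (leq_addl _ _)).
  have {}hc : g <= c (j + k)%N * (1 + e) by rewrite -ler_pdivrMr; lra.
  have /andP[c0 c1] := c_bd (j + k).
  have G1 : 1 <= g ^+ j by rewrite exprn_ege1 // ltW.
  rewrite -!mulrA in IX IY *; set u := (1 + e) * g ^+ j in IX IY.
  have u1 : 1 + e <= u by rewrite ler_peMr //; lra.
  have u1' : 1 <= u by lra.
  have -> : (1 + e) * g ^+ j.+1 = u * g by rewrite exprSr mulrA.
  rewrite addSn XS YSc; set A := X (j + k)%N in IX *; set B := Y (j + k)%N in IY *.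
  have B1 : b <= B by apply: le_trans IY; rewrite ler_peMr // ltW.
  have B2 : b ^+ 2 <= B ^+ 2 by rewrite lerXn2r // nnegrE ltW // (lt_le_trans b0).
  have B3 : b ^+ 3 <= B ^+ 3 by rewrite lerXn2r // nnegrE ltW // (lt_le_trans b0).
  have au0 : 0 <= a * u by rewrite mulr_ge0 ?(ltW a0) //; lra.
  have A2 : a ^+ 2 * u ^+ 2 <= A ^+ 2.
    by rewrite -exprMn lerXn2r // nnegrE // ltW // X_gt0.
  have gu : g <= u by apply: le_trans u1; rewrite /g; lra.
  split.
    apply: (@le_trans _ _ (a ^+ 2 * u ^+ 2 * (b + b ^+ 2))).
      have -> : a ^+ 2 * u ^+ 2 * (b + b ^+ 2) = a ^+ 2 * (b + b ^+ 2) * u ^+ 2 by ring.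
      by rewrite a_fix ler_pM2l // expr2 ler_pM2l //; lra.
    apply: ler_pM; [ | | exact: A2 | exact: lerD]; first by rewrite mulr_ge0 ?sqr_ge0.
    by rewrite addr_ge0 ?sqr_ge0 ?(ltW b0).
  apply: (@le_trans _ _ (a ^+ 2 * u ^+ 2 * (c (j + k)%N * (1 + b ^+ 3)))).
    have -> : a ^+ 2 * u ^+ 2 * (c (j + k)%N * (1 + b ^+ 3)) =
      a ^+ 2 * (1 + b ^+ 3) * (c (j + k)%N * u ^+ 2) by ring.
    rewrite b_fix ler_pM2l // expr2 mulrCA ler_pM2l; last lra.
    by apply: le_trans hc _; rewrite ler_pM2l.
  have b30 : 0 <= b ^+ 3 by rewrite exprn_ge0 // ltW.
  apply: ler_pM; [ | | exact: A2 | ]; first by rewrite mulr_ge0 ?sqr_ge0.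
    by rewrite mulr_ge0 ?(ltW c0) ?addr_ge0.
  have := ler_wpM2l (ltW c0) B3; lra.
have Xoo : X @ \oo --> +oo.
  by apply: (@geo_infty' _ _ k (a * (1 + e)) g) => // [|j]; [rewrite mulr_gt0 //;
    lra | exact: (key j).1].
have Yoo : Y @ \oo --> +oo.
  by apply: (@geo_infty' _ _ k (b * (1 + e)) g) => // [|j]; [rewrite mulr_gt0 //;
    lra | exact: (key j).2].
have [m1 h1] := infty_eventually_gt 1 Xoo; have [m2 h2] := infty_eventually_gt 1 Yoo.
by apply: (@nesc (m1 + m2)%N); rewrite h1 ?leq_addr // h2 // leq_addl.
Qed.

Let slope_aux (u p : R) : u * p <= u * (100 / 65 * (100 / 77)) -> 0 < u * p -> 0 < u -> u < 3 / 4 ->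
  - (3 / 4) <= u * (1 - p) <= 3 / 4.
Proof. by move=> *; apply/andP; split; lra. Qed.

(** For [k = 1] and [x2 = a], [y2] is [a * g y1] with [g y = y - 1 + y^-1], a map fixing [b] whose
    chord slope at [y1] and [b] is [a * (1 - y1^-1 * b^-1)]. The bounds [65 / 100] and [77 / 100]
    keep [y1^-1 * b^-1] below 2, so the slope is at most [3 / 4] in absolute value. The two
    alternatives on [x2] and [y2] serve the lower and the upper estimate. *)
Let contraction (y1 y2 x2 k e : R) : 65 / 100 <= y1 -> 0 < x2 -> 0 < e -> 1 - e <= k -> 0 < k ->
  k < 1 ->
  y2 * (y1 * (1 + y1)) = x2 * (1 + k * y1 ^+ 3) -> a <= x2 \/ b <= y2 ->
  x2 <= (1 + e) * a \/ y2 <= (1 + e) * b ->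
  `|y2 - b| <= 3 / 4 * `|y1 - b| + e * (b + 3 / 4 * `|y1 - b|).
Proof.
move=> y1l x20 e0 ek k0 k1 r lo up; have /andP[a0 a1] := a_bd; have /andP[b1 b2] := b_bd.
set d := `|y1 - b|; have d0 : 0 <= d by apply: normr_ge0.
have y10 : 0 < y1 by lra.
pose g := y1 - 1 + y1^-1; pose g' := b - 1 + b^-1.
have yv : y1 * y1^-1 = 1 by rewrite divff // gt_eqF.
have bv : b * b^-1 = 1 by rewrite divff // gt_eqF.
have yv0 : 0 < y1^-1 by rewrite invr_gt0.
have bv0 : 0 < b^-1 by rewrite invr_gt0.
have P0 : 0 < y1 * (1 + y1) by rewrite mulr_gt0 //; lra.
have gE : g * (y1 * (1 + y1)) = 1 + y1 ^+ 3.
  have -> : g * (y1 * (1 + y1)) = (y1 ^+ 2 - y1 + y1 * y1^-1) * (1 + y1) by rewrite /g; ring.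
  by rewrite yv; ring.
have ag' : a * g' = b.
  have bp : 0 < b * (1 + b) by rewrite mulr_gt0 //; lra.
  have bn : b * (1 + b) != 0 by rewrite gt_eqF.
  apply: (mulIf bn).
  have -> : a * g' * (b * (1 + b)) = a * (b ^+ 2 - b + b * b^-1) * (1 + b) by rewrite /g'; ring.
  rewrite bv -[X in X * (b * _)]b_fix.
  have -> : a ^+ 2 * (1 + b ^+ 3) * (b * (1 + b)) =
    (a * (b * (1 + b))) * (a * (1 + b ^+ 3)) by ring.
  by rewrite ab1; ring.
have lip : `|a * g - b| <= 3 / 4 * d.
  have -> : a * g - b = (a * (1 - y1^-1 * b^-1)) * (y1 - b).
    rewrite -{1}ag' /g /g'; have -> : a * (1 - y1^-1 * b^-1) * (y1 - b) =
      a * (y1 - b - (y1 * y1^-1) * b^-1 + y1^-1 * (b * b^-1)) by ring.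
    by rewrite yv bv; ring.
  rewrite normrM ler_wpM2r // ler_norml.
  have yu : y1^-1 <= 100 / 65 by rewrite -[y1^-1]mul1r ler_pdivrMr //; lra.
  have bu : b^-1 <= 100 / 77 by rewrite -[b^-1]mul1r ler_pdivrMr //; lra.
  have pu : y1^-1 * b^-1 <= 100 / 65 * (100 / 77) by apply: ler_pM => //; exact: ltW.
  have p0 : 0 < y1^-1 * b^-1 by apply: mulr_gt0.
  exact: slope_aux (ler_wpM2l (ltW a0) pu) (mulr_gt0 a0 p0) a0 a1.
have {lip} [lip1 lip2] : a * g <= b + 3 / 4 * d /\ b - 3 / 4 * d <= a * g.
  by move: lip; rewrite ler_norml => /andP[]; split; lra.
have g0 : 0 < g by rewrite -(pmulr_lgt0 _ P0) gE; have := exprn_gt0 3 y10; lra.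
have y3 := exprn_gt0 3 y10.
have yup : y2 <= x2 * g.
  by rewrite -(ler_pM2r P0) r -mulrA gE ler_pM2l // lerD2l ler_piMl ?(ltW k1) ?(ltW y3).
have ylo : x2 * (k * g) <= y2.
  rewrite -(ler_pM2r P0) r -!mulrA gE ler_pM2l //; lra.
rewrite ler_norml; apply/andP; split.
  have bd0 : 0 <= e * (b + 3 / 4 * d) by rewrite mulr_ge0 ?(ltW e0) //; lra.
  case: lo => h; last by lra.
  have h1 : k * (b - 3 / 4 * d) <= y2.
    apply: le_trans ylo; apply: (@le_trans _ _ (a * (k * g))); first by rewrite mulrCA ler_pM2l.
    by rewrite ler_pM2r // mulr_gt0.
  have h2 : (1 - k) * b <= e * b by rewrite ler_pM2r //; lra.
  have h3 : 0 <= (1 - k) * d by rewrite mulr_ge0 //; lra.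
  have h4 : 0 <= e * d by rewrite mulr_ge0 // ltW.
  by lra.
case: up => h; last by nra.
have : y2 <= (1 + e) * (b + 3 / 4 * d).
  apply: le_trans yup _; apply: (@le_trans _ _ ((1 + e) * a * g)); first by rewrite ler_pM2r.
  by rewrite -mulrA ler_pM2l //; lra.
by lra.
Qed.

Lemma pentagon_limit : pentagon_cvg a b.
Proof.
have /andP[a0 a1] := a_bd; have /andP[b1 b2] := b_bd.
have [K K0 YK] := Y_bounded.
(* Together with [c >= 19 / 20] this yields [Y >= 65 / 100], as [contraction] requires. *)
have a72 : 72 / 100 <= a.
  by rewrite aE -[leRHS]mul1r ler_pdivlMr; nra.
have e20 : 0 < 1 / 20 :> R by lra.
have [m1 H1] := c_late e20.
have Yl j : (m1.+2 <= j)%N -> 65 / 100 <= Y j.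
  case: j => [//|[//|j]]; rewrite !ltnS => mj.
  have e19 : 0 < 19 / 20 :> R by lra.
  have h : 19 / 20 <= c j.+1 by have := H1 j.+1 (leqW mj); lra.
  have := Y_lower e19 h; nra.
have d_cvg : (fun m => `|Y m - b|) @ \oo --> (0 : R).
  apply: (@contract_cvg0 _ _ (K + 1) (3 / 4)); first by apply/andP; lra.
  (* [K + 2] bounds the coefficient of the error in [contraction], the distance to [b] being at most
     [K + 1]. *)
  move=> e e0; pose e' := e / (K + 2).
  have e'0 : 0 < e' by rewrite divr_gt0 //; lra.
  have [m2 H2] := c_late e'0; have [m3 H3] := not_above e'0.
  exists (m1.+2 + (m2 + m3))%N => j mj.
  have h1 := Yl j (leq_trans (leq_addr _ _) mj).
  have h23 := leq_trans (leq_addl _ _) mj.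
  have h2 := H2 j (leq_trans (leq_addr _ _) h23).
  have h3 := H3 j.+1 (leqW (leq_trans (leq_addl _ _) h23)).
  have Kj : Y j <= K.
    by case: j mj {h1 h23 h2 h3} => [//|[//|j]] _.
  have dK : `|Y j - b| <= K + 1 by rewrite ler_norml; have := Y_gt0 j; move=> ?; apply/andP;
    split; lra.
  split; first by rewrite normr_ge0.
  have /andP[c0 c1] := c_bd j.
  have up : X j.+1 <= (1 + e') * a \/ Y j.+1 <= (1 + e') * b.
    case: (leP (X j.+1) ((1 + e') * a)) => [|hx]; first by left.
    case: (leP (Y j.+1) ((1 + e') * b)) => [|hy]; first by right.
    by case: h3; split; apply: ltW.
  apply: le_trans (contraction h1 (X_gt0 j.+1) e'0 h2 c0 c1 (rat j) (dich j.+1) up) _.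
  rewrite lerD2l; have -> : e = e' * (K + 2) by rewrite /e' divfK // gt_eqF //; lra.
  by rewrite ler_pM2l //; lra.
have Yb : Y @ \oo --> b.
  apply/cvgrPdist_lt => e e0; have [m H] := cvg_eventually_lt d_cvg e0.
  by exists m => // j /= mj; rewrite distrC; exact: H.
have cc : c @ \oo --> (1 : R).
  apply/cvgrPdist_lt => e e0; have e2 : 0 < e / 2 by lra.
  have [m H] := c_late e2; exists m => // j /= mj.
  have /andP[c0 c1] := c_bd j; rewrite ger0_norm; last lra.
  by have := H j mj; lra.
have b30 : 0 < 1 + 1 * b ^+ 3 by rewrite mul1r; have := exprn_gt0 3 b0; lra.
have Xa : X @ \oo --> a.
  apply/(cvg_shiftE _ 1).
  have -> : (fun j => X (j + 1)%N) =
    (fun j => Y j.+1 * (Y j * (1 + Y j)) * (1 + c j * Y j ^+ 3)^-1).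
    apply/funext => j; rewrite addn1 rat mulfK // gt_eqF //.
    have /andP[c0 c1] := c_bd j; have : 0 < c j * Y j ^+ 3 by rewrite mulr_gt0 ?exprn_gt0.
    by lra.
  have -> : a = b * (b * (1 + b)) * (1 + 1 * b ^+ 3)^-1.
    apply: (canRL (mulfK _)); first by rewrite gt_eqF.
    have -> : b * (b * (1 + b)) = a ^+ 2 * (1 + b ^+ 3) * (b * (1 + b)) by rewrite b_fix.
    have -> : a ^+ 2 * (1 + b ^+ 3) * (b * (1 + b)) =
      a * (b * (1 + b)) * (a * (1 + b ^+ 3)) by ring.
    by rewrite ab1 !mul1r.
  apply: cvgM.
    exact: cvgM (cvgS Yb) (cvgM Yb (cvgD (cvg_cst _) Yb)).
  apply: cvgV; first by rewrite gt_eqF.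
  by apply: cvgD; [exact: cvg_cst | by apply: cvgM cc _; apply: cvg_exprn].
have Yy : (fun m => Y m - y m) @ \oo --> (0 : R).
  have -> : (fun m => Y m - y m) = (fun m => Y m * t m) by apply/funext => m; rewrite [y m]yE; ring.
  by rewrite -[X in _ --> X](mulr0 b); apply: cvgM.
have Xx : (fun m => X m - x m) @ \oo --> (0 : R).
  apply/(cvg_shiftE _ 1).
  have -> : (fun j => X (j + 1)%N - x (j + 1)%N) = (fun j => X j ^+ 2 * Y j * (Y j - y j)).
    by apply/funext => j; rewrite addn1 visitX.
  rewrite -[X in _ --> X](mulr0 (a ^+ 2 * b)); by apply: cvgM (Yy); apply: cvgM (Yb);
    apply: cvg_exprn.
split=> //.
  have -> : x = (fun m => X m - (X m - x m)) by apply/funext => m; ring.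
  by rewrite -[X in _ --> X]subr0; apply: cvgB.
have -> : y = (fun m => Y m - (Y m - y m)) by apply/funext => m; ring.
by rewrite -[X in _ --> X]subr0; apply: cvgB.
Qed.

End PentagonLimit.
End PentagonDynamics.

Local Open Scope fset_scope.
Local Open Scope complex_scope.
Local Open Scope ring_scope.

(** * Geometry of the cells *)

Local Notation Re := complex.Re.
Local Notation Im := complex.Im.

Section Trig.
Variables (R : realType) (N : nat).
Hypotheses (hN : (3 <= N)%N) (hN4 : ~~ (4 %| N)%N).
Implicit Types (i j d e : int) (x y z : R[i]).

(** All angles are integer multiples of [u]: the vertex [j] lies at [4 j], the axis between the
    vertices [i] and [i + 1] at [4 i + 2], and a right angle is [N]. *)
Let u : R := pi / (2 * N%:R).
Local Notation s := (Posz (gs N)).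
Local Notation q := (gq R N).
Local Notation P := (@Psi R N).
Local Notation Pi := (@Psi_inv R N).
Local Notation r := (rho R N).
Let SA : R := sin ((2 * (gs N)%:R - 1) * pi / N%:R).

Let N_gt0 : 0 < N%:R :> R.
Proof. by rewrite ltr0n; apply: leq_trans hN. Qed.

Let u_gt0 : 0 < u.
Proof. by rewrite divr_gt0 ?pi_gt0 // mulr_gt0. Qed.

Let uN : u * (2 * N%:R) = pi.
Proof. by rewrite divfK // mulf_neq0 // gt_eqF. Qed.

Lemma sin_sub (a b : R) :
  sin a - sin b = 2 * cos ((a + b) / 2) * sin ((a - b) / 2).
Proof.
rewrite -[in sin a](_ : (a + b) / 2 + (a - b) / 2 = a); last by field.
rewrite -[in sin b](_ : (a + b) / 2 - (a - b) / 2 = b); last by field.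
by rewrite sinB sinD; ring.
Qed.

Lemma sinDz (a : R) (z : int) : sin (a + 2 * pi * z%:~R) = sin a.
Proof.
case: z => [m|m].
  rewrite -pmulrn mulr_natr -mulr_natl [2 * pi]mulr_natl mulr_natl.
  by apply: periodicn; exact: sinD2pi.
rewrite NegzE mulrNz mulrN -{2}(subrK (2 * pi * m.+1%:~R) a).
rewrite -pmulrn mulr_natr -mulr_natl [2 * pi]mulr_natl mulr_natl.
by symmetry; apply: periodicn; exact: sinD2pi.
Qed.

Lemma cosDz (a : R) (z : int) : cos (a + 2 * pi * z%:~R) = cos a.
Proof. by rewrite -!sinDpihalf addrAC sinDz. Qed.

Lemma gqE j : q j = cos ((4 * j)%:~R * u) +i* sin ((4 * j)%:~R * u).
Proof.
rewrite /gq; have -> : 2 * pi * j%:~R / N%:R = (4 * j)%:~R * u; last by [].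
by rewrite /u rmorphM /=; field; rewrite gt_eqF.
Qed.

Lemma gqD i j : q (i + j) = q i * q j.
Proof.
rewrite !gqE; have -> : (4 * (i + j))%:~R * u = (4 * i)%:~R * u + (4 * j)%:~R * u.
  by rewrite mulrDr rmorphD mulrDl.
by rewrite cosD sinD; apply/eqP; rewrite eq_complex /= eqxx /= addrC.
Qed.

Lemma gq_period i (z : int) : q (i + z * N%:Z) = q i.
Proof.
rewrite !gqE; have -> : (4 * (i + z * N))%:~R * u = (4 * i)%:~R * u + 2 * pi * z%:~R.
  by rewrite -uN !rmorphM !rmorphD rmorphM /= -pmulrn; ring.
by rewrite cosDz sinDz.
Qed.

Lemma gq0 : q 0 = 1.
Proof. by rewrite gqE mulr0 mul0r cos0 sin0. Qed.

Lemma gqN_conj j : q (- j) = conjc (q j).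
Proof. by rewrite !gqE mulrN rmorphN mulNr cosN sinN. Qed.

Let sin_u_gt0 (t : int) : 0 < t -> t < 2 * N%:Z -> 0 < sin (t%:~R * u).
Proof.
move=> t0 tN; apply: sin_gt0_pi; rewrite mulr_gt0 ?ltr0z //=.
rewrite -uN mulrC ltr_pM2l // -[2 * _]/((2%:Z)%:~R * N%:Z%:~R) -rmorphM /=.
by rewrite ltr_int.
Qed.

(* [4 s - 2 - N = 2 - l] with [l = N mod 4] in {1, 2, 3}. *)
Lemma gs_bounds : (N%:Z - 1 <= 4 * s - 2 <= N%:Z + 1) /\ (0 < s) /\ (2 * s < N%:Z).
Proof. by rewrite /gs /gk; move: hN hN4; lia. Qed.

Let SAE : SA = sin ((4 * s - 2)%:~R * u).
Proof.
rewrite /SA; congr sin; rewrite rmorphB /= rmorphM /= -pmulrn /u.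
by field; rewrite gt_eqF.
Qed.

(** Among the integers congruent to 2 modulo 4, [4 s - 2] is the one nearest to the right angle [N].
    A tie would need 4 to divide [N]. *)
Lemma sin_max_odd_strict e : 0 < e < N%:Z ->
  sin ((4 * (s - e) - 2)%:~R * u) < SA.
Proof.
move=> /andP[e0 eN]; rewrite SAE -subr_gt0 sin_sub -mulrA mulr_gt0 //.
have -> : (((4 * s - 2)%:~R * u - (4 * (s - e) - 2)%:~R * u) / 2) = (2 * e)%:~R * u.
  rewrite -mulrBl -rmorphB.
  have -> : 4 * s - 2 - (4 * (s - e) - 2) = 2 * (2 * e) by lia.
  by rewrite [in LHS]rmorphM /=; field.
have -> : (((4 * s - 2)%:~R * u + (4 * (s - e) - 2)%:~R * u) / 2) =
    - (((N%:Z - (4 * s - 2) + 2 * e)%:~R * u) - pi / 2).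
  rewrite -mulrDl -rmorphD -uN; have ->
    : 4 * s - 2 + (4 * (s - e) - 2) = 2 * (4 * s - 2 - 2 * e) by lia.
  by rewrite !(intrM, intrD, mulrNz) -!pmulrn; field.
rewrite cosN cosBpihalf; have [/andP[]] := gs_bounds => h1 h2 [h3 h4].
by apply: mulr_gt0; apply: sin_u_gt0; lia.
Qed.

Definition eqN i j := exists z : int, i = j + z * N%:Z.

Lemma sin_max_odd d : sin ((4 * d - 2)%:~R * u) <= SA /\
  (sin ((4 * d - 2)%:~R * u) = SA -> eqN d s).
Proof.
pose e := ((s - d) %% N%:Z)%Z; pose z := ((s - d) %/ N%:Z)%Z.
have dE : d = s - e + (- z) * N%:Z.
  by have := divz_eq (s - d) N%:Z; rewrite -/e -/z; lia.
have N0 : N%:Z != 0 by lia.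
have sE : sin ((4 * d - 2)%:~R * u) = sin ((4 * (s - e) - 2)%:~R * u).
  rewrite dE; set w := s - e.
  have -> : (4 * (w + - z * N%:Z) - 2)%:~R * u = (4 * w - 2)%:~R * u + 2 * pi * (- z)%:~R.
    by rewrite -uN !(intrM, intrD, mulrNz) -!pmulrn; ring.
  by rewrite sinDz.
have e0 : 0 <= e by apply: modz_ge0.
have eN : e < N%:Z by apply: ltz_pmod; lia.
rewrite sE; case: (eqVneq e 0) => [e00|en0].
  split; first by rewrite e00 subr0 SAE.
  by move=> _; exists (- z); rewrite dE e00 subr0.
have h : sin ((4 * (s - e) - 2)%:~R * u) < SA by apply: sin_max_odd_strict; lia.
by split; [exact: ltW | move=> hh; move: h; rewrite hh ltxx].
Qed.

Let S1 : R := sin (pi / N%:R).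

Let S1E : S1 = sin (2%:~R * u).
Proof. by rewrite /S1 /u; congr sin; rewrite -pmulrn; field; rewrite gt_eqF. Qed.

Let S1_gt0 : 0 < S1.
Proof. by rewrite S1E; apply: sin_u_gt0; lia. Qed.

Let SA_gt0 : 0 < SA.
Proof.
rewrite SAE; have [/andP[]] := gs_bounds => h1 h2 [h3 h4].
by apply: sin_u_gt0; lia.
Qed.

Lemma rho_gt0 : 0 < r.
Proof. by rewrite /rho -/S1 -/SA divr_gt0 // addr_gt0. Qed.

Lemma rho_lt1 : r < 1.
Proof. by rewrite /rho -/S1 -/SA ltr_pdivrMr ?addr_gt0 // mul1r ltrDl. Qed.

Lemma rhoE : (1 - r) * S1 = r * SA.
Proof. by rewrite /rho -/S1 -/SA; field; rewrite gt_eqF ?addr_gt0. Qed.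

(** The signed distance of [x] from the axis through the origin that bisects the vertices [i] and
    [i + 1]; the cells [i] and [i + 1] are mirror images in this axis. *)
Definition Lform i x : R :=
  Im x * cos ((4 * i + 2)%:~R * u) - Re x * sin ((4 * i + 2)%:~R * u).

Lemma Lform_gq i j : Lform i (q j) = sin ((4 * (j - i) - 2)%:~R * u).
Proof.
rewrite gqE /Lform /=.
have -> : (4 * (j - i) - 2)%:~R * u = (4 * j)%:~R * u - (4 * i + 2)%:~R * u.
  by rewrite -mulrBl -rmorphB; congr (_%:~R * _); lia.
by rewrite sinB.
Qed.

Lemma LformN_gq i j : - Lform i (q j) = sin ((4 * (i - j + 1) - 2)%:~R * u).
Proof. by rewrite Lform_gq -sinN -mulNr -rmorphN; congr (sin (_%:~R * _)); lia. Qed.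

Lemma RePsi j x : Re (P j x) = (1 - r) * Re (q j) + r * Re x.
Proof. by rewrite /Psi; case: (q j) x => a b [c d] /=; ring. Qed.

Lemma ImPsi j x : Im (P j x) = (1 - r) * Im (q j) + r * Im x.
Proof. by rewrite /Psi; case: (q j) x => a b [c d] /=; ring. Qed.

Lemma Lform_Psi i j x : Lform i (P j x) = (1 - r) * Lform i (q j) + r * Lform i x.
Proof. by rewrite /Lform RePsi ImPsi; ring. Qed.

(** A set containing the vertices and stable under every [Psi], hence containing all vertices of the
    unscaled gasket. It retains of the convex hull only what the contact analysis uses: the unit
    disc and the extreme values of each [Lform], attained at one vertex each. *)
Definition hull x := Re x ^+ 2 + Im x ^+ 2 <= 1 /\
  forall i, [/\ Lform i x <= SA, Lform i x = SA -> x = q (i + s),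
     - Lform i x <= SA & - Lform i x = SA -> x = q (i + 1 - s)].

Lemma gq_eqN i j : eqN i j -> q i = q j.
Proof. by case=> z ->; rewrite gq_period. Qed.

Lemma gq_norm j : Re (q j) ^+ 2 + Im (q j) ^+ 2 = 1.
Proof. by rewrite gqE /= cos2Dsin2. Qed.

Lemma hull_gq j : hull (q j).
Proof.
split; first by rewrite gq_norm.
move=> i; split; rewrite ?LformN_gq ?Lform_gq.
- exact: (sin_max_odd _).1.
- move=> /(sin_max_odd _).2[z hz]; apply: gq_eqN; exists z; lia.
- exact: (sin_max_odd _).1.
- move=> /(sin_max_odd _).2[z hz]; apply: gq_eqN; exists (- z); lia.
Qed.

Let convex_eq (a b c : R) : a <= c -> b <= c ->
  (1 - r) * a + r * b <= c /\ ((1 - r) * a + r * b = c -> a = c /\ b = c).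
Proof.
move=> ac bc; have r0 := rho_gt0; have r1 := rho_lt1.
have h1 : (1 - r) * a <= (1 - r) * c by rewrite ler_pM2l // subr_gt0.
have h2 : r * b <= r * c by rewrite ler_pM2l.
split; first by lra.
move=> e; split.
  by apply: (@mulfI _ (1 - r)); [rewrite gt_eqF // subr_gt0 | lra].
by apply: (@mulfI _ r); [rewrite gt_eqF | lra].
Qed.

Lemma hull_Psi j x : hull x -> hull (P j x).
Proof.
case=> nx hx; have [nq hq] := hull_gq j.
have fix_q : P j (q j) = q j by rewrite /Psi subrr mulr0 addr0.
split.
  rewrite RePsi ImPsi; have r0 := rho_gt0; have r1 := rho_lt1.
  have -> : ((1 - r) * Re (q j) + r * Re x) ^+ 2 + ((1 - r) * Im (q j) + r * Im x) ^+ 2 =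
    (1 - r) * (Re (q j) ^+ 2 + Im (q j) ^+ 2) + r * (Re x ^+ 2 + Im x ^+ 2)
     - r * (1 - r) * ((Re (q j) - Re x) ^+ 2 + (Im (q j) - Im x) ^+ 2) by ring.
  rewrite gq_norm mulr1.
  have h1 : r * (Re x ^+ 2 + Im x ^+ 2) <= r by rewrite ler_piMr // ltW.
  have h2 : 0 <= r * (1 - r) * ((Re (q j) - Re x) ^+ 2 + (Im (q j) - Im x) ^+ 2).
    apply: mulr_ge0; last by rewrite addr_ge0 ?sqr_ge0.
    by apply: mulr_ge0; rewrite ?subr_ge0; exact: ltW.
  lra.
move=> i; have [a1 a2 a3 a4] := hx i; have [b1 b2 b3 b4] := hq i.
rewrite Lform_Psi.
have nE : - ((1 - r) * Lform i (q j) + r * Lform i x) =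
   (1 - r) * (- Lform i (q j)) + r * (- Lform i x) by ring.
rewrite nE; split.
- exact: (convex_eq _ _).1.
- by case/(convex_eq b1 a1).2 => /b2 e1 /a2 e2; rewrite e2 -e1 fix_q.
- exact: (convex_eq _ _).1.
- by case/(convex_eq b3 a3).2 => /b4 e1 /a4 e2; rewrite e2 -e1 fix_q.
Qed.

(** Applying [Lform i] and [rhoE] turns the equality into [Lform i x - Lform i y = 2 * SA], which
    forces both points to be extreme. *)
Lemma contact_next i x y : hull x -> hull y -> P i x = P (i + 1) y ->
  x = q (i + s) /\ y = q (i + 1 - s).
Proof.
move=> [_ hx] [_ hy] /(congr1 (Lform i)); rewrite !Lform_Psi !Lform_gq.
have [a1 a2 _ _] := hx i; have [_ _ b3 b4] := hy i.
have -> : sin ((4 * (i - i) - 2)%:~R * u) = - S1.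
  by rewrite S1E subrr mulr0 sub0r rmorphN mulNr sinN.
have -> : sin ((4 * (i + 1 - i) - 2)%:~R * u) = S1.
  by rewrite S1E; congr (sin (_%:~R * _)); lia.
have r0 := rho_gt0; have re := rhoE; rewrite !mulrN re => e.
have {}e : Lform i x - Lform i y = 2 * SA.
  by apply: (@mulfI _ r); [rewrite gt_eqF | lra].
by split; [apply: a2 | apply: b4]; lra.
Qed.

(** The chords [q (i + 1) - q i] and [q (i + s) - q (i + 1 - s)] are parallel, and [rho] is the
    ratio for which the two images meet. *)
Lemma Psi_contact i : P i (q (i + s)) = P (i + 1) (q (i + 1 - s)).
Proof.
rewrite /Psi.
have E : (1 - r%:C) * (q (i + 1) - q i) = r%:C * (q (i + s) - q (i + 1 - s)).
  have -> : i + 1 - s = i + (1 - s) by lia.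
  rewrite !gqD.
  suff E : (1 - r%:C) * (q 1 - q 0) = r%:C * (q s - q (1 - s)).
    transitivity (q i * ((1 - r%:C) * (q 1 - q 0))); first by rewrite gq0; ring.
    by rewrite E gqD; ring.
  (* both sides are multiples of i e^(i pi / N) *)
  pose h := cos (2%:~R * u) +i* sin (2%:~R * u).
  have half j : q j = h * (cos ((4 * j - 2)%:~R * u) +i* sin ((4 * j - 2)%:~R * u)).
    rewrite gqE; have -> : (4 * j)%:~R * u = 2%:~R * u + (4 * j - 2)%:~R * u.
      by rewrite -mulrDl -rmorphD; congr (_%:~R * _); lia.
    by rewrite cosD sinD; apply/eqP; rewrite eq_complex /= eqxx /= addrC.
  rewrite (half 1) (half 0) (half s) (half (1 - s)) -!mulrBr [in RHS]mulrCA [in LHS]mulrCA.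
  congr (_ * _).
  have -> : 4 * 0 - 2 = - (4 * 1 - 2) :> int by [].
  have -> : 4 * (1 - s) - 2 = - (4 * s - 2) by lia.
  rewrite !rmorphN !mulNr !cosN !sinN -SAE -S1E.
  apply/eqP; rewrite eq_complex /= !subrr !mulr0 !mul0r; apply/andP; split; apply/eqP.
    by ring.
  by have := rhoE; lra.
have -> : q (i + s) = q (i + 1 - s) + (q (i + s) - q (i + 1 - s)) by ring.
have : r%:C * (q (i + s) - q (i + 1 - s)) = (1 - r%:C) * (q (i + 1) - q i) by rewrite E.
set c := r%:C; set a := q (i + s); set b := q (i + 1 - s); set d := q (i + 1); set e := q i.
move=> EE; have -> : e + c * (b + (a - b) - e) = e + c * (b - e) + c * (a - b) by ring.
by rewrite EE; ring.
Qed.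

Lemma eqN_mod i j : eqN i j <-> (i = j %[mod N%:Z])%Z.
Proof.
split=> [[z ->]|e]; first by rewrite addrC modzMDl.
exists ((i %/ N%:Z)%Z - (j %/ N%:Z)%Z).
have := divz_eq i N%:Z; have := divz_eq j N%:Z; rewrite e.
by set a := (i %/ _)%Z; set b := (j %/ _)%Z; set c := (j %% _)%Z; move=> -> ->; ring.
Qed.

Lemma Psi_eqN i j x : eqN i j -> P i x = P j x.
Proof. by move=> e; rewrite /Psi (gq_eqN e). Qed.

Let dist_gq i j : (Re (q i) - Re (q j)) ^+ 2 + (Im (q i) - Im (q j)) ^+ 2 =
  4 * sin ((2 * (i - j))%:~R * u) ^+ 2.
Proof.
rewrite !gqE /=.
have -> : (4 * i)%:~R * u = (2 * (i + j))%:~R * u + (2 * (i - j))%:~R * u.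
  by rewrite -mulrDl -rmorphD; congr (_%:~R * _); lia.
have -> : (4 * j)%:~R * u = (2 * (i + j))%:~R * u - (2 * (i - j))%:~R * u.
  by rewrite -mulrBl -rmorphB; congr (_%:~R * _); lia.
rewrite cosD sinD cosB sinB.
set A := _%:~R * u; set B := (2 * (i - j))%:~R * u.
transitivity (4 * (cos A ^+ 2 + sin A ^+ 2) * sin B ^+ 2); first by ring.
by rewrite cos2Dsin2; ring.
Qed.

Let cos_u_gt0 (t : int) : `|t| < N%:Z -> 0 < cos (t%:~R * u).
Proof.
move=> tN; apply: cos_gt0_pihalf; rewrite -ltr_norml normrM (gtr0_norm u_gt0).
rewrite -uN -intr_norm; have -> : u * (2 * N%:R) / 2 = N%:Z%:~R * u by rewrite -pmulrn; field.
by rewrite ltr_pM2r // ltr_int.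
Qed.

Lemma gq_inj i j : q i = q j -> eqN i j.
Proof.
move=> e; have := dist_gq i j; rewrite e !subrr expr0n addr0.
pose d := ((i - j) %% N%:Z)%Z; pose z := ((i - j) %/ N%:Z)%Z.
have dE : i - j = z * N%:Z + d := divz_eq _ _.
have d0 : 0 <= d by apply: modz_ge0; lia.
have dN : d < N%:Z by apply: ltz_pmod; lia.
case: (eqVneq d 0) => [h _|h]; first by exists z; lia.
have {e} : q (j + d) = q j by rewrite -e; apply: gq_eqN; exists (- z); lia.
move=> e _; have := dist_gq (j + d) j; rewrite e !subrr expr0n addr0 => /esym/eqP.
rewrite mulf_eq0 pnatr_eq0 /= expf_eq0 /=; have -> : j + d - j = d by lia.
by rewrite gt_eqF // sin_u_gt0; lia.
Qed.

(** Points of the unit disc are at distance at most 2, so a contact would give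
    [(1 - r) * sin (2 d u) <= r]. Bounding the sine below by [sin (4 u)], then using [rhoE] and
    [SA >= cos (2 u)], one gets [2 * cos (2 u) ^+ 2 <= 1]. This contradicts [cos (4 u) > 0], as the
    range of [d] and 4 not dividing [N] give [N >= 5]. *)
Lemma no_contact_far i j x y d : hull x -> hull y -> j = i + d ->
  2 <= d <= N%:Z - 2 -> P i x <> P j y.
Proof.
move=> [nx _] [ny _] -> /andP[d2 dN] E.
have r0 := rho_gt0; have r1 := rho_lt1; have re := rhoE.
have E1 : (1 - r) * (Re (q (i + d)) - Re (q i)) = r * (Re x - Re y).
  by have := congr1 (@complex.Re R) E; rewrite !RePsi; lra.
have E2 : (1 - r) * (Im (q (i + d)) - Im (q i)) = r * (Im x - Im y).
  by have := congr1 (@complex.Im R) E; rewrite !ImPsi; lra.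
have xy : (Re x - Re y) ^+ 2 + (Im x - Im y) ^+ 2 <= 4.
  have := sqr_ge0 (Re x + Re y); have := sqr_ge0 (Im x + Im y); nra.
pose sd := sin ((2 * d)%:~R * u).
have sd0 : 0 < sd by apply: sin_u_gt0; clear -hN hN4 d2 dN; lia.
have h1 : ((1 - r) * sd) ^+ 2 <= r ^+ 2.
  rewrite -(@ler_pM2l _ 4) //.
  have -> : 4 * ((1 - r) * sd) ^+ 2 = (1 - r) ^+ 2 * (4 * sd ^+ 2) by ring.
  have := dist_gq (i + d) i; rewrite [i + d - i]addrAC subrr add0r => dd.
  rewrite -dd mulrDr -!exprMn E1 E2.
  have -> : (r * (Re x - Re y)) ^+ 2 + (r * (Im x - Im y)) ^+ 2 =
    ((Re x - Re y) ^+ 2 + (Im x - Im y) ^+ 2) * r ^+ 2 by ring.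
  by apply: ler_wpM2r => //; exact: sqr_ge0.
have h2 : (1 - r) * sd <= r.
  by rewrite -(@ler_pXn2r _ 2) // nnegrE ltW // mulr_gt0 // subr_gt0.
have h3 : sin (4%:~R * u) <= sd.
  rewrite -subr_ge0 sin_sub.
  have -> : ((2 * d)%:~R * u + 4%:~R * u) / 2 = (d + 2)%:~R * u.
    by rewrite !(intrM, intrD); field.
  have -> : ((2 * d)%:~R * u - 4%:~R * u) / 2 = (d - 2)%:~R * u.
    by rewrite !(intrM, intrD, mulrNz); field.
  rewrite !mulr_ge0 //.
    case: (eqVneq (d + 2) N%:Z) => [->|dn].
      have -> : N%:Z%:~R * u = pi / 2 by rewrite -uN -pmulrn; field.
      by rewrite cos_pihalf.
    by apply: ltW; apply: cos_u_gt0; clear -hN hN4 d2 dN dn; lia.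
  case: (eqVneq d 2) => [->|dn]; first by rewrite subrr mul0r sin0.
  by apply: ltW; apply: sin_u_gt0; clear -hN hN4 d2 dN dn; lia.
have h4 : sin (4%:~R * u) = 2 * (S1 * cos (2%:~R * u)).
  have -> : 4%:~R * u = (2%:~R * u) *+ 2 by rewrite -mulr_natl; ring.
  by rewrite sin_mulr2n S1E; ring.
have c0 : 0 < cos (2%:~R * u) by apply: cos_u_gt0; clear -hN hN4 d2 dN; lia.
have h5 : cos (2%:~R * u) <= SA.
  rewrite SAE.
  have -> : (4 * s - 2)%:~R * u = (4 * s - 2 - N%:Z)%:~R * u + pi / 2.
    by rewrite -uN !(intrM, intrD, mulrNz) -!pmulrn; field.
  rewrite sinDpihalf -cosN; set t := 4 * s - 2 - N%:Z.
  have : `|t| <= 1 by have [/andP[g1 g2] _] := gs_bounds; clear -g1 g2; lia.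
  move=> t1; rewrite -[X in _ <= X]cos_norm cosN normrM (gtr0_norm u_gt0).
  have uu : 2%:~R * u <= pi.
    by rewrite -uN mulrC ler_pM2l // -[X in _ <= X]/((2%:Z)%:~R * N%:Z%:~R) -rmorphM /= ler_int;
      clear -hN hN4 d2 dN; lia.
  have u2 : `|t%:~R| <= 1 :> R by rewrite -intr_norm -[X in _ <= X]/(1%:~R) ler_int.
  rewrite leNgt ltr_cos ?in_itv /=; last first.
  - rewrite mulr_ge0 ?normr_ge0 ?(ltW u_gt0) //=.
    apply: le_trans uu; rewrite ler_pM2r //; apply: le_trans u2 _.
    by rewrite -[X in X <= _]/(1%:~R) ler_int.
  - by rewrite uu mulr_ge0 // ltW.
  rewrite -leNgt ler_pM2r //; apply: le_trans u2 _.
  by rewrite -[X in X <= _]/(1%:~R) ler_int.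
have h6 : 1 < 2 * cos (2%:~R * u) ^+ 2.
  have := cos_mulr2n (2%:~R * u).
  have -> : (2%:~R * u) *+ 2 = 4%:~R * u by rewrite -mulr_natl; ring.
  have : 0 < cos (4%:~R * u) by apply: cos_u_gt0; move: hN4; clear -hN hN4 d2 dN; lia.
  rewrite -[_ ^+ 2 *+ 2]mulr_natl; lra.
have h7 : (1 - r) * (2 * (S1 * cos (2%:~R * u))) <= r.
  by rewrite -h4; apply: le_trans h2; rewrite ler_pM2l // subr_gt0.
have h8 : r * (2 * SA * cos (2%:~R * u)) <= r * 1.
  have -> : r * (2 * SA * cos (2%:~R * u)) = ((1 - r) * S1) * (2 * cos (2%:~R * u)).
    by rewrite rhoE; ring.
  by rewrite mulr1; apply: le_trans h7; rewrite le_eqVlt; apply/orP; left; apply/eqP; ring.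
move: h8; rewrite ler_pM2l //; have : 0 <= (SA - cos (2%:~R * u)) * cos (2%:~R * u).
  by rewrite mulr_ge0 ?subr_ge0 // ltW.
by lra.
Qed.

Lemma Psi_contact_only i j x y : hull x -> hull y -> P i x = P j y ->
  [\/ eqN i j,
      [/\ eqN j (i + 1), x = q (i + s) & y = q (i + 1 - s)]
    | [/\ eqN i (j + 1), y = q (j + s) & x = q (j + 1 - s)]].
Proof.
move=> hx hy E.
pose d := ((j - i) %% N%:Z)%Z; pose z := ((j - i) %/ N%:Z)%Z.
have dE : j - i = z * N%:Z + d := divz_eq _ _.
have d0 : 0 <= d by apply: modz_ge0; lia.
have dN : d < N%:Z by apply: ltz_pmod; lia.
have ej : eqN j (i + d) by exists z; lia.
case: (eqVneq d 0) => [h|h]; first by constructor 1; exists (- z); lia.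
case: (eqVneq d 1) => [h1|h1].
  constructor 2; move: E; rewrite h1 in ej; rewrite (Psi_eqN _ ej) => E.
  by have [] := contact_next hx hy E.
case: (eqVneq d (N%:Z - 1)) => [h2|h2].
  constructor 3; have ei : eqN i (j + 1) by exists (- z - 1); lia.
  move: E; rewrite (Psi_eqN _ ei) => E.
  by have [] := contact_next hy hx (esym E).
exfalso; apply: (@no_contact_far i (i + d) x y d) => //; first by lia.
by rewrite -(Psi_eqN _ ej).
Qed.

Lemma Psi_inj j : injective (P j).
Proof.
move=> x y; rewrite /Psi => /addrI/mulfI e.
have r0 : r%:C != 0 by rewrite eq_complex /= eqxx andbT gt_eqF // rho_gt0.
by have := e r0 => /addIr.
Qed.

Lemma PsiK j : cancel (P j) (Pi j).
Proof.
move=> x; rewrite /Psi_inv /Psi addrAC subrr add0r mulrA -rmorphM mulVf ?gt_eqF ?rho_gt0 //.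
by rewrite mul1r addrCA subrr addr0.
Qed.

Lemma Psi_invK j : cancel (Pi j) (P j).
Proof.
move=> x; rewrite /Psi_inv /Psi addrAC subrr add0r mulrA -rmorphM mulfV ?gt_eqF ?rho_gt0 //.
by rewrite mul1r addrCA subrr addr0.
Qed.

Lemma Psi_gq j : P j (q j) = q j.
Proof. by rewrite /Psi subrr mulr0 addr0. Qed.

Lemma Psi_rot t j x : q t * P j x = P (t + j) (q t * x).
Proof. by rewrite /Psi gqD; ring. Qed.

Lemma Psi_conj j x : conjc (P j x) = P (- j) (conjc x).
Proof.
rewrite /Psi gqN_conj; case: (q j) x => a b [c d]; apply/eqP.
by rewrite eq_complex /=; apply/andP; split; apply/eqP; ring.
Qed.

End Trig.

(** * Linear forests *)

Local Open Scope fset_scope.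

Section PathGraphs.
Variable R : realType.
Local Notation C := R[i]%C.
Implicit Types (G : graph R) (x y z u v : C) (p q : seq C).

Fixpoint pedges x p : graph R :=
  if p is y :: p' then [fset x; y] |` pedges y p' else fset0.

Lemma fset2_eq x y u v :
  ([fset u; v] == [fset x; y]) = ((u == x) && (v == y)) || ((u == y) && (v == x)).
Proof.
apply/eqP/orP => [E|[/andP[/eqP -> /eqP ->]//|/andP[/eqP -> /eqP ->]]]; last by rewrite fsetUC.
move/fsetP: E => E; have := E u; rewrite !inE eqxx /= => /esym/orP[/eqP ux|/eqP uy].
  have := E y; rewrite !inE eqxx orbT ux => /orP[/eqP yx|/eqP ->].
    by have := E v; rewrite !inE eqxx orbT yx orbb => /esym/eqP ->; rewrite !eqxx; left.
  by left; rewrite !eqxx.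
have := E x; rewrite !inE eqxx uy => /orP[/eqP yx|/eqP ->].
  by have := E v; rewrite !inE eqxx orbT yx orbb => /esym/eqP ->; rewrite !eqxx; left.
by right; rewrite !eqxx.
Qed.

Lemma cardfs2P (e : {fset C}) : reflect (exists u v, u != v /\ e = [fset u; v]) (#|` e| == 2%N).
Proof.
apply: (iffP eqP) => [e2|[u [v [uv ->]]]]; last by rewrite cardfs2 uv.
have /fset0Pn[u ue] : e != fset0 by rewrite -cardfs_gt0 e2.
have /eqP/cardfs1P[v E] : #|` e `\ u| = 1%N by have := cardfsD1 u e; rewrite ue e2 => -[].
exists u, v; split; last by rewrite -(fsetD1K ue) E.
by have := fset11 v; rewrite -E !inE eq_sym => /andP[].
Qed.

Lemma adjC G u v : adj G u v = adj G v u.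
Proof. by rewrite /adj fsetUC. Qed.

Lemma adj_pedges x p u v : uniq (x :: p) -> adj (pedges x p) u v =
  [&& u \in x :: p, v \in x :: p &
    (index u (x :: p) == (index v (x :: p)).+1) || (index v (x :: p) == (index u (x :: p)).+1)].
Proof.
elim: p x => [|y p IH] x.
  move=> _; rewrite /adj /= in_fset0 !inE.
  by case: (eqVneq u x) => [_|//]; case: (eqVneq v x).
rewrite cons_uniq => /andP[xy up]; move: (IH y up).
rewrite /adj /= in_fset1U fset2_eq => ->.
have xyne : x == y = false by apply: contraNF xy => /eqP ->; rewrite mem_head.
rewrite [u \in [:: x, _ & _]]inE [v \in [:: x, _ & _]]inE.
rewrite [x == u]eq_sym [x == v]eq_sym.
case: (eqVneq u x) => [->|ux] /=.
  rewrite (negPf xy) /= orbF xyne /= orbF.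
  case: (eqVneq v x) => [->|vx] /=; first by rewrite xyne.
  rewrite eqSS [v \in _]inE [y == v]eq_sym.
  by case: (eqVneq v y) => [->|vy] /=; rewrite ?eqxx // andbF.
case: (eqVneq v x) => [->|vx] /=.
  rewrite (negPf xy) /= !andbF andbT orbF.
  rewrite eqSS [u \in _]inE [y == u]eq_sym orbF.
  by case: (eqVneq u y) => [->|uy] /=; rewrite ?eqxx //= andbF.
by rewrite andbF /= !eqSS.
Qed.

Lemma pedgesP x p e : e \in pedges x p -> exists u v, e = [fset u; v] /\ adj (pedges x p) u v.
Proof.
elim: p x => [|y p IH] x //=; rewrite in_fset1U => /predU1P[->|/IH[u [v [-> h]]]].
  by exists x, y; split=> //; rewrite /adj /= fset1U1.
by exists u, v; split=> //; move: h; rewrite /adj /= => h; rewrite in_fset1U h orbT.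
Qed.

Lemma pedges_card2 x p e : uniq (x :: p) -> e \in pedges x p -> #|` e| = 2%N.
Proof.
move=> up /pedgesP[u [v [-> ]]]; rewrite adj_pedges // => /and3P[_ _ h].
rewrite cardfs2; case: (eqVneq u v) h => [->|//].
by rewrite orbb => /eqP; lia.
Qed.

(** On a cycle, the vertex of least index along the path has two neighbours; both have the next
    index, so they coincide. *)
Lemma pedges_acyclic x p : uniq (x :: p) -> acyclic (pedges x p).
Proof.
move=> up [c [sc uc cc]].
have cn : c != [::] by case: (c) sc.
pose f := index^~ (x :: p).
have cw z : z \in c -> z \in x :: p.
  move=> zc; have := next_cycle cc zc; rewrite adj_pedges // => /andP[].
  by [].
have [z zc zmin] : exists2 z, z \in c & forall t, t \in c -> (f z <= f t)%N.
  elim: (c) cn => // z c' IH _; case: (eqVneq c' [::]) => [->|/IH[t tc tm]].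
    by exists z; rewrite ?mem_head // => t; rewrite inE => /eqP ->.
  case: (leqP (f z) (f t)) => h.
    exists z; rewrite ?mem_head // => r; rewrite inE => /predU1P[->//|/tm].
    exact: leq_trans h.
  exists t; first by rewrite inE tc orbT.
  by move=> r; rewrite inE => /predU1P[->|/tm//]; apply: ltnW.
have [i c' cE] := rot_to zc; rewrite -(rot_uniq i) cE in uc.
have mc t : t \in z :: c' -> t \in c by rewrite -cE mem_rot.
rewrite -(rot_cycle i) cE in cc; rewrite -(size_rot i) cE in sc.
move: cc uc mc sc; case: c' {cE} => [//|y [//|y' c']].
set r := y' :: c'; move=> /= cc uc mc _.
have zy : adj (pedges x p) z y by case/and3P: cc.
have zl : adj (pedges x p) z (last y r).
  by move: cc; rewrite rcons_path => /and4P[_ _ _]; rewrite [in X in X -> _]adjC.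
have nb t : t \in c -> adj (pedges x p) z t -> f t = (f z).+1.
  move=> tc; rewrite adj_pedges // => /and3P[_ _ /orP[]/eqP E]; last by rewrite /f E.
  by have := zmin _ tc; rewrite /f E ltnn.
have yc : y \in c by apply: mc; rewrite !inE eqxx orbT.
have lc : last y r \in c by apply: mc; rewrite inE mem_last orbT.
have E : y = last y r.
  rewrite -[LHS](nth_index x (cw _ yc)) -[RHS](nth_index x (cw _ lc)).
  by congr nth; rewrite -/(f _) (nb _ yc zy) -/(f _) (nb _ lc zl).
by move: uc => /and3P[_ + _]; rewrite {1}E /r /= mem_last.
Qed.

Lemma adj_pedges_first x y p : uniq (x :: y :: p) ->
  forall t, adj (pedges x (y :: p)) x t = (t == y).
Proof.
move=> up t; rewrite adj_pedges //; apply/idP/eqP => [|->].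
  rewrite [index x _]/= eqxx => /and3P[_ tw /eqP ti].
  by rewrite -(nth_index x tw) ti.
rewrite !inE eqxx /= eqxx orbT /=; have /negPf -> : x != y by move: up => /= /andP[];
  rewrite inE negb_or => /andP[].
by rewrite eqxx.
Qed.

Section Degree.
Variables (G : graph R) (x : C).
Hypothesis c2 : forall e, e \in G -> #|` e| = 2%N.

Let edge_at e : e \in G -> x \in e -> exists2 t, e = [fset x; t] & adj G x t.
Proof.
move=> eG xe; have /eqP/cardfs1P[t E] : #|` e `\ x| = 1%N.
  by have := cardfsD1 x e; rewrite xe c2 // => -[].
have eE : e = [fset x; t] by rewrite -(fsetD1K xe) E.
by exists t => //; rewrite /adj -eE.
Qed.

Lemma adj_neq t : adj G x t -> x != t.
Proof. by move=> /c2; rewrite cardfs2; case: (x != t). Qed.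

Lemma degree_le (s : seq C) : (forall t, adj G x t -> t \in s) -> (degree G x <= size s)%N.
Proof.
move=> h; rewrite /degree.
rewrite -(size_map (fun t => [fset x; t]) s); apply: uniq_leq_size (fset_uniq _) _ => e.
rewrite !inE /= => /andP[eG xe]; have [t -> xt] := edge_at eG xe.
by apply: map_f; apply: h.
Qed.

Lemma degree_ge1 t : adj G x t -> (1 <= degree G x)%N.
Proof.
move=> xt; rewrite /degree cardfs_gt0; apply/fset0Pn; exists [fset x; t].
by rewrite !inE /= eqxx andbT.
Qed.

Lemma degree_ge2 t t' : adj G x t -> adj G x t' -> t != t' -> (2 <= degree G x)%N.
Proof.
move=> xt xt' tt'; rewrite /degree.
have <- : #|` [fset [fset x; t]; [fset x; t']]| = 2%N.
  rewrite cardfs2 fset2_eq eqxx /= negb_or tt' /=.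
  by have := adj_neq xt; rewrite eq_sym => /negPf ->; rewrite andbF.
apply: fsubset_leq_card; apply/fsubsetP => e; rewrite !inE.
by case/orP=> /eqP ->; rewrite !inE eqxx andbT.
Qed.

Lemma degree_ge3 t t' t'' : adj G x t -> adj G x t' -> adj G x t'' ->
  uniq [:: t; t'; t''] -> (3 <= degree G x)%N.
Proof.
move=> xt xt' xt''; rewrite /= !inE negb_or andbT => /andP[/andP[n1 n2] n3]; rewrite /degree.
have <- : #|` [fset x; t] |` [fset [fset x; t']; [fset x; t'']]| = 3%N.
  have ne u v : adj G x u -> adj G x v -> ([fset x; u] == [fset x; v]) = (u == v).
    move=> xu xv; rewrite fset2_eq eqxx /=; case: (u == v) => //=.
    by have := adj_neq xv; rewrite eq_sym => /negPf h; apply/negP => /andP[/eqP xv' _];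
      rewrite xv' eqxx in h.
  by rewrite cardfsU1 cardfs2 !inE !ne // (negPf n1) (negPf n2) n3.
apply: fsubset_leq_card; apply/fsubsetP => e; rewrite !inE.
by case/or3P=> /eqP ->; rewrite !inE eqxx andbT.
Qed.

Lemma degree1_adj : degree G x = 1%N -> exists t, adj G x t.
Proof.
move=> d1; have : (0 < degree G x)%N by rewrite d1.
rewrite /degree cardfs_gt0 => /fset0Pn[e]; rewrite !inE /= => /andP[eG xe].
by have [t _ xt] := edge_at eG xe; exists t.
Qed.

End Degree.

Lemma pedges_linear_forest x p : uniq (x :: p) -> linear_forest (pedges x p).
Proof.
move=> up; split; [by move=> e; apply: pedges_card2 | | exact: pedges_acyclic].
move=> z; pose i := index z (x :: p).
apply: (@degree_le _ z _ [:: nth x (x :: p) i.+1; nth x (x :: p) i.-1]).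
  by move=> e; apply: pedges_card2.
move=> t; rewrite adj_pedges // => /and3P[_ tw /orP[]/eqP h]; rewrite -(nth_index x tw) !inE.
  by rewrite /i h /= eqxx orbT.
by rewrite -h eqxx.
Qed.

Lemma pedges_degree1 x p z : uniq (x :: p) -> degree (pedges x p) z = 1%N ->
  z = x \/ z = last x p.
Proof.
move=> up d1; have c2 e := @pedges_card2 x p e up.
have [t zt] := degree1_adj c2 d1.
have zw : z \in x :: p by move: zt; rewrite adj_pedges // => /and3P[].
pose i := index z (x :: p).
have il : (i < (size p).+1)%N by rewrite [X in (_ < X)%N]/(size (x :: p)) index_mem.
case: (posnP i) => [i0|i0]; first by left; rewrite -(nth_index x zw) -/i i0.
case: (eqVneq i (size p)) => [ip|ip].
  by right; rewrite -(nth_index x zw) -/i ip -[last x p]/(last x (x :: p)) -nth_last.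
have nb k : (k < (size p).+1)%N -> (k == i.-1) || (k == i.+1) ->
  adj (pedges x p) z (nth x (x :: p) k).
  move=> kp h; rewrite adj_pedges // zw mem_nth // index_uniq // -/i andTb.
  by case/orP: h => /eqP ->; rewrite ?prednK // eqxx ?orbT.
have : (2 <= degree (pedges x p) z)%N.
  have i1 : (i.-1 < (size p).+1)%N by lia.
  have i2 : (i.+1 < (size p).+1)%N by lia.
  apply: (degree_ge2 c2 (nb i.-1 i1 _) (nb i.+1 i2 _)); rewrite ?eqxx ?orbT //.
  by rewrite nth_uniq //; lia.
by rewrite d1.
Qed.

Lemma pedges_mem x p e u : e \in pedges x p -> u \in e -> u \in x :: p.
Proof.
elim: p x => [|y p IH] x //=; rewrite in_fset1U => /predU1P[->|h ue].
  by rewrite !inE => /orP[]/eqP ->; rewrite eqxx ?orbT.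
by rewrite inE (IH _ h ue) orbT.
Qed.

Lemma card_pedges x p : uniq (x :: p) -> #|` pedges x p| = size p.
Proof.
elim: p x => [|y p IH] x //; rewrite cons_uniq => /andP[xp up] /=.
rewrite cardfsU1 IH //; case: (boolP (_ \in _)) => // h.
by move: xp; rewrite (pedges_mem h) // fset21.
Qed.

Lemma pedges_sub G x p : (pedges x p `<=` G) = path (adj G) x p.
Proof. elim: p x => [|y p IH] x /=; first exact: fsub0set.
by rewrite -IH -[_ |` _]/(fsetU [fset [fset x; y]] _) fsubUset fsub1set. Qed.

Lemma pedges_inj x p q : uniq (x :: p) -> uniq (x :: q) -> pedges x p = pedges x q -> p = q.
Proof.
elim: p x q => [|y p IH] x [|z q] //=.
- by move=> _ _ /fsetP/(_ [fset x; z]); rewrite !inE eqxx.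
- by move=> _ _ /fsetP/(_ [fset x; y]); rewrite !inE eqxx.
move=> up uq E; have yz : y = z.
  have := adj_pedges_first uq y; rewrite -[pedges x (z :: q)]E -[_ |` _]/(pedges x (y :: p)).
  by rewrite (adj_pedges_first up) eqxx => /esym/eqP.
subst z; congr (_ :: _); case/andP: up => xp up; case/andP: uq => xq uq.
apply: (IH y) => //; apply/fsetP => e; move/fsetP/(_ e): E; rewrite !inE.
case: eqP => [-> _|_ //]; apply/idP/idP => h.
  by move: xp; rewrite (pedges_mem h) // fset21.
by move: xq; rewrite (pedges_mem h) // fset21.
Qed.

(** A sequence with steps of size one that turns back repeats a value. *)
Lemma succ_or_pred_path (i : nat) (s : seq nat) :
  path (fun k l => (k == l.+1) || (l == k.+1)) i s -> uniq (i :: s) ->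
  (forall k, (k <= size s)%N -> nth 0%N (i :: s) k = (i + k)%N) \/
  (forall k, (k <= size s)%N -> (nth 0%N (i :: s) k + k)%N = i).
Proof.
elim: s i => [|j s IH] i; first by left; case=> //; rewrite addn0.
rewrite cons_uniq => /andP[ij ps] /andP[iu us].
have [H|H] := IH j ps us.
- case/orP: ij => /eqP ij.
    right; case: s {IH} ps iu us H => [|l s] ps iu us H.
      by case=> [|[|//]] _; rewrite /= ?addn0 ?addn1 ?ij.
    have := H 1%N isT; rewrite /= => lE; move: iu; rewrite !inE lE ij addn1 eqxx /=.
    by rewrite orbT.
  by left; case=> [|k] kl; rewrite ?addn0 //= H // ij addSnnS.
- case/orP: ij => /eqP ij.
    by right; case=> [|k] kl; rewrite ?addn0 //= addnS H // ij.
  left; case: s {IH} ps iu us H => [|l s] ps iu us H.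
    by case=> [|[|//]] _; rewrite /= ?addn0 ?addn1 ?ij.
  have := H 1%N isT; rewrite /= => lE; move: iu; rewrite !inE.
  have -> : i = l by lia.
  by rewrite eqxx /= orbT.
Qed.

(** Closure under adjacency makes [q] contain every vertex of the path; read through indices, [q]
    becomes an injective sequence with steps of size one. *)
Lemma component_pedges x p q : uniq (x :: p) -> component_path (pedges x p) q ->
  q = x :: p \/ q = rev (x :: p).
Proof.
move=> up [sq uq srt cl]; set w := x :: p in up *.
have qw : {subset q <= w}.
  move=> z zq; case: q sq uq srt cl zq => [//|a [//|b q]] _ _ /=.
  move=> /andP[ab pq] _; rewrite inE => /predU1P[->|].
    by move: ab; rewrite adj_pedges // => /and3P[].
  elim: q a b ab pq => [|c q IH] a b ab /=.
    by rewrite inE => _ /eqP ->; move: ab; rewrite adj_pedges // => /and3P[].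
  move=> /andP[bc pq]; rewrite inE => /predU1P[->|]; last exact: IH bc pq.
  by move: ab; rewrite adj_pedges // => /and3P[].
pose f := index^~ w.
have step k : (k.+1 < size w)%N -> (nth x w k \in q) = (nth x w k.+1 \in q).
  move=> kw; have h : adj (pedges x p) (nth x w k) (nth x w k.+1).
    by rewrite adj_pedges // !mem_nth ?(ltnW kw) // !index_uniq ?(ltnW kw) // eqxx orbT.
  by apply/idP/idP => [/cl|/cl]; apply=> //; rewrite adjC.
have all_or k : (k < size w)%N -> (nth x w k \in q) = (x \in q).
  by elim: k => [|k IH] kw //; rewrite -step // IH // ltnW.
have wq : {subset w <= q}.
  case: q sq uq srt cl qw step all_or => [//|a q] _ _ _ _ qw _ all_or.
  have xq : x \in a :: q.
    have aw : a \in w by apply: qw; rewrite mem_head.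
    by rewrite -(all_or (index a w)) ?index_mem // nth_index // mem_head.
  by move=> z zw; rewrite -(nth_index x zw) all_or // index_mem.
have szq : size q = size w.
  by apply/eqP; rewrite eqn_leq !uniq_leq_size.
case: q sq uq srt cl qw wq szq {step all_or} => [//|a q] _ uq srt cl qw wq szq.
have fin : {in w &, injective f}.
  by move=> u v uw vw; rewrite /f => E; rewrite -(nth_index x uw) E nth_index.
have us : uniq (f a :: map f q).
  by rewrite -[_ :: _]/(map f (a :: q)) map_inj_in_uniq // => u v /qw uw /qw vw; apply: fin.
have ps : path (fun k l => (k == l.+1) || (l == k.+1)) (f a) (map f q).
  rewrite path_map; apply: sub_path srt => u v.
  by rewrite adj_pedges // => /and3P[].
have szm : size (map f q) = size p by rewrite size_map; case: szq.
have fw u : u \in a :: q -> (f u < size w)%N by move=> /qw; rewrite index_mem.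
have nthf k : (k <= size p)%N -> nth x (a :: q) k = nth x w (nth 0%N (map f (a :: q)) k).
  move=> kp; have kq : (k < size (a :: q))%N by rewrite szq.
  by rewrite (nth_map x) // nth_index //; apply: qw; apply: mem_nth.
have [H|H] := succ_or_pred_path ps us; rewrite szm in H.
- have a0 : f a = 0%N.
    have := H _ (leqnn (size p)); have : (nth 0%N (map f (a :: q)) (size p) < size w)%N.
      rewrite (nth_map x) ?szq //; apply: fw; apply: mem_nth; by rewrite szq.
    by rewrite /= => + E; rewrite E; lia.
  left; apply: (@eq_from_nth _ x) => // k; rewrite szq ltnS => kp.
  by rewrite nthf // H // a0.
- have aE : f a = size p.
    have /= E := H _ (leqnn (size p)); have : (f a < size w)%N by apply: fw; rewrite mem_head.
    by rewrite /= => h; lia.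
  right; apply: (@eq_from_nth _ x); rewrite ?size_rev // => k; rewrite szq ltnS => kp.
  rewrite nthf // nth_rev ?ltnS // -[size w]/(size p).+1 subSS.
  by congr nth; rewrite map_cons; apply: (@addIn k); rewrite H // aE subnK.
Qed.

Lemma infix2P (s : seq C) u v : infix [:: u; v] s -> exists s1 s2, s = s1 ++ u :: v :: s2.
Proof. by move/infixP=> [s1 [s2 ->]]; exists s1, s2. Qed.

Lemma infix2_adj x p u v : infix [:: u; v] (x :: p) -> [fset u; v] \in pedges x p.
Proof.
elim: p x => [|y p IH] x.
  by move=> /infix2P[[|a [|b s1]] [s2]].
move=> /infix2P[[|a s1] [s2]] /= [].
  by move=> -> -> _; rewrite fset1U1.
move=> _ E; rewrite in_fset1U IH ?orbT //.
by rewrite E infix_infix.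
Qed.

Lemma infix_rev2 (s : seq C) u v : infix [:: u; v] (rev s) = infix [:: v; u] s.
Proof. by rewrite -[[:: u; v]]/(rev [:: v; u]) infix_rev. Qed.

Lemma pedges_infix x p e : e \in pedges x p ->
  exists u v, e = [fset u; v] /\ infix [:: u; v] (x :: p).
Proof.
elim: p x => [|y p IH] x //=; rewrite in_fset1U => /predU1P[->|/IH[u [v [-> h]]]].
  exists x, y; split=> //; exact: (prefix_infix [:: x; y] p).
by exists u, v; split=> //; apply: infix_trans h (infix_cons _ _).
Qed.

Lemma infix_map (T U : eqType) (g : T -> U) (s1 s2 : seq T) :
  infix s1 s2 -> infix (map g s1) (map g s2).
Proof. by move=> /infixP[a [b ->]]; rewrite !map_cat infix_infix. Qed.

Lemma infix2_of_map (g : C -> C) (s : seq C) u v : infix [:: u; v] (map g s) ->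
  exists a b, [/\ infix [:: a; b] s, u = g a & v = g b].
Proof.
elim: s => [|c s IH]; first by move=> /infix2P[[|? [|? ?]] [?]].
move=> /infix2P[[|d s1] [s2]] /=.
  case: s {IH} => [//|c' s] [<- <- _]; exists c, c'; split=> //.
  exact: (prefix_infix [:: c; c'] s).
move=> [_ E]; have : infix [:: u; v] (map g s) by rewrite E infix_infix.
by move=> /IH[a [b [h -> ->]]]; exists a, b; split=> //; apply: infix_trans h (infix_cons _ _).
Qed.

Section Trace.
Variables (N m : nat).
Hypothesis ga_inj_gq : forall j k : int, ga R N m j = ga R N m k -> gq R N j = gq R N k.
Hypothesis gq_inj_ga : forall j k : int, gq R N j = gq R N k -> ga R N m j = ga R N m k.
Hypothesis gq_V0 : forall j : int, gq R N j \in V0 R N.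
Hypothesis ga_bd : forall j : int, ga R N m j \in boundary R N m.

(** A path has a single component, so its trace is again a path: its boundary vertices in order,
    relabelled. *)
Lemma trace_crossing x p (j k : int) : uniq (x :: p) -> x = ga R N m j -> last x p = ga R N m k ->
  (0 < size p)%N -> S_ N (trace N m (pedges x p)).
Proof.
move=> up xj lk sp; have lin := pedges_linear_forest up.
have bd : {subset [seq z <- x :: p | z \in boundary R N m] <= boundary R N m}.
  by move=> z; rewrite mem_filter => /andP[].
set f := [seq z <- x :: p | z \in boundary R N m].
(* An index is determined by its vertex only modulo the period, so the relabelling is a choice on
   vertices. *)
have [g gE] : exists g : C -> C, forall i : int, g (ga R N m i) = gq R N i.
  have [g gP] : {g : C -> C & forall z, (exists i : int, z = ga R N m i) ->
      exists2 i : int, z = ga R N m i & g z = gq R N i}.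
    apply: (@choice C C (fun z y => (exists i : int, z = ga R N m i) ->
      exists2 i : int, z = ga R N m i & y = gq R N i)) => z.
    have [[i zi]|h] := pselect (exists i : int, z = ga R N m i).
      by exists (gq R N i) => _; exists i.
    by exists z.
  exists g => i; have [|i' /ga_inj_gq -> ->] := gP (ga R N m i); by [exists i|].
have bdP z : z \in boundary R N m -> exists i : int, z = ga R N m i.
  by case/imfsetP => i _ ->; exists (Posz i).
have xb : x \in boundary R N m by rewrite xj; exact: ga_bd.
have lb : last x p \in boundary R N m by rewrite lk; exact: ga_bd.
have fP z : z \in f -> exists i : int, z = ga R N m i by move=> /bd/bdP.
have uf : uniq f by rewrite filter_uniq.
have ug : uniq (map g f).
  rewrite map_inj_in_uniq // => z z' /fP[i ->] /fP[i' ->]; rewrite !gE.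
  exact: gq_inj_ga.
have fx : f = x :: [seq z <- p | z \in boundary R N m] by rewrite /f /= xb.
set f' := [seq z <- p | z \in boundary R N m] in fx.
have sf' : (0 < size f')%N.
  case: (p) sp lb @f' {fx} => // y p' _ lb f'.
  have : last x (y :: p') \in f' by rewrite mem_filter lb /= mem_last.
  by case: f'.
have TE : trace N m (pedges x p) = pedges (g x) (map g f').
  apply/fsetP => e; rewrite !inE /=; apply/andP/idP.
    case=> _ /asboolP[q [j' [k' [cq inf ->]]]].
    have inf' : infix [:: ga R N m j'; ga R N m k'] f \/ infix [:: ga R N m k'; ga R N m j'] f.
      have [qE|qE] := component_pedges up cq; rewrite qE in inf; first by left.
      by right; move: inf; rewrite filter_rev infix_rev2.
    case: inf' => /(infix_map g); rewrite fx /= !gE => /infix2_adj //.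
    by rewrite fsetUC.
  move=> eT; have [u [v [-> inf]]] := pedges_infix eT.
  move: inf; rewrite -map_cons -fx => inf; have [c [d [inf' -> ->]]] := infix2_of_map inf.
  have [j' cE] := fP c (mem_infix inf' (mem_head _ _)).
  have [k' dE] : exists i : int, d = ga R N m i.
    by apply: fP; apply: (mem_infix inf'); rewrite !inE eqxx orbT.
  rewrite cE dE !gE; split.
    by rewrite fpowersetE fsubUset !fsub1set !gq_V0.
  apply/asboolP; exists (x :: p), j', k'; split=> //; last by rewrite -cE -dE.
  split=> //.
  - by rewrite /= -pedges_sub.
  - move=> u' v' _; rewrite adj_pedges // => /and3P[_ -> _]; by [].
rewrite TE; have ug' : uniq (g x :: map g f') by rewrite -map_cons -fx.
split.
- by rewrite -cardfs_eq0 card_pedges // size_map -lt0n.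
- exact: pedges_linear_forest.
- move=> e eT; apply/fsubsetP => z ze; have := pedges_mem eT ze.
  by rewrite -map_cons -fx => /mapP[z' /fP[i ->] ->]; rewrite gE.
Qed.

End Trace.

Lemma sub_linear_forest G H : (H `<=` G)%fset -> linear_forest G -> linear_forest H.
Proof.
move=> /fsubsetP HG [c2 d2 ac]; split.
- by move=> e /HG; apply: c2.
- move=> x; apply: leq_trans (d2 x); apply: fsubset_leq_card; apply/fsubsetP => e.
  by rewrite !inE /= => /andP[/HG -> ->].
- move=> [c [sc uc cc]]; apply: ac; exists c; split=> //.
  by apply: sub_cycle cc => u v; apply: HG.
Qed.

Definition vlist G : seq C := enum_fset (\bigcup_(e <- G) e)%fset.

Lemma mem_vlist G u : u \in vlist G <-> exists2 e, e \in G & u \in e.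
Proof.
split; first by case/bigfcupP => e /andP[eG _] ue; exists e.
by case=> e eG ue; apply/bigfcupP; exists e; rewrite ?eG.
Qed.

Lemma adj_vlist G u v : adj G u v -> u \in vlist G /\ v \in vlist G.
Proof. by move=> h; split; apply/mem_vlist; exists [fset u; v] => //; rewrite !inE eqxx ?orbT. Qed.

(** * Leaves and components of a linear forest, through longest paths *)

Section Leaves.
Variable G : graph R.
Hypothesis LF : linear_forest G.

Let c2 : forall e, e \in G -> #|` e| = 2%N := let: And3 h _ _ := LF in h.

Definition longest x p := [/\ uniq (x :: p), path (adj G) x p &
  forall x' p', uniq (x' :: p') -> path (adj G) x' p' -> (size p' <= size p)%N].

Lemma longest_exists : G != fset0 -> exists x p, longest x p /\ (0 < size p)%N.
Proof.
case/fset0Pn => e eG; have /eqP/cardfs2P[u [v [uv eE]]] := c2 eG.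
pose Q n := `[< exists x p, [/\ uniq (x :: p), path (adj G) x p & size p = n] >].
have Q1 : Q 1%N.
  apply/asboolP; exists u, [:: v]; split=> //; first by rewrite /= inE uv.
  by rewrite /= andbT /adj -eE.
have bnd n : Q n -> (n <= size (vlist G))%N.
  case/asboolP => x [p [/= /andP[_ up] pp <-]]; apply: uniq_leq_size => //.
  by apply: saw_in pp => a b /adj_vlist[].
have [n /asboolP[x [p [up pp sp]]] mx] := @ex_maxnP Q _ (ex_intro (fun n => Q n) _ Q1) bnd.
exists x, p; split; last by rewrite sp; apply: mx.
by split=> // x' p' up' pp'; rewrite sp; apply: mx; apply/asboolP; exists x', p'.
Qed.

(** A neighbour off the path would prolong it, and one further along it would close a cycle. *)
Lemma longest_first x y p t : longest x (y :: p) -> adj G x t -> t = y.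
Proof.
move=> [up pp mx] xt; have [_ _ ac] := LF.
case: (boolP (t \in x :: y :: p)) => tw; last first.
  have := mx t (x :: y :: p); rewrite cons_uniq tw up => /(_ isT).
  have -> : path (adj G) t [:: x, y & p].
    by rewrite -[path _ _ _]/(adj G t x && path (adj G) x (y :: p)) adjC xt pp.
  by rewrite ltnn => /(_ isT).
move: tw; rewrite inE => /predU1P[tx|]; first by have := adj_neq c2 xt; rewrite tx eqxx.
rewrite inE => /predU1P[//|tp]; exfalso; apply: ac.
case/splitPr: tp up pp {mx} => p1 p2 up pp.
exists (x :: y :: rcons p1 t); split.
- by rewrite /= size_rcons.
- move: up; rewrite -cat_rcons -!cat_cons cat_uniq => /andP[]; by [].
- move: pp; rewrite -cat_rcons [path _ _ _]/= cat_path => /and3P[xy pp _].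
  by rewrite /= xy rcons_path pp last_rcons adjC xt.
Qed.

Lemma longest_rev x p : longest x p -> longest (last x p) (rev (belast x p)).
Proof.
move=> [up pp mx]; split; rewrite ?size_rev ?size_belast //.
  by rewrite -rev_rcons -lastI rev_uniq.
by rewrite rev_path; apply: sub_path pp => u v; rewrite adjC.
Qed.

Lemma longest_degree1 x p : longest x p -> (0 < size p)%N -> degree G x = 1%N.
Proof.
case: p => // y p lg _; apply/eqP; rewrite eqn_leq.
have xy : adj G x y by case: lg => _ /andP[].
rewrite (degree_ge1 xy) andbT.
by apply: (degree_le c2 (s := [:: y])) => t /(longest_first lg) ->; rewrite mem_head.
Qed.

Lemma longest_degree1_last x p : longest x p -> (0 < size p)%N -> degree G (last x p) = 1%N.
Proof. by move=> /longest_rev lg sp; apply: longest_degree1 lg _; rewrite size_rev size_belast. Qed.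

(** The path already uses up the degree of each of its vertices, 1 at the ends and 2 inside, so it
    is a whole component. *)
Lemma longest_closed x p u t : longest x p -> (0 < size p)%N -> u \in x :: p -> adj G u t ->
  adj (pedges x p) u t.
Proof.
move=> lg sp uw ut; have [up pp _] := lg.
have sub : {subset pedges x p <= G} by apply/fsubsetP; rewrite pedges_sub.
pose i := index u (x :: p).
have il : (i < size (x :: p))%N by rewrite index_mem.
have one : degree G u = 1%N -> (exists v, adj (pedges x p) u v) -> adj (pedges x p) u t.
  move=> d1 [v uv]; case: (eqVneq t v) => [->//|tv].
  by have := degree_ge2 c2 ut (sub _ uv) tv; rewrite d1.
have nb k : (k < size (x :: p))%N -> (k == i.-1) || (k == i.+1) -> (0 < i)%N || (k == i.+1) ->
    adj (pedges x p) u (nth x (x :: p) k).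
  move=> kp h h'; rewrite adj_pedges // uw mem_nth // index_uniq // -/i andTb.
  case/orP: h h' => /eqP ->; last by rewrite !eqxx !orbT.
  by case: (i) => [|j] /=; rewrite ?eqxx // orbF.
case: (posnP i) => [i0|i0].
  have ux : u = x by rewrite -(nth_index x uw) -/i i0.
  apply: one; first by rewrite ux; apply: longest_degree1 lg sp.
  by exists (nth x (x :: p) 1); apply: nb; rewrite ?i0 ?eqxx ?orbT.
case: (eqVneq i (size p)) => [ip|ip].
  have ux : u = last x p by rewrite -(nth_index x uw) -/i ip -[last x p]/(last x (x :: p))
    -nth_last.
  apply: one; first by rewrite ux; apply: longest_degree1_last lg sp.
  by exists (nth x (x :: p) i.-1); apply: nb; rewrite ?eqxx ?i0 //;
    apply: leq_ltn_trans (leq_pred _) il.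
have i1 : (i.-1 < size (x :: p))%N by apply: leq_ltn_trans (leq_pred _) il.
have i2 : (i.+1 < size (x :: p))%N by rewrite /= ltnS ltn_neqAle ip -ltnS.
have h1 : adj (pedges x p) u (nth x (x :: p) i.-1) by apply: nb; rewrite ?eqxx ?i0.
have h2 : adj (pedges x p) u (nth x (x :: p) i.+1) by apply: nb; rewrite ?eqxx ?orbT.
case: (eqVneq t (nth x (x :: p) i.-1)) => [->//|t1].
case: (eqVneq t (nth x (x :: p) i.+1)) => [->//|t2].
have [_ d2 _] := LF; have := d2 u; rewrite leqNgt => /negP; case.
apply: (degree_ge3 c2 ut (sub _ h1) (sub _ h2)).
have h3 : nth x (x :: p) i.-1 != nth x (x :: p) i.+1.
  by rewrite nth_uniq //; apply/eqP; clear -i0; lia.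
by move: h3; rewrite cons_uniq cons_uniq inE mem_seq1 negb_or t1 t2 mem_seq1 => ->.
Qed.

End Leaves.

(** A longest path is a component with two leaves. Any edge outside it would give a second component
    with two further leaves, four in all. *)
Lemma forest_few_leaves G (L : seq C) : linear_forest G -> G != fset0 ->
  (size L <= 3)%N -> (forall v, degree G v = 1%N -> v \in L) ->
  exists x p, [/\ uniq (x :: p), (0 < size p)%N, G = pedges x p, x \in L & last x p \in L].
Proof.
move=> LF G0 sL HL; have [x [p [lg sp]]] := longest_exists LF G0.
have [up pp _] := lg.
have sub : {subset pedges x p <= G} by apply/fsubsetP; rewrite pedges_sub.
have xL := HL _ (longest_degree1 LF lg sp).
have lL := HL _ (longest_degree1_last LF lg sp).
have neq z q : uniq (z :: q) -> (0 < size q)%N -> z != last z q.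
  case: q => // y q /=; rewrite inE negb_or => /andP[/andP[zy zq] _] _.
  by apply: contraTneq (mem_last y q) => /= <-; rewrite inE negb_or zy.
exists x, p; split=> //; apply/eqP; rewrite eqEfsubset pedges_sub pp andbT; apply/negPn/negP => nG.
pose H := (G `\` pedges x p)%fset.
have H0 : H != fset0 by rewrite fsetD_eq0.
have LH : linear_forest H by apply: sub_linear_forest LF; apply: fsubsetDl.
have [x' [p' [lg' sp']]] := longest_exists LH H0; have [up' pp' _] := lg'.
have disj u t : adj H u t -> u \notin x :: p.
  rewrite /adj inE => /andP[n h]; apply/negP => uw.
  by move: n; have := longest_closed LF lg sp uw h; rewrite /adj => ->.
have dH u t : adj H u t -> degree G u = degree H u.
  move=> ut; congr #|` _|; apply/fsetP => e; rewrite !inE /=; case: (boolP (u \in e)) => ue;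
    rewrite ?andbF //.
  rewrite !andbT; case: (boolP (e \in pedges x p)) => [ep|//].
  by have := disj _ _ ut; rewrite (pedges_mem ep ue).
have [t xt] := degree1_adj (let: And3 h _ _ := LH in h) (longest_degree1 LH lg' sp').
have [t' lt] := degree1_adj (let: And3 h _ _ := LH in h) (longest_degree1_last LH lg' sp').
have xL' : x' \in L by apply: HL; rewrite (dH _ _ xt); apply: longest_degree1 lg' sp'.
have lL' : last x' p' \in L by apply: HL; rewrite (dH _ _ lt); apply: longest_degree1_last lg' sp'.
have d1 := disj _ _ xt; have d2 := disj _ _ lt.
have ne a b : a \notin x :: p -> b \in x :: p -> b != a.
  by move=> ha hb; apply: contraNneq ha => <-.
have : (size [:: x; last x p; x'; last x' p'] <= size L)%N.
  apply: uniq_leq_size; last by move=> z; rewrite !inE => /or4P[]/eqP ->.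
  rewrite /= !inE !negb_or (neq _ _ up sp) (neq _ _ up' sp') !ne ?mem_head ?mem_last //.
by move=> /leq_trans/(_ sL).
Qed.

End PathGraphs.

Local Open Scope ring_scope.

(** * The gasket *)

Section GasketStep.
Variables (R : realType) (n : nat).
Local Notation N := n.+3.
Hypothesis hN4 : ~~ (4 %| N)%N.
Local Notation C := R[i]%C.
Local Notation I := 'I_n.+3.
Implicit Types (x y z : C) (i j : I) (m : nat).

Let hN : (3 <= N)%N. Proof. by []. Qed.

Local Notation gq := (gq R N).
Local Notation Psi := (@Psi R N).
Local Notation Pinv := (@Psi_inv R N).
Local Notation ga := (ga R N).

(** The graph [F m] is blown up by [Psi_inv 0]. Zooming in returns to the unscaled picture, in which
    the cells are the images of the maps [Psi]. *)
Definition zoom_in m z : C := iter m (Psi 0) z.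
Definition zoom_out m z : C := iter m (Pinv 0) z.
Definition cell m i z : C := zoom_out m.+1 (Psi (Posz i) (zoom_in m z)).
Definition corner m i : C := ga m (Posz i).
Definition shift : I := (gs N)%:R.

Lemma zoom_inK m : cancel (zoom_in m) (zoom_out m).
Proof.
elim: m => [|m IH] z //; rewrite /zoom_in /zoom_out iterSr iterS.
by rewrite (PsiK hN hN4); apply: IH.
Qed.

Lemma zoom_outK m : cancel (zoom_out m) (zoom_in m).
Proof.
elim: m => [|m IH] z //; rewrite /zoom_in /zoom_out iterSr iterS.
by rewrite (Psi_invK hN hN4); apply: IH.
Qed.

Lemma natI k : val (k%:R : I) = (k %% N)%N.
Proof. by rewrite (Zp_nat n.+1 k). Qed.

Lemma eqN_add i j : eqN N (Posz (val (i + j))) (Posz (val i) + Posz (val j)).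
Proof. by apply/eqN_mod; rewrite -PoszD -modz_nat modz_mod. Qed.

Lemma eqN_opp i : eqN N (Posz (val (- i))) (- Posz (val i)).
Proof.
apply/eqN_mod; rewrite -modz_nat modz_mod.
have iN : (val i <= N)%N by apply: ltnW; exact: ltn_ord.
by rewrite -subzn // addrC modzDr.
Qed.

Lemma eqN_nat k : eqN N (Posz (val (k%:R : I))) (Posz k).
Proof. by apply/eqN_mod; rewrite natI -modz_nat modz_mod. Qed.

Lemma eqN_I i j : eqN N (Posz (val i)) (Posz (val j)) -> i = j.
Proof.
move/eqN_mod => E; apply: val_inj; have := E.
by rewrite !modz_nat !modn_small ?ltn_ord // => -[].
Qed.
Lemma shift_gs : eqN N (Posz (val shift)) (Posz (gs N)).
Proof. exact: eqN_nat. Qed.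

Lemma eqN_trans a b c : eqN N a b -> eqN N b c -> eqN N a c.
Proof. by move=> [z ->] [z' ->]; exists (z' + z); ring. Qed.

Lemma eqN_sym a b : eqN N a b -> eqN N b a.
Proof. by move=> [z ->]; exists (- z); ring. Qed.

Lemma eqN_refl a : eqN N a a.
Proof. by exists 0; ring. Qed.

Lemma eqN_addm a b c d : eqN N a b -> eqN N c d -> eqN N (a + c) (b + d).
Proof. by move=> [z ->] [z' ->]; exists (z + z'); ring. Qed.

Lemma eqN_oppm a b : eqN N a b -> eqN N (- a) (- b).
Proof. by move=> [z ->]; exists (- z); ring. Qed.

Lemma ga_eqN m (a b : int) : ga m a = ga m b <-> eqN N a b.
Proof.
split=> [|e]; last by rewrite /Defs.ga (gq_eqN R hN e).
by move=> /(can_inj (zoom_outK m)) /(gq_inj hN hN4).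
Qed.

Lemma cornerE m i (a : int) : eqN N (Posz (val i)) a -> corner m i = ga m a.
Proof. by move=> e; apply/ga_eqN. Qed.

Lemma corner_inj m : injective (corner m).
Proof. by move=> i j /ga_eqN/eqN_I. Qed.

Lemma Psi_word_hull (w : seq I) x : hull N x ->
  hull N (foldr (fun (j : I) y => Psi (Posz j) y) x w).
Proof. by move=> hx; elim: w => //= j w IH; apply: hull_Psi. Qed.

Lemma F_edgeE m (w : m.-tuple I) (j : I) :
  F_edge R w j = [fset zoom_out m (Psi_word w (gq (Posz j)));
    zoom_out m (Psi_word w (gq (Posz j + 1)))].
Proof. by []. Qed.

Lemma FP m e : e \in F R N m -> exists (w : m.-tuple I) (j : I), e = F_edge R w j.
Proof. by case/imfset2P => w _ [j _ ->]; exists w, j. Qed.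

Lemma F_in m (w : m.-tuple I) (j : I) : F_edge R w j \in F R N m.
Proof. by apply/imfset2P; exists w => //; exists j. Qed.

Definition verts m := vlist (F R N m).

Lemma verts_hull m x : x \in verts m -> hull N (zoom_in m x).
Proof.
case/mem_vlist => e eF xe; have [w [j eE]] := FP eF.
move: xe; rewrite eE F_edgeE !inE => /orP[]/eqP ->; rewrite zoom_outK;
by apply: Psi_word_hull; apply: hull_gq.
Qed.

Lemma cell_zoom m i (w : m.-tuple I) j : F_edge R (cons_tuple i w) j =
  [fset cell m i z | z in F_edge R w j].
Proof.
rewrite !F_edgeE imfsetU !imfset_fset1 /cell /= !zoom_outK.
by [].
Qed.

Lemma adj_cell m x y : adj (F R N m.+1) x y <->
  exists i x' y', [/\ x = cell m i x', y = cell m i y' & adj (F R N m) x' y'].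
Proof.
split=> [/FP[w [j]]|[i [x' [y' [-> -> /FP[w [j E]]]]]]].
  case/tupleP: w => i w; rewrite -[[tuple of _]]/(cons_tuple i w) cell_zoom F_edgeE imfsetU
    !imfset_fset1 => /eqP.
  rewrite fset2_eq => /orP[/andP[/eqP -> /eqP ->]|/andP[/eqP -> /eqP ->]].
    by do 3 eexists; split; try reflexivity; rewrite /adj -F_edgeE F_in.
  by do 3 eexists; split; try reflexivity; rewrite adjC /adj -F_edgeE F_in.
suff -> : adj (F R N m.+1) (cell m i x') (cell m i y') =
  (F_edge R (cons_tuple i w) j \in F R N m.+1).
  exact: F_in.
by rewrite cell_zoom -E imfsetU !imfset_fset1.
Qed.

Lemma gs_char k : (k%:R == 0 :> I) = (N %| k)%N.
Proof. by rewrite -val_eqE natI /dvdn. Qed.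

Lemma gs_lt : (0 < gs N)%N /\ (2 * gs N < N)%N.
Proof. by have [_ [h1 h2]] := gs_bounds R hN hN4; lia. Qed.

Lemma corner_vert m i : corner m i \in verts m.
Proof.
pose w := [tuple of nseq m i].
have E : zoom_out m (Psi_word w (gq (Posz i))) = corner m i.
  congr zoom_out; rewrite /Psi_word /w /=; elim: (m) => //= k ->.
  exact: Psi_gq.
by apply/mem_vlist; exists (F_edge R w i); rewrite ?F_in // F_edgeE !inE E eqxx.
Qed.

Lemma gasket_step m : one_step N shift (adj (F R N m)) (adj (F R N m.+1)) (verts m)
  (cell m) (corner m) (corner m.+1).
Proof.
have [s0 s2] := gs_lt.
split.
- by [].
- exact: gs_char.
- by rewrite gs_char; apply/negP => /(dvdn_leq s0); lia.
- rewrite -subr_eq0 opprK -natrD gs_char; apply/negP => /dvdn_leq; lia.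
- by move=> x y /adj_vlist.
- exact: corner_vert.
- exact: corner_inj.
- by move=> i; apply: inj_comp; [apply: can_inj (zoom_outK _) | apply: inj_comp;
  [apply: (Psi_inj hN hN4) | apply: can_inj (zoom_inK _)]].
- exact: adj_cell.
- by move=> i; rewrite /cell /corner /Defs.ga -/(zoom_out _ _) zoom_outK Psi_gq.
- move=> i; rewrite /cell /corner; congr zoom_out.
  have e1 : eqN N (Posz (val (i + shift))) (Posz (val i) + Posz (gs N)).
    by apply: eqN_trans (eqN_add _ _) _; apply: eqN_addm (eqN_refl _) shift_gs.
  have e2 : eqN N (Posz (val (i + 1))) (Posz (val i) + 1).
    by apply: eqN_trans (eqN_add _ _) _; apply: eqN_addm (eqN_refl _) (eqN_nat 1).
  have e3 : eqN N (Posz (val (i + 1 - shift))) (Posz (val i) + 1 - Posz (gs N)).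
    apply: eqN_trans (eqN_add _ _) _; apply: eqN_addm e2 _.
    by apply: eqN_trans (eqN_opp _) _; apply: eqN_oppm shift_gs.
  rewrite (Psi_eqN hN _ e2) /Defs.ga -!/(zoom_out _ _) !zoom_outK (gq_eqN R hN e1) (gq_eqN R hN e3).
  exact: Psi_contact.
- move=> i j x y /verts_hull hx /verts_hull hy /(can_inj (zoom_outK _)) E.
  have nxt (k : I) : eqN N (Posz (val (k + 1)%R)) (Posz (val k) + 1).
    by apply: eqN_trans (eqN_add _ _) _; apply: eqN_addm (eqN_refl _) (eqN_nat 1).
  have pls (k : I) : eqN N (Posz (val (k + shift)%R)) (Posz (val k) + Posz (gs N)).
    by apply: eqN_trans (eqN_add _ _) _; apply: eqN_addm (eqN_refl _) shift_gs.
  have mns (k : I) : eqN N (Posz (val (k + 1 - shift)%R)) (Posz (val k) + 1 - Posz (gs N)).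
    apply: eqN_trans (eqN_add _ _) _; apply: eqN_addm (nxt k) _.
    by apply: eqN_trans (eqN_opp _) _; apply: eqN_oppm shift_gs.
  have back z a (k : I) : eqN N (Posz (val k)) a -> zoom_in m z = gq a -> z = corner m k.
    by move=> e /(congr1 (zoom_out m)); rewrite zoom_inK (cornerE m e).
  case: (Psi_contact_only hN hN4 hx hy E) => [ij|[ji xE yE]|[ij yE xE]].
  + by constructor 1; apply: eqN_I.
  + constructor 2; split; last exact: back (mns i) yE.
      by apply: eqN_I; apply: eqN_trans ji (eqN_sym (nxt i)).
    exact: back (pls i) xE.
  + constructor 3; split; last exact: back (mns j) xE.
      by apply: eqN_I; apply: eqN_trans ij (eqN_sym (nxt j)).
    exact: back (pls j) yE.
Qed.

Definition rot m (t : int) z : C := zoom_out m (gq t * zoom_in m z).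
Definition refl m z : C := zoom_out m (conjc (zoom_in m z)).

Lemma rot_corner m (t i : I) : rot m (Posz (val t)) (corner m i) = corner m (t + i).
Proof.
rewrite /rot /corner /Defs.ga -/(zoom_out _ _) zoom_outK -(gqD _ hN).
by congr zoom_out; apply/esym; apply: (gq_eqN R hN); exact: eqN_add.
Qed.

Lemma refl_corner m i : refl m (corner m i) = corner m (- i).
Proof.
rewrite /refl /corner /Defs.ga -/(zoom_out _ _) zoom_outK -(gqN_conj _ hN).
by congr zoom_out; apply/esym; apply: (gq_eqN R hN); exact: eqN_opp.
Qed.

Lemma reflK m : cancel (refl m) (refl m).
Proof. by move=> z; rewrite /refl zoom_outK conjcK zoom_inK. Qed.

Lemma rotK m t : cancel (rot m t) (rot m (- t)).
Proof.
by move=> z; rewrite /rot zoom_outK mulrA -(gqD _ hN) addNr (gq0 _ hN) mul1r zoom_inK.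
Qed.

Lemma int_ord (a : int) : exists j : I, eqN N a (Posz (val j)).
Proof.
exists (inord (`|(a %% N)%Z|)%N); rewrite /= inordK; last first.
  by rewrite -ltz_nat gez0_abs ?modz_ge0 // ltz_pmod.
by rewrite gez0_abs ?modz_ge0 //; apply/eqN_mod; rewrite modz_mod.
Qed.

Lemma Psi_word_rot (t : int) (w : seq I) :
  exists w' : seq I, size w' = size w /\ forall x,
  gq t * foldr (fun (j : I) y => Psi (Posz j) y) x w =
  foldr (fun (j : I) y => Psi (Posz j) y) (gq t * x) w'.
Proof.
elim: w => [|j w [w' [sw' E]]]; first by exists [::].
have [j' ej] := int_ord (t + Posz (val j)).
exists (j' :: w'); split=> [|x]; rewrite /= ?sw' //.
by rewrite (Psi_rot hN) E (Psi_eqN hN _ ej).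
Qed.

Lemma Psi_word_conj (w : seq I) x :
  conjc (foldr (fun (j : I) y => Psi (Posz j) y) x w) =
  foldr (fun (j : I) y => Psi (Posz j) y) (conjc x) (map -%R w).
Proof.
elim: w => //= j w <-; rewrite (Psi_conj hN); apply: (Psi_eqN hN).
exact: eqN_sym (eqN_opp j).
Qed.

Let adj_word m (w : seq I) (a : int) : size w = m ->
  [fset zoom_out m (foldr (fun (j : I) y => Psi (Posz j) y) (gq a) w);
    zoom_out m (foldr (fun (j : I) y => Psi (Posz j) y) (gq (a + 1)) w)] \in F R N m.
Proof.
move=> sw; have [j aj] := int_ord a; have [j1 aj1] := int_ord (a + 1).
have -> : [fset zoom_out m (foldr (fun (j : I) y => Psi (Posz j) y) (gq a) w);
    zoom_out m (foldr (fun (j : I) y => Psi (Posz j) y) (gq (a + 1)) w)] =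
   F_edge R (tcast sw (in_tuple w)) j.
  rewrite F_edgeE /Psi_word val_tcast /= (gq_eqN R hN aj).
  by rewrite (gq_eqN R hN (eqN_addm aj (eqN_refl 1))).
exact: F_in.
Qed.

Lemma adj_rot m t x y : adj (F R N m) x y -> adj (F R N m) (rot m t x) (rot m t y).
Proof.
move=> /FP[w [j /eqP]]; rewrite F_edgeE fset2_eq.
have [w' [sw' E]] := Psi_word_rot t w; rewrite size_tuple in sw'.
have H a : rot m t (zoom_out m (Psi_word w (gq a))) =
     zoom_out m (foldr (fun (j : I) y => Psi (Posz j) y) (gq (t + a)) w').
  by rewrite /rot zoom_outK E (gqD _ hN).
case/orP=> /andP[/eqP -> /eqP ->]; rewrite !H addrA; last rewrite adjC.
  exact: adj_word.
exact: adj_word.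
Qed.

Lemma adj_refl m x y : adj (F R N m) x y -> adj (F R N m) (refl m x) (refl m y).
Proof.
move=> /FP[w [j /eqP]]; rewrite F_edgeE fset2_eq.
have H a : refl m (zoom_out m (Psi_word w (gq a))) =
     zoom_out m (foldr (fun (j : I) y => Psi (Posz j) y) (gq (- a)) (map -%R w)).
  by rewrite /refl zoom_outK Psi_word_conj (gqN_conj _ hN).
have sw : size (map -%R w : seq I) = m by rewrite size_map size_tuple.
have E : - Posz j = - (Posz j + 1) + 1 by lia.
case/orP=> /andP[/eqP -> /eqP ->]; rewrite !H E; first rewrite adjC; exact: adj_word.
Qed.

Section CornerWeights.
Variable w : R.

Definition wt m i j B := pf w (avw (adj (F R N m)) (corner m i) (corner m j) B).

(* With [w = exp (- beta)], [wX] and [wY] are the paper's [X_m] and [Y_m], while [wx] and [wy]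
   only count the crossings avoiding the third corner: [x_m] is [wx] for [N = 3], [phi_1] and
   [theta_1] are [wx] and [wy] for [N = 5]. *)
Definition wX m := wt m 0 shift pred0.
Definition wx m := wt m 0 shift (pred1 (corner m (- shift))).
Definition wY m := wt m (- shift) shift pred0.
Definition wy m := wt m (- shift) shift (pred1 (corner m 0)).

Lemma wt_rot m (t i j k : I) :
  wt m (t + i) (t + j) pred0 = wt m i j pred0 /\
  wt m (t + i) (t + j) (pred1 (corner m (t + k))) = wt m i j (pred1 (corner m k)).
Proof.
have fK := @rotK m (Posz (val t)); have gK := @rotK m (- Posz (val t)); rewrite opprK in gK.
rewrite /wt -!rot_corner; split; rewrite (pf_avw_sym _ _ _ _ fK gK) //; try exact: adj_rot.
by congr pf; congr avw; apply/funext => x /=; rewrite (can_eq fK).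
Qed.

Lemma wt_refl m (i j k : I) :
  wt m (- i) (- j) pred0 = wt m i j pred0 /\
  wt m (- i) (- j) (pred1 (corner m (- k))) = wt m i j (pred1 (corner m k)).
Proof.
have fK := @reflK m.
rewrite /wt -!refl_corner; split; rewrite (pf_avw_sym _ _ _ _ fK fK) //; try exact: adj_refl.
by congr pf; congr avw; apply/funext => x /=; rewrite (can_eq fK).
Qed.

Lemma wt_rev m (i j k : I) : i != k -> j != k ->
  wt m i j (pred1 (corner m k)) = wt m j i (pred1 (corner m k)).
Proof.
move=> ik jk; apply: pf_avw_rev; rewrite /= ?(inj_eq (@corner_inj m)) //.
by move=> x y; apply: adjC.
Qed.

Let s_ne : shift != 0 /\ shift != - shift.
Proof. by split; [exact: os_s (gasket_step 0) | exact: os_2s (gasket_step 0)]. Qed.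

(** Rotation suffices for most of the fields. In [sw_x'] the forbidden corner lies on the other
    side, so the walk is also reversed and reflected. *)
Lemma gasket_weights m :
  symmetric_weights shift (adj (F R N m)) (corner m) w (wX m) (wx m) (wY m) (wy m).
Proof.
have [s0 s2] := s_ne.
have R0 t i j : wt m (t + i) (t + j) pred0 = wt m i j pred0 := (wt_rot m t i j 0).1.
have R1 t i j k := (wt_rot m t i j k).2.
split=> i; rewrite -/(wt m _ _ _).
- by rewrite -[X in wt m X _]addr0 R0.
- by rewrite -[X in wt m _ X](subrK shift) -[X in wt m X _]addr0 R0.
- by rewrite -[X in wt m X _]addr0 R1.
- rewrite wt_rev; last 2 first.
  + by rewrite (inj_eq (addrI i)) eq_sym.
  + by rewrite -subr_eq0 opprD addrA subrr sub0r oppr_eq0.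
  rewrite -[X in wt m X _]addr0 R1 -[X in wt m X]oppr0 -[X in pred1 (corner m X)]opprK.
  by rewrite (wt_refl m _ _ _).2.
- by rewrite R0.
- by rewrite -[X in pred1 (corner m X)]addr0 R1.
Qed.

Lemma gasket_weights_opp m :
  symmetric_weights shift (adj (F R N m)) (corner m \o -%R) w (wX m) (wx m) (wY m) (wy m).
Proof.
have [h1 h2 h3 h4 h5 h6] := gasket_weights m.
have Q0 i j : wt m (- i) (- j) pred0 = wt m i j pred0 := (wt_refl m i j 0).1.
have Q1 i j k := (wt_refl m i j k).2.
by split=> i /=; rewrite -/(wt m _ _ _) ?Q0 ?Q1;
  [apply: h1|apply: h2|apply: h3|apply: h4|apply: h5|apply: h6].
Qed.

Definition between m (T : seq I) (i : I) k := \prod_(0 <= l < k.-1)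
  (if i + l.+1%:R \in T then wy m else wY m).
Definition ends m k := if k == N.-1 then wX m * wx m + wx m * (wX m - wx m) else wX m * wX m.

(** The backward way is evaluated in the reflected necklace, whence the negated indices and
    [N - k]. *)
Lemma gasket_rec m (i : I) k (T : seq I) : (0 < k < N)%N -> i \notin T -> i + k%:R \notin T ->
  wt m.+1 i (i + k%:R) (fun x => x \in map (corner m.+1) T) =
  between m T i k * ends m k + between m (map -%R T) (- i) (N - k)%N * ends m (N - k)%N.
Proof.
move=> kN iT ikT; rewrite /wt /avw (crossing_pf _ _ _ (gasket_step m) kN).
congr (_ + _).
  have := turn_eval (gasket_step m) (gasket_weights m) kN iT ikT.
  by apply.
have kN' : (0 < N - k < N)%N by move: kN => /andP[]; lia.
have -> : (fun x => x \in map (corner m.+1) T) =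
    (fun x => x \in map (corner m.+1 \o -%R) (map -%R T)).
  apply/funext => x; rewrite -map_comp; congr (x \in _); apply: eq_map => j /=.
  by rewrite opprK.
have iT' : - i \notin map -%R T by rewrite (mem_map oppr_inj).
have ikT' : - i + (N - k)%:R \notin map -%R T.
  rewrite natrB; last by case/andP: kN => _ /ltnW.
  have /eqP -> : N%:R == 0 :> I by rewrite gs_char.
  by rewrite sub0r -opprD (mem_map oppr_inj).
have := turn_eval (one_step_opp (gasket_step m)) (gasket_weights_opp m) kN' iT' ikT'.
by apply.
Qed.

End CornerWeights.

End GasketStep.

Section WalkSumsBounds.
Variables (R : realType) (V : choiceType).
Implicit Types (w : R) (S : set (seq V)).

Lemma pf_ge w S p : 0 < w -> finite_set S -> S p -> w ^+ size p <= pf w S.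
Proof.
move=> w0 fS Sp; rewrite (pfID w [set p] fS).
have -> : (S `&` [set p] = [set p])%classic by apply/seteqP; split=> [q []//|q ->].
rewrite {1}/pf fsbig_set1 lerDl; apply: pf_ge0; first exact: ltW.
by apply: sub_finite_set fS => q [].
Qed.

Lemma pf_scale w w' S : 0 < w' -> w' <= w -> finite_set S -> (forall p, S p -> (0 < size p)%N) ->
  pf w' S <= w' / w * pf w S.
Proof.
move=> w0 ww fS S0; have w1 := lt_le_trans w0 ww;
  rewrite /pf !fsbig_finite //= big_distrr /= !big_seq.
apply: ler_sum => p; rewrite in_fset_set // inE => /S0; case: (size p) => // k _.
rewrite !exprS mulrA divfK ?gt_eqF // ler_pM2l //.
by rewrite lerXn2r // nnegrE ltW.
Qed.

Lemma pf_continuous S : finite_set S -> continuous (fun w => pf w S).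
Proof.
move=> fS w.
have -> : (fun w => pf w S) = (fun w => \sum_(p <- fset_set S) w ^+ size p).
  by apply/funext => v; rewrite /pf fsbig_finite.
elim: (fset_set S : seq _) => [|p s IH].
  have -> : (fun w : R => \sum_(p <- [::] : seq (seq V)) w ^+ size p) = cst 0.
    by apply/funext => v; rewrite big_nil.
  exact: cvg_cst.
have -> : (fun w : R => \sum_(q <- p :: s) w ^+ size q) =
  (fun w => w ^+ size p + \sum_(q <- s) w ^+ size q).
  by apply/funext => v; rewrite big_cons.
by apply: cvgD IH; exact: exprn_continuous.
Qed.

Lemma avw_pred1 (e : rel V) u v c : avw e u v (pred1 c) = [set p | saw e u p v /\ c \notin p].
Proof. by rewrite /avw; under eq_set do rewrite has_pred1. Qed.

Lemma avw_pred0 (e : rel V) u v : avw e u v pred0 = [set p | saw e u p v].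
Proof. by apply/seteqP; split=> p => [[]//|h]; split; rewrite // has_pred0. Qed.

Lemma pf_visit w (e : rel V) u v c : finite_set (avw e u v pred0) ->
  pf w (avw e u v pred0) - pf w (avw e u v (pred1 c)) = pf w [set p | saw e u p v /\ c \in p].
Proof.
move=> fS; rewrite (pfID w [set p : seq V | c \in p] fS) avw_pred1 avw_pred0.
suff -> : ([set p | saw e u p v /\ c \notin p] =
  [set p | saw e u p v] `&` ~` [set p : seq V | c \in p])%classic.
  by rewrite addrK.
by apply/seteqP; split=> p [h /negP].
Qed.

End WalkSumsBounds.

Section GasketCrossings.
Variables (R : realType) (n : nat).
Local Notation N := n.+3.
Hypothesis hN4 : ~~ (4 %| N)%N.
Local Notation C := R[i]%C.
Local Notation I := 'I_n.+3.
Implicit Types (x y z : C) (i j t : I) (m k : nat) (w beta : R).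

Let hN : (3 <= N)%N. Proof. by []. Qed.

Lemma finite_walks m i j B : finite_set (avw (adj (F R N m)) (corner R m i) (corner R m j) B).
Proof. by apply: (finite_avw (gasket_step R hN4 m)). Qed.

Lemma crossing_saw m i j p :
  crossing N m (corner R m i) (corner R m j) p <-> saw (adj (F R N m)) (corner R m i) p (corner
    R m j).
Proof.
split; first by case=> h1 h2 h3; apply/and3P; split=> //; apply/eqP.
by case/and3P=> h1 h2 /eqP h3.
Qed.

Let termE beta (S : set (seq C)) : \sum_(p \in S) expR (- beta * (size p)%:R) =
  pf (expR (- beta)) S.
Proof. by apply: eq_fsbigr => p _; rewrite expRM_natr. Qed.

Lemma cross_total m beta i j :
  cross_pf N m beta (corner R m i) (corner R m j) (fun=> True) = wt (expR (- beta)) m i j pred0.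
Proof.
rewrite /cross_pf termE /wt avw_pred0; congr pf; apply/seteqP; split=> p.
  by case=> /crossing_saw.
by move/crossing_saw.
Qed.

Lemma cross_avoids m beta i j t : i != t ->
  cross_pf N m beta (corner R m i) (corner R m j) (avoids (corner R m t)) =
  wt (expR (- beta)) m i j (pred1 (corner R m t)).
Proof.
move=> it; rewrite /cross_pf termE /wt avw_pred1; congr pf; apply/seteqP; split=> p /=;
  rewrite /avoids.
  by case=> /crossing_saw h; rewrite inE negb_or => /andP[].
case=> /crossing_saw h np; split=> //; rewrite inE negb_or np andbT.
by rewrite (inj_eq (@corner_inj _ _ hN4 m)) eq_sym.
Qed.

Lemma cross_visits m beta i j t : i != t ->
  cross_pf N m beta (corner R m i) (corner R m j) (visits (corner R m t)) =
  wt (expR (- beta)) m i j pred0 - wt (expR (- beta)) m i j (pred1 (corner R m t)).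
Proof.
move=> it; rewrite /cross_pf termE /wt (pf_visit _ _ (finite_walks m i j pred0)).
congr pf; apply/seteqP; split=> p /=;
rewrite /visits inE (inj_eq (@corner_inj _ _ hN4 m)) [t == i]eq_sym (negPf it) /=.
  by case=> /crossing_saw.
by case=> /crossing_saw.
Qed.

Let adj0 i : adj (F R N 0) (corner R 0 i) (corner R 0 (i + 1)).
Proof.
have -> : corner R 0 (i + 1) = gq R N (Posz i + 1).
  apply: (gq_eqN R hN); apply: (eqN_trans (eqN_add _ _)).
  apply: eqN_addm (eqN_refl _ _) _; exact: (eqN_nat n 1).
by rewrite /adj; have := F_in R [tuple] i; rewrite F_edgeE.
Qed.

(** Arcs of the polygon are explicit walks at level 0; they bound the initial weights from below. *)
Definition arc i k : seq C := [seq corner R 0 (i + l%:R) | l <- iota 1 k].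

Lemma arc_saw i k : (k < N)%N -> saw (adj (F R N 0)) (corner R 0 i) (arc i k) (corner R 0 (i +
  k%:R)).
Proof.
move=> kN; have E : corner R 0 i :: arc i k = [seq corner R 0 (i + l%:R) | l <- iota 0 k.+1].
  by rewrite -[X in corner R 0 X :: _]addr0.
have pathP (j : nat) : path (adj (F R N 0)) (corner R 0 (i + j%:R)) [seq corner R 0 (i + l%:R) |
  l <- iota j.+1 k].
  elim: k j {kN E} => // k IH j; apply/andP; split; last exact: IH.
  by rewrite -natr1 addrA; exact: adj0.
apply/and3P; split.
- by have := pathP 0%N; rewrite addr0.
- rewrite E map_inj_in_uniq ?iota_uniq // => l l';
  rewrite !mem_iota !add0n => /andP[_ lk] /andP[_ lk'].
  move/(corner_inj hN4)/addrI/(congr1 val); rewrite !natI !modn_small //; lia.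
- have -> : last (corner R 0 i) (arc i k) = last (corner R 0 i) (corner R 0 i :: arc i k) by [].
  have iE : iota 0 k.+1 = rcons (iota 0 k) k by rewrite -[k.+1]addn1 iotaD cats1.
  by rewrite E iE map_rcons last_rcons.
Qed.

Lemma wt0_ge w i k B : 0 < w -> (k < N)%N -> (forall l,
  (0 < l <= k)%N -> ~~ B (corner R 0 (i + l%:R))) ->
  w ^+ k <= wt w 0 i (i + k%:R) B.
Proof.
move=> w0 kN HB; have sz : size (arc i k) = k by rewrite size_map size_iota.
rewrite -{1}sz; apply: pf_ge => //; first exact: finite_walks.
split; first exact: arc_saw.
rewrite has_map; apply/hasPn => l; rewrite mem_iota => lk /=; apply: HB; lia.
Qed.

Lemma wt0_gap w i k l : 0 < w -> (0 < l < k)%N -> (k < N)%N ->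
  w ^+ k <= wt w 0 i (i + k%:R) pred0 - wt w 0 i (i + k%:R) (pred1 (corner R 0 (i + l%:R))).
Proof.
move=> w0 lk kN; have sz : size (arc i k) = k by rewrite size_map size_iota.
rewrite /wt (pf_visit _ _ (finite_walks 0 i (i + k%:R) pred0)) -{1}sz; apply: pf_ge => //.
  by apply: sub_finite_set (finite_walks 0 i (i + k%:R) pred0) => p [h _]; rewrite avw_pred0.
by split; [exact: arc_saw | apply/mapP; exists l; rewrite // mem_iota; lia].
Qed.

Let walk_ne m i j B p : i != j ->
  avw (adj (F R N m)) (corner R m i) (corner R m j) B p -> (0 < size p)%N.
Proof.
move=> ij [/saw_ne h _]; have := h; rewrite (inj_eq (@corner_inj _ _ hN4 m)) => /(_ ij).
by case: p {h}.
Qed.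

Lemma wt_scale w w' m i j B : 0 < w' -> w' <= w -> i != j -> wt w' m i j B <= w' / w * wt w m i j B.
Proof. by move=> *; apply: pf_scale => //; [exact: finite_walks | move=> p; exact: walk_ne]. Qed.

Lemma wt_continuous m i j B : continuous (fun w => wt w m i j B).
Proof. by apply: pf_continuous; exact: finite_walks. Qed.

Lemma wt_ge0 w m i j B : 0 <= w -> 0 <= wt w m i j B.
Proof. by move=> w0; apply: pf_ge0 => //; exact: finite_walks. Qed.

End GasketCrossings.

(** * Boundary forests *)

Lemma sum_uniq_sub (R : numDomainType) (U : eqType) (s B : seq U) (g : U -> R) :
  uniq s -> {subset s <= B} -> (forall b, 0 <= g b) -> \sum_(b <- s) g b <= \sum_(b <- B) g b.
Proof.
move=> us sB g0; elim: s B us sB => [|b s IH] B /=; first by rewrite big_nil sumr_ge0.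
move=> /andP[bs us] sB; have bB : b \in B by apply: sB; rewrite mem_head.
rewrite (perm_big _ (perm_to_rem bB)) !big_cons lerD2l; apply: IH => // c cs.
have := sB c; rewrite inE cs orbT (perm_mem (perm_to_rem bB)) inE => /(_ isT)/predU1P[cb|//].
by move: bs; rewrite -cb cs.
Qed.

Lemma sum_inj_le (R : numDomainType) (T U : eqType) (A : seq T) (B : seq U) (h : T -> U)
  (f : T -> R) (g : U -> R) : uniq A -> {in A &, injective h} -> {in A, forall a, h a \in B} ->
  {in A, forall a, f a <= g (h a)} -> (forall b,
    0 <= g b) -> \sum_(a <- A) f a <= \sum_(b <- B) g b.
Proof.
move=> uA hi hB fg g0; apply: (@le_trans _ _ (\sum_(a <- A) g (h a))).
  by rewrite !big_seq; apply: ler_sum.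
rewrite -(big_map h xpredT g); apply: sum_uniq_sub => //; first by rewrite map_inj_in_uniq.
by move=> _ /mapP[a aA ->]; exact: hB.
Qed.

Section ForestBound.
Variables (R : realType) (n : nat).
Local Notation N := n.+3.
Hypothesis hN4 : ~~ (4 %| N)%N.
Local Notation C := R[i]%C.
Local Notation I := 'I_n.+3.
Implicit Types (x y z : C) (i j t : I) (m k : nat) (w beta : R) (G H : graph R) (e : {fset C}).

Let hN : (3 <= N)%N. Proof. by []. Qed.
Let OS m := gasket_step R hN4 m.
Local Notation s := (shift n).

Definition cell_edge m i e : {fset C} := [fset cell m i z | z in e].
(** Taken as a preimage in [F m], so that the parts in all cells range over subgraphs of one
    graph. *)
Definition cell_part m G i : graph R := [fset e in F R N m | cell_edge m i e \in G].

Lemma cell_partE m G i e : (e \in cell_part m G i) = (e \in F R N m) && (cell_edge m i e \in G).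
Proof. by rewrite !inE. Qed.

Lemma cell_edge2 m i x y : cell_edge m i [fset x; y] = [fset cell m i x; cell m i y].
Proof. by rewrite /cell_edge imfsetU !imfset_fset1. Qed.

Lemma mem_cell_edge m i e x : (cell m i x \in cell_edge m i e) = (x \in e).
Proof. by rewrite mem_imfset //; exact: os_Ainj (OS m) i. Qed.

Lemma card_cell_edges m i (A : graph R) : #|` [fset cell_edge m i e | e in A]| = #|` A|.
Proof.
rewrite card_imfset // => e e' E.
by apply/fsetP => z; rewrite -(mem_cell_edge m i e) E mem_cell_edge.
Qed.

Lemma F_cell m e : e \in F R N m.+1 -> exists i e', e' \in F R N m /\ e = cell_edge m i e'.
Proof.
case/FP=> v [j ->]; case/tupleP: v => i v; exists i, (F_edge R v j); split; first exact: F_in.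
by rewrite -[[tuple of _]]/(cons_tuple i v) cell_zoom.
Qed.

Lemma edge_vert m e x : e \in F R N m -> x \in e -> x \in verts R n m.
Proof. by move=> eF xe; apply/(mem_vlist (F R N m)); exists e. Qed.

(** An edge lying in two cells would have both ends at contact vertices: either at the same one, or
    at contacts on both sides, which makes [2] vanish in the ring of indices. *)
Lemma cell_edge_inj m i j e e' : e \in F R N m -> e' \in F R N m -> #|` e| = 2%N ->
  cell_edge m i e = cell_edge m j e' -> i = j /\ e = e'.
Proof.
move=> eF e'F e2 E.
have ij : i = j.
  have /eqP/cardfs2P[x [y [xy ee]]] := e2.
  have xe : x \in e by rewrite ee !inE eqxx.
  have ye : y \in e by rewrite ee !inE eqxx orbT.
  have get z : z \in e -> exists2 z', z' \in e' & cell m i z = cell m j z'.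
    move=> ze; have : cell m i z \in cell_edge m j e' by rewrite -E mem_cell_edge.
    by case/imfsetP => z' z'e ->; exists z'.
  have [x' xe' Ex] := get x xe; have [y' ye' Ey] := get y ye.
  have ct z z' : z \in e -> z' \in e' -> cell m i z = cell m j z' -> _ :=
    fun ze z'e => os_contact (OS m) (edge_vert eF ze) (edge_vert e'F z'e).
  have two a b : a = b + 1 -> b = a + 1 -> (a : I) = b.
    move=> ab ba; have /eqP : 2%:R == 0 :> I.
      by apply/eqP/(@addrI _ b); rewrite addr0 mulr2n addrA -ab -ba.
    move/eqP; by rewrite gs_char => /(dvdn_leq (isT : (0 < 2)%N)).
  case: (ct x x' xe xe' Ex) => [//|[ji Exx _]|[ij _ Exx]];
  case: (ct y y' ye ye' Ey) => [//|[ji' Eyy _]|[ij' _ Eyy]].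
  - by move: xy; rewrite Exx Eyy eqxx.
  - exact: two.
  - exact: two.
  - by move: xy; rewrite Exx Eyy eqxx.
split=> //; move: E; rewrite -ij => E; apply/fsetP => x.
by rewrite -(mem_cell_edge m i e) E mem_cell_edge.
Qed.

Section Parts.
Variables (m : nat) (G : graph R).
Hypotheses (GF : (G `<=` F R N m.+1)%fset) (lin : linear_forest G).

Let cardG e : e \in G -> #|` e| = 2%N. Proof. by case: lin => h _ _; exact: h. Qed.

Let part_card i e : e \in cell_part m G i -> #|` e| = 2%N.
Proof.
rewrite cell_partE => /andP[_ /cardG <-]; rewrite card_imfset //; exact: os_Ainj (OS m) i.
Qed.

Lemma parts_card : (\sum_i #|` cell_part m G i| <= #|` G|)%N.
Proof.
pose L := [seq cell_edge m i e | i <- enum I, e <- enum_fset (cell_part m G i)].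
have -> : (\sum_i #|` cell_part m G i| = size L)%N.
  by rewrite /L size_allpairs_dep sumnE big_map big_enum; apply: eq_bigr.
apply: uniq_leq_size.
  apply: allpairs_uniq_dep; first exact: enum_uniq.
    by move=> i _; exact: fset_uniq.
  move=> _ _ /allpairsPdep[i [e [_ ei ->]]] /allpairsPdep[j [e' [_ ej ->]]] /= E.
  have e2 := part_card ei; move: ei ej; rewrite !cell_partE => /andP[eF _] /andP[eF' _].
  by have [-> ->] := cell_edge_inj eF eF' e2 E.
by move=> _ /allpairsPdep[i [e [_ + ->]]]; rewrite /= cell_partE => /andP[].
Qed.

Lemma parts_linear i : linear_forest (cell_part m G i).
Proof.
have fi := os_Ainj (OS m) (i := i).
split=> [e|x|]; first exact: part_card.
  case: lin => _ /(_ (cell m i x)) h _; apply: leq_trans h.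
  rewrite /degree -(card_cell_edges m i).
  apply: fsubset_leq_card; apply/fsubsetP => _ /imfsetP[e /= + ->].
  by rewrite !inE /= => /andP[/andP[_ eG] xe]; rewrite eG mem_cell_edge.
case=> c [c3 uc cc]; case: lin => _ _; apply; exists (map (cell m i) c); split.
- by rewrite size_map.
- by rewrite map_inj_uniq.
- move: cc; case: c {c3 uc} => // x c; rewrite /= -map_rcons path_map; apply: sub_path => u v.
  by rewrite /adj cell_partE cell_edge2 => /andP[].
Qed.

(** Away from the contact corners the part has the same degree as the whole forest, so a leaf there
    is a leaf of [G]; it then lies on the boundary, and the only new corner of the cell [i] is its
    own. *)
Lemma parts_leaf i x : (forall z, degree G z = 1%N -> z \in boundary R N m.+1) ->
  degree (cell_part m G i) x = 1%N -> x \in [:: corner R m i; corner R m (i + s);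
    corner R m (i - s)].
Proof.
move=> bd d1; apply/negPn/negP; rewrite !inE !negb_or => /and3P[n1 n2 n3].
have [y /= xy] := degree1_adj (@part_card i) d1.
have xv : x \in verts R n m.
  by move: xy; rewrite /adj cell_partE => /andP[eF _]; apply: edge_vert eF _; rewrite !inE eqxx.
have dG : degree G (cell m i x) = 1%N.
  rewrite -d1 /degree -[RHS](card_cell_edges m i); congr #|` _|; apply/fsetP => e;
    apply/idP/imfsetP => /=; last first.
    by case=> e' + ->; rewrite !inE /= => /andP[/andP[_ ->]]; rewrite mem_cell_edge.
  rewrite !inE /= => /andP[eG xe].
  have [j [e' [e'F ee]]] := F_cell (fsubsetP GF _ eG).
  move: xe; rewrite ee => /imfsetP[x' /= xe' Ex].
  case: (os_contact (OS m) xv (edge_vert e'F xe') Ex) => [ij|[_ xE _]|[ij _ xE]].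
  - exists e'; rewrite ?ij // !inE e'F -ee eG /=.
    by move: Ex; rewrite ij => /(os_Ainj (OS m)) ->.
  - by rewrite xE eqxx in n2.
  - by rewrite xE ij eqxx in n3.
have := bd _ dG; case/imfsetP => j _ E; have [ij xE] := own_cell (OS m) xv E.
by rewrite xE ij eqxx in n1.
Qed.

End Parts.

Lemma parts_inj m G G' : (G `<=` F R N m.+1)%fset -> (G' `<=` F R N m.+1)%fset ->
  (forall i, cell_part m G i = cell_part m G' i) -> G = G'.
Proof.
move=> GF GF' E.
suff sub A B : (A `<=` F R N m.+1)%fset -> (forall i,
  cell_part m A i = cell_part m B i) -> (A `<=` B)%fset.
  by apply/eqP; rewrite eqEfsubset; apply/andP; split; apply: sub => // i; rewrite E.
move=> AF AB; apply/fsubsetP => e eA; have [i [e' [e'F ee]]] := F_cell (fsubsetP AF _ eA).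
have : e' \in cell_part m A i by rewrite cell_partE e'F -ee.
by rewrite AB cell_partE -ee => /andP[].
Qed.

Definition bforests m : {fset graph R} :=
  [fset G in fpowerset (F R N m) | `[< boundary_forest N m G >]].

Lemma bforestsP m G : G \in bforests m <-> boundary_forest N m G.
Proof.
rewrite !inE /=; split; first by case/andP=> _ /asboolP.
by move=> h; apply/andP; split; [rewrite fpowersetE; case: h | apply/asboolP].
Qed.

Definition total w m : R := \sum_(G <- bforests m) w ^+ #|` G|.

Let walks m i j : seq (seq C) :=
  fset_set (avw (adj (F R N m)) (corner R m i) (corner R m j) pred0).

Let mem_walks m i j p : (p \in walks m i j) = saw (adj (F R N m)) (corner R m i) p (corner R m j).
Proof.
rewrite in_fset_set; last exact: (finite_walks hN4).
by rewrite avw_pred0; apply/idP/idP; rewrite inE.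
Qed.

Let sum_walks w m i j : \sum_(p <- walks m i j) w ^+ size p = wt w m i j pred0.
Proof. by rewrite /wt /pf fsbig_finite //; exact: (finite_walks hN4). Qed.

(** The 1 accounts for the empty part. Any other part is a path between two of three corners,
    counted over the six ordered pairs, four of weight [wX] and two of weight [wY]; counting a path
    from both ends is harmless in an upper bound. *)
Let few_leaves_sum w m i (A : seq (graph R)) : 0 < w -> uniq A ->
  {in A, forall H, [/\ (H `<=` F R N m)%fset, linear_forest H & forall z, degree H z = 1%N ->
     z \in [:: corner R m i; corner R m (i + s); corner R m (i - s)]]} ->
  \sum_(H <- A) w ^+ #|` H| <= 1 + 4 * wX n w m + 2 * wY n w m.
Proof.
move=> w0 uA HA; set A' := [seq H <- A | H != fset0].
apply: (@le_trans _ _ (\sum_(H <- fset0 :: A') w ^+ #|` H|)).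
  apply: sum_uniq_sub => // [H HA0|H]; last by rewrite exprn_ge0 // ltW.
  by rewrite inE mem_filter HA0 andbT; case: eqP.
rewrite big_cons cardfs0 expr0 -addrA lerD2l.
pose PQ := [:: (i, i + s); (i + s, i); (i, i - s); (i - s, i); (i + s, i - s); (i - s, i + s)].
pose B := [seq (corner R m ij.1, p) | ij <- PQ, p <- walks m ij.1 ij.2].
have [h hP] : {h : graph R -> C * seq C & forall H, H \in A' -> [/\ uniq ((h H).1 :: (h H).2),
    H = pedges (h H).1 (h H).2 & h H \in B]}.
  apply: (@choice _ _ (fun H xp => H \in A' -> [/\ uniq (xp.1 :: xp.2),
    H = pedges xp.1 xp.2 & xp \in B])) => H.
  have [HA'|] := boolP (H \in A'); last by exists (0, [::]).
  move: (HA'); rewrite mem_filter => /andP[Hn /HA[HF lin leaves]].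
  have [x [p [up sp HE xL lL]]] := forest_few_leaves (L := [:: _; _; _]) lin Hn isT leaves.
  exists (x, p) => _; split=> //.
  have xl : x != last x p.
    case: p up sp {HE lL} => // y p /andP[xn _] _; apply: contra xn => /eqP E;
      rewrite [X in X \in _]E; exact: (mem_last y p).
  have pp : path (adj (F R N m)) x p by rewrite -pedges_sub -HE.
  have sB ij : ij \in PQ -> x = corner R m ij.1 -> last x p = corner R m ij.2 -> (x, p) \in B.
    move=> ijP xE lE; apply/allpairsPdep; exists ij, p; split=> //; last by rewrite xE.
    by rewrite mem_walks -xE -lE; apply/and3P; split.
  move: xL lL; rewrite !inE => /or3P[] /eqP xE /or3P[] /eqP lE; try by rewrite lE xE eqxx in xl.
  - by apply: (sB (i, i + s)) => //; rewrite !inE eqxx ?orbT.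
  - by apply: (sB (i, i - s)) => //; rewrite !inE eqxx ?orbT.
  - by apply: (sB (i + s, i)) => //; rewrite !inE eqxx ?orbT.
  - by apply: (sB (i + s, i - s)) => //; rewrite !inE eqxx ?orbT.
  - by apply: (sB (i - s, i)) => //; rewrite !inE eqxx ?orbT.
  - by apply: (sB (i - s, i + s)) => //; rewrite !inE eqxx ?orbT.
apply: (@le_trans _ _ (\sum_(xp <- B) w ^+ size xp.2)).
  apply: (sum_inj_le (h := h)).
  - exact: filter_uniq.
  - by move=> H H' /hP[_ E _] /hP[_ E' _] hh; rewrite [LHS]E hh -E'.
  - by move=> H /hP[].
  - by move=> H /hP[up HE _]; rewrite {1}HE card_pedges.
  - by move=> b; rewrite exprn_ge0 // ltW.
have -> : \sum_(xp <- B) w ^+ size xp.2 = \sum_(ij <- PQ) wt w m ij.1 ij.2 pred0.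
  by rewrite big_allpairs_dep; apply: eq_bigr => ij _; exact: sum_walks.
rewrite /PQ !big_cons big_nil addr0 /=.
have [hX hX' _ _ hY _] := gasket_weights hN4 w m.
have rev (a b : I) : wt w m a b pred0 = wt w m b a pred0 by apply: pf_avw_rev => // u v;
  exact: adjC.
have e1 : wt w m i (i + s) pred0 = wX n w m := hX i.
have e2 : wt w m (i - s) i pred0 = wX n w m := hX' i.
have e3 : wt w m (i - s) (i + s) pred0 = wY n w m := hY i.
have e4 : wt w m (i + s) i pred0 = wX n w m by rewrite rev.
have e5 : wt w m i (i - s) pred0 = wX n w m by rewrite rev.
have e6 : wt w m (i + s) (i - s) pred0 = wY n w m by rewrite rev.
rewrite e1 e2 e3 e4 e5 e6.
by rewrite le_eqVlt; apply/orP; left; apply/eqP; ring.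
Qed.

(** A forest is determined by its parts, and dropping all compatibility between cells leaves a
    product of [N] independent sums. *)
Lemma total_step w m : 0 < w -> w <= 1 ->
  total w m.+1 <= (1 + 4 * wX n w m + 2 * wY n w m) ^+ N.
Proof.
move=> w0 w1; pose J := fpowerset (F R N m).
have J0 : fset0 \in J by rewrite fpowersetE fsub0set.
pose j0 : J := [` J0]%fset.
pose ok i H := [/\ (H `<=` F R N m)%fset, linear_forest H & forall z, degree H z = 1%N ->
     z \in [:: corner R m i; corner R m (i + s); corner R m (i - s)]].
pose Q i (H : J) := `[< ok i (val H) >].
pose h G : {ffun I -> J} := [ffun i => insubd j0 (cell_part m G i)].
have hE G i : val (h G i) = cell_part m G i.
  by rewrite ffunE insubdK // -topredE /= fpowersetE; apply/fsubsetP => e;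
    rewrite cell_partE => /andP[].
apply: (@le_trans _ _ (\sum_(f in family Q) \prod_i w ^+ #|` val (f i)|)).
  rewrite -big_enum; apply: (sum_inj_le (h := h)).
  - exact: fset_uniq.
  - move=> G G' /bforestsP[_ GF _ _] /bforestsP[_ GF' _ _] E.
    by apply: (parts_inj GF GF') => i; rewrite -!hE E.
  - move=> G /bforestsP[_ GF lin bd]; rewrite mem_enum; apply/familyP => i.
    apply/asboolP; rewrite hE; split; first by apply/fsubsetP => e; rewrite cell_partE => /andP[].
      exact: parts_linear.
    by move=> z; exact: parts_leaf.
  - move=> G /bforestsP[_ GF lin bd]; under eq_bigr do rewrite hE.
    (* The parts have at most as many edges as the forest, and [w <= 1]. *)
    by rewrite prodrXr; apply: ler_wiXn2l; rewrite ?(ltW w0) //; exact: parts_card.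
  - by move=> f; apply: prodr_ge0 => i _; rewrite exprn_ge0 // ltW.
rewrite -(bigA_distr_big_dep _ (fun i (H : J) => w ^+ #|` val H|)).
have -> : (1 + 4 * wX n w m + 2 * wY n w m) ^+ N = \prod_(i : I) (1 + 4 * wX n w m + 2 * wY n w m).
  by rewrite prodr_const card_ord.
apply: ler_prod => i _; apply/andP; split; first by apply: sumr_ge0 => H _;
  rewrite exprn_ge0 // ltW.
rewrite -big_enum_cond -(big_map val xpredT (fun H => w ^+ #|` H|)).
apply: (few_leaves_sum (i := i)) => //; first by rewrite map_inj_uniq ?enum_uniq //; exact: val_inj.
move=> H /mapP[H1 + ->]. by rewrite mem_enum -topredE /=; case: pselect.
Qed.

Section Boundedness.
Variable beta : R.
Hypothesis beta0 : 0 <= beta.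
Local Notation w := (expR (- beta)).

Let w0 : 0 < w. Proof. exact: expR_gt0. Qed.
Let w1 : w <= 1. Proof. by rewrite -expR0 ler_expR oppr_le0. Qed.

Let traced m (sg : graph R) : seq (graph R) :=
  fset_set [set G | boundary_forest N m G /\ trace N m G = sg].

Let finite_traced m (sg : graph R) : finite_set [set G | boundary_forest N m G /\ trace N m G = sg].
Proof.
apply: (@sub_finite_set _ _ [set` bforests m]); last exact: finite_fset.
by move=> G [/bforestsP].
Qed.

Let ZE m (sg : graph R) : Z N m sg beta = \sum_(G <- traced m sg) w ^+ #|` G|.
Proof.
rewrite /Z fsbig_finite; last exact: finite_traced.
by apply: eq_bigr => G _; rewrite expRM_natr.
Qed.

Let Z_ge0 m (sg : graph R) : 0 <= Z N m sg beta.
Proof. by rewrite ZE sumr_ge0 // => G _; rewrite exprn_ge0. Qed.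

Let Z_total m (sg : graph R) : Z N m sg beta <= total w m.
Proof.
rewrite ZE; apply: sum_uniq_sub => [|G|G]; first exact: fset_uniq.
  rewrite in_fset_set; last exact: finite_traced.
  by rewrite inE => -[/bforestsP].
by rewrite exprn_ge0.
Qed.

Let pedges_boundary m i j p : i != j -> saw (adj (F R N m)) (corner R m i) p (corner R m j) ->
  boundary_forest N m (pedges (corner R m i) p).
Proof.
move=> ij /and3P[pp up /eqP lp].
have sp : (0 < size p)%N.
  by case: p lp {pp up} => //= /eqP; rewrite (inj_eq (corner_inj hN4 (m := m))) (negPf ij).
have bd (k : I) : corner R m k \in boundary R N m by apply/imfsetP; exists k.
split.
- by rewrite -cardfs_eq0 card_pedges // -lt0n.
- by rewrite pedges_sub.
- exact: pedges_linear_forest.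
- by move=> z /(pedges_degree1 up)[->|->]; rewrite ?lp; exact: bd.
Qed.

Let trace_pedges m i j p : i != j -> saw (adj (F R N m)) (corner R m i) p (corner R m j) ->
  S_ N (trace N m (pedges (corner R m i) p)).
Proof.
move=> ij /and3P[pp up /eqP lp].
have sp : (0 < size p)%N.
  by case: p lp {pp up} => //= /eqP; rewrite (inj_eq (corner_inj hN4 (m := m))) (negPf ij).
apply: (@trace_crossing R N m _ _ _ _ _ _ (Posz i) (Posz j)) => //.
- by move=> a b /(ga_eqN R hN4); exact: gq_eqN.
- by move=> a b /(gq_inj hN hN4) /(ga_eqN R hN4).
- move=> a; have [k ak] := int_ord n a; rewrite (gq_eqN R hN ak).
  by apply/imfsetP; exists k.
- move=> a; have [k ak] := int_ord n a; have /(ga_eqN R hN4 m) -> := ak.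
  by apply/imfsetP; exists k.
Qed.

Let traces : seq (graph R) := [seq sg <- fpowerset (fpowerset (V0 R N)) | `[< S_ N sg >]].

Let mem_traces sg : S_ N sg -> sg \in traces.
Proof.
move=> h; rewrite mem_filter; apply/andP; split; first exact/asboolP.
rewrite fpowersetE; apply/fsubsetP => e eg; rewrite fpowersetE; case: h => _ _; exact.
Qed.

(** Each crossing is itself a boundary forest, and its trace is one of finitely many. *)
Let wt_Z m i j M : i != j -> (forall sg, S_ N sg -> Z N m sg beta <= M) ->
  wt w m i j pred0 <= (size traces)%:R * M.
Proof.
move=> ij ZM; rewrite -sum_walks.
pose B := [seq (sg, G) | sg <- traces, G <- traced m sg].
pose h p := (trace N m (pedges (corner R m i) p), pedges (corner R m i) p).
apply: (@le_trans _ _ (\sum_(b <- B) w ^+ #|` b.2|)).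
  apply: (sum_inj_le (h := h)).
  - exact: fset_uniq.
  - move=> p q; rewrite !mem_walks => /and3P[_ up _] /and3P[_ uq _] [_].
    exact: pedges_inj.
  - move=> p; rewrite mem_walks => hp; apply/allpairsPdep; exists (h p).1, (h p).2; split=> //.
      by apply: mem_traces; exact: trace_pedges hp.
    rewrite in_fset_set; last exact: finite_traced.
    by rewrite inE; split=> //; exact: pedges_boundary hp.
  - by move=> p; rewrite mem_walks => /and3P[_ up _]; rewrite card_pedges.
  - by move=> b; rewrite exprn_ge0.
rewrite big_allpairs_dep /= -[X in X%:R]count_predT -sum1_count natr_sum big_distrl /=.
rewrite !big_seq; apply: ler_sum => sg; rewrite mem_filter => /andP[/asboolP /ZM h' _].
by rewrite mul1r -ZE.
Qed.

Lemma bounded_iff : (ereal_sup [set Z_norm N m beta | m in [set: nat]] < +oo)%E <->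
  exists K : R, forall m, wX n w m <= K /\ wY n w m <= K.
Proof.
split=> [sup|[K HK]].
  have [M ZM] : exists M : R, forall m sg, S_ N sg -> Z N m sg beta <= M.
    have ub m sg : S_ N sg -> ((Z N m sg beta)%:E <= ereal_sup [set Z_norm N m beta | m in [set:
      nat]])%E.
      move=> hs; apply: (@le_trans _ _ (Z_norm N m beta)); last by apply: ereal_sup_ubound;
        exists m.
      by apply: ereal_sup_ubound; exists sg => //; rewrite ger0_norm.
    case: (ereal_sup _) sup ub => [r|//|] _ ub; first by exists r => m sg /(ub m); rewrite lee_fin.
    by exists 0 => m sg /(ub m).
  exists ((size traces)%:R * M) => m; have s0 := os_s (OS 0); have s2 := os_2s (OS 0).
  by split; apply: wt_Z (ZM m); rewrite eq_sym // .
pose M := Num.max (total w 0) ((1 + 4 * K + 2 * K) ^+ N).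
have ZM m sg : Z N m sg beta <= M.
  apply: le_trans (Z_total m sg) _; case: m => [|m]; first by rewrite le_max lexx.
  rewrite le_max; apply/orP; right; apply: le_trans (total_step m w0 w1) _.
  have [hX hY] := HK m; have X0 := wt_ge0 hN4 m 0 s pred0 (ltW w0).
  have Y0 := wt_ge0 hN4 m (- s) s pred0 (ltW w0).
  have h : 1 + 4 * wX n w m + 2 * wY n w m <= 1 + 4 * K + 2 * K by lra.
  have h0 : 0 <= 1 + 4 * wX n w m + 2 * wY n w m by rewrite /wX /wY; lra.
  by rewrite lerXn2r // nnegrE // (le_trans h0).
apply: (@le_lt_trans _ _ M%:E); last exact: ltry.
apply: ge_ereal_sup => _ [m _ <-]; apply: ge_ereal_sup => _ [sg _ <-].
by rewrite lee_fin ger0_norm.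
Qed.

End Boundedness.

End ForestBound.

(** * The critical value *)

Section Critical.
Variables (R : realType) (X : R -> R^nat) (Esc Small Bd : R -> Prop) (L : R).
Implicit Types b : R.
Hypothesis X_ge0 : forall b m, 0 <= X b m.
Hypothesis X_scale : forall b b' m, b <= b' -> X b' m <= expR (- (b' - b)) * X b m.
Hypothesis esc_cvg : forall b, Esc b -> X b @ \oo --> +oo.
Hypothesis small_cvg : forall b, Small b -> X b @ \oo --> (0 : R).
Hypothesis mid_cvg : forall b, ~ Esc b -> ~ Small b -> X b @ \oo --> L.
Hypothesis L0 : 0 < L.
Hypothesis esc_open : forall b, Esc b -> \forall b' \near b, Esc b'.
Hypothesis small_open : forall b, Small b -> \forall b' \near b, Small b'.
Hypothesis esc0 : Esc 0.
Hypothesis small_ex : exists2 b, 0 <= b & Small b.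
Hypothesis BdE : forall b, 0 <= b -> Bd b <-> ~ Esc b.

Let excl b : Esc b -> ~ Small b.
Proof.
move=> /esc_cvg /(infty_eventually_gt 1)[m1 h1] /small_cvg /cvg_eventually_lt /(_ ltr01)[m2 h2].
have := h1 (m1 + m2)%N (leq_addr _ _); have := h2 (m1 + m2)%N (leq_addl _ _); lra.
Qed.

Let not_esc_cvg b : ~ Esc b -> exists2 l, l <= L & X b @ \oo --> l.
Proof.
move=> ne; have [/small_cvg h|h] := pselect (Small b); first by exists 0 => //; exact: ltW.
by exists L => //; exact: mid_cvg.
Qed.

Let not_esc_mono b b' : b <= b' -> ~ Esc b -> ~ Esc b'.
Proof.
move=> bb' /not_esc_cvg[l _ Xl] /esc_cvg /(infty_eventually_gt (l + 1))[m1 h1].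
have l1 : l < l + 1 by rewrite ltrDl.
have [m2 h2] := cvg_eventually_lt Xl l1.
have := h1 (m1 + m2)%N (leq_addr _ _); have := h2 (m1 + m2)%N (leq_addl _ _).
have e1 : expR (- (b' - b)) <= 1 by rewrite -expR0 ler_expR oppr_le0 subr_ge0.
have := X_scale (m1 + m2) bb'; have := ler_wpM2r (X_ge0 b (m1 + m2)%N) e1; lra.
Qed.

(** If [b'] were neither escaping nor small, its sequence would tend to [L], although it is at most
    a fixed factor below 1 times a sequence whose limit is at most [L]. *)
Let not_esc_small b b' : b < b' -> ~ Esc b -> Small b'.
Proof.
move=> bb' ne; have ne' := not_esc_mono (ltW bb') ne; apply: contrapT => ns.
have [l lL Xl] := not_esc_cvg ne; have XL := mid_cvg ne' ns.
set r := expR (- (b' - b)); have r1 : r < 1 by rewrite -expR0 ltr_expR oppr_lt0 subr_gt0.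
have : L <= r * l.
  apply: (ler_cvg_to XL (cvgM (cvg_cst r) Xl)); apply: nearW => m; exact: X_scale (ltW bb').
have r0 : 0 < r by exact: expR_gt0.
have rL : r * L < L by rewrite gtr_pMl.
have := ler_wpM2l (ltW r0) lL; lra.
Qed.

Let S := [set b | 0 <= b /\ Bd b].
Local Notation bc := (inf S).

Let S_inf : has_inf S.
Proof.
split; last by exists 0 => b [].
have [b b0 sb] := small_ex; exists b; split=> //; apply/BdE => // eb; exact: excl eb sb.
Qed.

Let S_above b : bc < b -> exists2 b', b' < b & 0 <= b' /\ ~ Esc b'.
Proof.
move=> h; have e0 : 0 < b - bc by rewrite subr_gt0.
have [b' [b0 /BdE ne] lt] := inf_adherent e0 S_inf.
by exists b'; [move: lt; rewrite addrC subrK | split=> //; exact: ne].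
Qed.

(** Openness places the infimum in neither set: escape there would persist to the right, where
    non-escaping parameters accumulate, and smallness would persist to the left, where every
    non-negative parameter escapes. *)
Lemma critical_value : [/\ forall b, bc < b -> Small b, forall b, 0 <= b -> b < bc -> Esc b,
  ~ Esc bc & ~ Small bc].
Proof.
have bc0 : 0 <= bc by apply: lb_le_inf; [exact: S_inf.1 | move=> b []].
have below b : 0 <= b -> b < bc -> Esc b.
  move=> b0 lt; apply: contrapT => ne; have : S b by split=> //; apply/BdE.
  by move=> /(ge_inf S_inf.2); rewrite leNgt lt.
have nesc : ~ Esc bc.
  move=> /esc_open /nbhs_ballP[e /= e0 He].
  have lt : bc < bc + e by rewrite ltrDl.
  have [b' b'e [b0 ne]] := S_above lt; apply: (ne); apply: He.
  have : bc <= b' by apply: (ge_inf S_inf.2); split=> //; apply/(BdE b0).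
  by move=> h; rewrite /ball /= ltr_norml; apply/andP; split; lra.
split=> //.
- by move=> b /S_above[b' lt [_ ne]]; exact: not_esc_small lt ne.
- have bcp : 0 < bc by rewrite lt_neqAle bc0 andbT; apply/eqP => E; apply: nesc; rewrite -E.
  move=> /small_open /nbhs_ballP[e /= e0 He].
  (* Escape below [bc] is known only for non-negative parameters, hence the maximum. *)
  pose b := Num.max 0 (bc - e / 2).
  have b0 : 0 <= b by rewrite le_max lexx.
  have bbc : b < bc by rewrite gt_max bcp /=; lra.
  have be : bc - e / 2 <= b by rewrite le_max lexx orbT.
  apply: (excl (below b b0 bbc)); apply: He.
  by rewrite /ball /= ltr_norml; apply/andP; split; lra.
Qed.

End Critical.

Lemma root_exists (R : rcfType) (a b : nat) : (0 < a)%N -> (0 < b)%N ->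
  exists2 y : R, 0 < y < 1 & y ^+ a + 2 * y ^+ b = 1.
Proof.
move=> a0 b0; pose p : {poly R} := 'X^a + 2%:P * 'X^b - 1%:P.
have pE y : p.[y] = y ^+ a + 2 * y ^+ b - 1 by rewrite /p !hornerE.
have p0 : p.[0] = - 1 by rewrite pE !expr0n !gtn_eqF // mulr0 !add0r.
have p1 : p.[1] = 2 by rewrite pE !expr1n; ring.
have [|y /andP[y0 y1] /eqP] := poly_ivt (p := p) ler01; first by rewrite p0 p1 lerN10 ler0n.
rewrite pE => /eqP; rewrite subr_eq0 => /eqP yE; exists y => //; apply/andP; split.
  rewrite lt_neqAle y0 andbT; apply/eqP => E; move: yE;
    rewrite -E !expr0n !gtn_eqF //= mulr0 addr0 => /eqP.
  by rewrite eq_sym oner_eq0.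
by rewrite lt_neqAle y1 andbT; apply/eqP => E; move: yE; rewrite E !expr1n; lra.
Qed.

Lemma root_unique (R : realDomainType) (a b : nat) (x y : R) : (0 < a)%N -> 0 < x -> 0 < y ->
  x ^+ a + 2 * x ^+ b = 1 -> y ^+ a + 2 * y ^+ b = 1 -> x = y.
Proof.
have mono (u v : R) : (0 < a)%N -> 0 < u -> u < v -> u ^+ a + 2 * u ^+ b < v ^+ a + 2 * v ^+ b.
  move=> a0 u0 uv; have v0 := lt_trans u0 uv; rewrite ltr_leD //.
    by rewrite ltrXn2r ?nnegrE ?ltW // -lt0n.
  by rewrite ler_pM2l // lerXn2r // ?nnegrE ltW.
move=> a0 x0 y0 xE yE; case: (ltgtP x y) => // h.
  by have := mono _ _ a0 x0 h; rewrite xE yE ltxx.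
by have := mono _ _ a0 y0 h; rewrite xE yE ltxx.
Qed.

Lemma tauE (R : realType) : 0 < tau R < 1 /\ tau R + tau R ^+ 2 = 1.
Proof.
have s5 : Num.sqrt 5 ^+ 2 = 5 :> R by rewrite sqr_sqrtr.
have s0 : 0 <= Num.sqrt 5 :> R by exact: sqrtr_ge0.
rewrite /tau; move: (Num.sqrt 5) s5 s0 => q q2 q0; split; last by lra.
by apply/andP; split; nra.
Qed.

Section GasketBeta.
Variables (R : realType) (n : nat).
Local Notation N := n.+3.
Hypothesis hN4 : ~~ (4 %| N)%N.
Local Notation I := 'I_n.+3.
Local Notation s := (shift n).
Implicit Types (i j : I) (m k : nat) (w beta : R).

Let OS m := gasket_step R hN4 m.
Let s0 : 0 != s. Proof. by rewrite eq_sym; exact: os_s (OS 0). Qed.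
Let s2 : - s != s. Proof. by rewrite eq_sym; exact: os_2s (OS 0). Qed.

Lemma wt_near m i j B beta : {for beta, continuous (fun b : R => wt (expR (- b)) m i j B)}.
Proof.
apply: (@continuous_comp _ _ _ (fun b : R => expR (- b)) (fun w => wt w m i j B)).
  by apply: (@continuous_comp _ _ _ -%R expR); [exact: opp_continuous | exact: continuous_expR].
exact: wt_continuous.
Qed.

Lemma wt_gt_near m i j B (a beta : R) : a < wt (expR (- beta)) m i j B ->
  \forall b \near beta, a < wt (expR (- b)) m i j B.
Proof. by move=> h; apply: (cvgr_gt _ (wt_near (beta := beta) (m := m) (i := i) (j := j) (B :=
  B))). Qed.

Lemma wt_lt_near m i j B (a beta : R) : wt (expR (- beta)) m i j B < a ->
  \forall b \near beta, wt (expR (- b)) m i j B < a.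
Proof. by move=> h; apply: (cvgr_lt _ (wt_near (beta := beta) (m := m) (i := i) (j := j) (B :=
  B))). Qed.

Lemma wX_beta_ge0 beta m : 0 <= wX n (expR (- beta)) m.
Proof. by apply: (wt_ge0 hN4); exact: expR_ge0. Qed.

Lemma wX_beta_scale beta beta' m : beta <= beta' ->
  wX n (expR (- beta')) m <= expR (- (beta' - beta)) * wX n (expR (- beta)) m.
Proof.
move=> h; have -> : expR (- (beta' - beta)) = expR (- beta') / expR (- beta).
  by rewrite -expRN -expRD opprK opprB addrC.
by apply: (wt_scale hN4) => //; [exact: expR_gt0 | rewrite ler_expR lerN2].
Qed.

Lemma wt_small (e : R) : 0 < e -> exists2 beta, 0 <= beta &
  wX n (expR (- beta)) 0 < e /\ wY n (expR (- beta)) 0 < e.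
Proof.
(* For [w <= 1] the initial weights are at most [w] times their values at 1; the summand 1 keeps [K]
   positive. *)
move=> e0; pose K := wX n 1 0 + wY n 1 0 + 1 : R.
have X0 : 0 <= wX n 1 0 :> R by apply: (wt_ge0 hN4).
have Y0 : 0 <= wY n 1 0 :> R by apply: (wt_ge0 hN4).
have K0 : 0 < K by rewrite /K; lra.
pose w := Num.min 1 (e / (2 * K)).
have w0 : 0 < w by rewrite lt_min ltr01 divr_gt0 // mulr_gt0.
have w1 : w <= 1 by rewrite ge_min lexx.
have we : w * K < e.
  apply: (@le_lt_trans _ _ (e / 2)); last by lra.
  have : w <= e / (2 * K) by rewrite ge_min lexx orbT.
  by rewrite ler_pdivlMr ?mulr_gt0 //; lra.
exists (- ln w); first by rewrite oppr_ge0 ln_le0.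
rewrite opprK lnK ?posrE //.
have hX : wX n w 0 <= w / 1 * wX n 1 0 by apply: (wt_scale hN4).
have hY : wY n w 0 <= w / 1 * wY n 1 0 by apply: (wt_scale hN4).
move: hX hY we; rewrite divr1 /K => hX hY we; have wX0 := mulr_ge0 (ltW w0) X0.
by have wY0 := mulr_ge0 (ltW w0) Y0; split; lra.
Qed.

Definition beta_crit (Esc Small : R -> Prop) := [/\ forall b, beta_c R N < b -> Small b,
  forall b, 0 <= b -> b < beta_c R N -> Esc b, ~ Esc (beta_c R N) & ~ Small (beta_c R N)].

Lemma gasket_critical (Esc Small : R -> Prop) (L L' : R) : 0 < L ->
  (forall b, Esc b -> wX n (expR (- b)) @ \oo --> +oo) ->
  (forall b, Small b -> wX n (expR (- b)) @ \oo --> (0 : R) /\ wY n (expR (- b)) @ \oo --> (0 :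
    R)) ->
  (forall b, ~ Esc b -> ~ Small b ->
    wX n (expR (- b)) @ \oo --> L /\ wY n (expR (- b)) @ \oo --> L') ->
  (forall b, Esc b -> \forall b' \near b, Esc b') ->
  (forall b, Small b -> \forall b' \near b, Small b') ->
  Esc 0 -> (exists2 b, 0 <= b & Small b) -> beta_crit Esc Small.
Proof.
move=> L0 hE hS hM oE oS E0 Sex.
have bounded (u : R^nat) (l : R) : u @ \oo --> l -> exists M, forall m, u m <= M.
  move=> ul; have [M [_ /(_ (M + 1))]] := cvg_seq_bounded (cvgP l ul).
  rewrite ltrDl ltr01 => /(_ isT) H; exists (M + 1) => m.
  by apply: le_trans (ler_norm _) _; exact: H.
apply: (critical_value (X := fun b => wX n (expR (- b))) (L := L)
   (Bd := fun b => (ereal_sup [set Z_norm N m b | m in [set: nat]] < +oo)%E)) => //.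
- exact: wX_beta_ge0.
- exact: wX_beta_scale.
- by move=> b /hS[].
- by move=> b e sm; have [] := hM b e sm.
move=> b b0; split=> [/(bounded_iff hN4 b0)[K HK] /hE /(infty_eventually_gt K)[m /(_ m (leqnn
  m))]|ne].
  by rewrite ltNge (HK m).1.
apply/(bounded_iff hN4 b0).
have [[a Xa] [a' Ya]] : (exists a : R, wX n (expR (- b)) @ \oo --> a) /\ (exists a : R,
  wY n (expR (- b)) @ \oo --> a).
  have [/hS[h1 h2]|h] := pselect (Small b); first by split; exists 0.
  by have [h1 h2] := hM b ne h; split; [exists L | exists L'].
have [K HK] := bounded _ _ Xa; have [K' HK'] := bounded _ _ Ya.
by exists (Num.max K K') => m; rewrite !le_max HK HK' orbT.
Qed.

Let gs0 : (0 < gs N)%N. Proof. by have [] := gs_lt R hN4. Qed.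
Let gs2 : (2 * gs N < N)%N. Proof. by have [] := gs_lt R hN4. Qed.

Let nat_neq0 k : (0 < k < N)%N -> (k%:R != 0 :> I).
Proof. by move=> /andP[k0 kN]; rewrite gs_char; apply/negP => /(dvdn_leq k0); lia. Qed.

Let opp_shift : - s = 0 + (N - gs N)%:R.
Proof.
rewrite add0r natrB; last by lia.
by have /eqP -> : N%:R == 0 :> I; rewrite ?sub0r // gs_char.
Qed.

Let to_shift : s = - s + (2 * gs N)%:R.
Proof. by rewrite mul2n -addnn natrD addKr. Qed.

Let pred1_corner m (a b : I) : pred1 (corner R m a) (corner R m b) = (b == a).
Proof. exact: (inj_eq (corner_inj hN4 (m := m))). Qed.

Lemma wx_le_wX w m : 0 < w -> wx n w m <= wX n w m.
Proof.
move=> w0; rewrite -subr_ge0 /wx /wX /wt (pf_visit _ _ (finite_walks hN4 m 0 s pred0)).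
apply: pf_ge0; first exact: ltW.
by apply: sub_finite_set (finite_walks hN4 m 0 s pred0) => p [h _]; rewrite avw_pred0.
Qed.

Lemma start_X w : 0 < w -> w ^+ gs N <= wX n w 0 /\ w ^+ gs N <= wx n w 0.
Proof.
move=> w0; rewrite /wX /wx -[X in wt _ _ _ X]add0r; split; apply: (wt0_ge hN4) => //; try lia.
move=> l /andP[l0 lg]; rewrite pred1_corner add0r -subr_eq0 opprK -natrD.
by apply: nat_neq0; lia.
Qed.

(** The short arc from [- s] to [s] passes through [0]. The bound on the avoiding weight comes from
    the other arc, of length [N - 2 * gs N]. *)
Lemma start_Y w : 0 < w -> w ^+ (2 * gs N) <= wY n w 0 /\ w ^+ (N - 2 * gs N) <= wy n w 0.
Proof.
move=> w0; split; first by rewrite /wY [X in wt _ _ _ X]to_shift; apply: (wt0_ge hN4) => //; lia.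
rewrite /wy -(wt_refl hN4 w 0 (- s) s 0).2 opprK oppr0.
have -> : - s = s + (N - 2 * gs N)%:R.
  rewrite natrB; last by lia.
  have /eqP -> : N%:R == 0 :> I by rewrite gs_char.
  by rewrite sub0r mul2n -addnn natrD opprD addrA subrr sub0r.
apply: (wt0_ge hN4) => //; first lia.
move=> l lN; rewrite pred1_corner -natrD.
by apply: nat_neq0; lia.
Qed.

Lemma start_visits w : 0 < w -> 0 < wX n w 0 - wx n w 0 /\ 0 < wY n w 0 - wy n w 0.
Proof.
move=> w0; split.
  apply: (@lt_le_trans _ _ (w ^+ (N - gs N))); first exact: exprn_gt0.
  rewrite /wX /wx -(wt_refl hN4 w 0 0 s 0).1 -(wt_refl hN4 w 0 0 s (- s)).2 opprK oppr0.
  rewrite opp_shift -[X in pred1 (corner R 0 X)](add0r (gs N)%:R).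
  by apply: (wt0_gap hN4) => //; lia.
apply: (@lt_le_trans _ _ (w ^+ (2 * gs N))); first exact: exprn_gt0.
rewrite /wY /wy [X in wt _ _ _ X pred0]to_shift [X in wt _ _ _ X (pred1 _)]to_shift.
rewrite -[X in pred1 (corner R 0 X)](addNr s).
by apply: (wt0_gap hN4) => //; lia.
Qed.

Lemma rec_total w m i k : (0 < k < N)%N -> wt w m.+1 i (i + k%:R) pred0 =
  wY n w m ^+ k.-1 * ends n w m k + wY n w m ^+ (N - k).-1 * ends n w m (N - k)%N.
Proof.
have B (i' : I) k' : between w m [::] i' k' = wY n w m ^+ k'.-1.
  by rewrite /between (eq_bigr (fun=> wY n w m)) // prodr_const_nat subn0.
move=> kN; have := gasket_rec hN4 w m (i := i) (T := [::]) kN isT isT.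
by rewrite [map -%R [::]]/= !B.
Qed.

Lemma rec_avoid w m i k t : (0 < k < N)%N -> i != t -> i + k%:R != t ->
  wt w m.+1 i (i + k%:R) (pred1 (corner R m.+1 t)) =
  \prod_(0 <= l < k.-1) (if i + l.+1%:R == t then wy n w m else wY n w m) * ends n w m k +
  \prod_(0 <= l < (N - k).-1) (if - i + l.+1%:R == - t then wy n w m else wY n w m) * ends n w m
    (N - k)%N.
Proof.
move=> kN it ikt; have it' : i \notin [:: t] by rewrite inE.
have ikt' : i + k%:R \notin [:: t] by rewrite inE.
have -> : wt w m.+1 i (i + k%:R) (pred1 (corner R m.+1 t)) =
    wt w m.+1 i (i + k%:R) (fun x => x \in map (corner R m.+1) [:: t]).
  by rewrite /wt; congr pf; congr avw; apply/funext => x; rewrite /= inE.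
rewrite (gasket_rec hN4 w m kN it' ikt') /between.
by congr (_ * _ + _ * _); apply: eq_bigr => l _; rewrite inE.
Qed.

Lemma rec_X w m : wX n w m.+1 =
  wY n w m ^+ (gs N).-1 * ends n w m (gs N) + wY n w m ^+ (N - gs N).-1 * ends n w m (N - gs N)%N.
Proof. by rewrite {1}/wX -[X in wt _ _ _ X]add0r rec_total //; lia. Qed.

Lemma rec_Y w m : wY n w m.+1 =
  wY n w m ^+ (2 * gs N).-1 * ends n w m (2 * gs N)%N +
  wY n w m ^+ (N - 2 * gs N).-1 * ends n w m (N - 2 * gs N)%N.
Proof. by rewrite {1}/wY [X in wt _ _ _ X]to_shift rec_total //; lia. Qed.

(** * Critical behaviour for N at least 6 *)

Section Generic.
Variables (k l : nat).
Hypotheses (Nkl : N = (4 * k + l)%N) (l13 : (1 <= l <= 3)%N) (N5 : (5 < N)%N).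

Let gsE : gs N = k.+1. Proof. by rewrite /gs /gk; lia. Qed.
Let k0 : (0 < k)%N. Proof. by lia. Qed.

(** For [N > 5] none of the numbers of steps equals [N - 1], so avoiding weights do not appear and
    the pair [(wX, wY)] is autonomous. *)
Let XS w m : wX n w m.+1 = wX n w m ^+ 2 * (wY n w m ^+ k + wY n w m ^+ (3 * k + l - 2)).
Proof.
rewrite rec_X gsE /ends.
have /negPf -> : k.+1 != N.-1 by lia.
have /negPf -> : (N - k.+1)%N != N.-1 by lia.
have -> : ((N - k.+1).-1 = 3 * k + l - 2)%N by lia.
by rewrite /=; ring.
Qed.

Let YS w m : wY n w m.+1 = wX n w m ^+ 2 * (wY n w m ^+ (2 * k).+1 + wY n w m ^+ (2 * k + l - 3)).
Proof.
rewrite rec_Y gsE /ends.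
have /negPf -> : (2 * k.+1)%N != N.-1 by lia.
have /negPf -> : (N - 2 * k.+1)%N != N.-1 by lia.
have -> : ((N - 2 * k.+1).-1 = 2 * k + l - 3)%N by lia.
have -> : ((2 * k.+1).-1 = (2 * k).+1)%N by lia.
by ring.
Qed.

Let pos w : 0 < w -> 0 < wX n w 0 /\ 0 < wY n w 0.
Proof.
move=> w0; split; first by apply: lt_le_trans (start_X w0).1; exact: exprn_gt0.
by apply: lt_le_trans (start_Y w0).1; exact: exprn_gt0.
Qed.

Let e0 b : 0 < expR (- b) :> R. Proof. exact: expR_gt0. Qed.

Let c1 : (k + (3 * k + l - 2) = (2 * k).+1 + (2 * k + l - 3))%N. Proof. by lia. Qed.
Let c2 : (k <= (2 * k).+1)%N. Proof. by lia. Qed.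
Let c3 : (k <= 2 * k + l - 3)%N. Proof. by lia. Qed.
Let c4 : (2 * k + l - 3 < (2 * k).+1)%N. Proof. by lia. Qed.

Variable Y : R.
Hypotheses (Y0 : 0 < Y) (YE : Y ^+ N + 2 * Y ^+ (2 * k + 2) = 1).

Definition generic_X : R := (Y ^+ k + Y ^+ (3 * k + l - 2))^-1.

Lemma generic_critical : [/\
  forall b, beta_c R N < b -> wX n (expR (- b)) @ \oo --> (0 : R) /\ wY n (expR (- b)) @ \oo -->
    (0 : R),
  forall b, 0 <= b -> b < beta_c R N ->
    wX n (expR (- b)) @ \oo --> +oo /\ wY n (expR (- b)) @ \oo --> +oo,
  wX n (expR (- beta_c R N)) @ \oo --> generic_X & wY n (expR (- beta_c R N)) @ \oo --> Y].
Proof.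
pose Esc (b : R) := exists m, 1 < wX n (expR (- b)) m /\ 1 < wY n (expR (- b)) m.
pose Small (b : R) := exists m, wX n (expR (- b)) m < 1 / 4 /\ wY n (expR (- b)) m < 1 / 4.
have hE b : Esc b -> wX n (expR (- b)) @ \oo --> +oo /\ wY n (expR (- b)) @ \oo --> +oo.
  move=> [m [h1 h2]]; have [p1 p2] := pos (e0 b).
  exact: (cyclic_escape k0 c1 c2 c3 (erefl _) c4 p1 p2 (XS _) (YS _) h1 h2).
have hS b : Small b -> wX n (expR (- b)) @ \oo --> (0 : R) /\ wY n (expR (- b)) @ \oo --> (0 : R).
  move=> [m [h1 h2]]; have [p1 p2] := pos (e0 b).
  exact: (cyclic_vanish k0 c1 c2 c3 (erefl _) c4 p1 p2 (XS _) (YS _) h1 h2).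
have hM b : ~ Esc b -> ~ Small b ->
  wX n (expR (- b)) @ \oo --> generic_X /\ wY n (expR (- b)) @ \oo --> Y.
  move=> ne ns; have [p1 p2] := pos (e0 b).
  case: (cyclic_trichotomy k0 c1 c2 c3 (erefl _) c4 p1 p2 (XS _) (YS _)) => [//|//|[x [y [Xx Yy]]]].
  case=> x0 y0 xE yE.
  have yY : y = Y.
    apply: (root_unique (isT : (0 < N)%N) y0 Y0 _ YE); rewrite -[RHS]yE.
    have -> : (3 * k + l - 2 + (2 * k).+1 - k - (2 * k + l - 3) = 2 * k + 2)%N by lia.
    have -> : (2 * (3 * k + l - 2 - k) + (2 * k).+1 - (2 * k + l - 3) = N)%N by lia.
    by ring.
  suff xX : x = generic_X by rewrite -yY -xX.
  rewrite /generic_X -yY; have Pn : y ^+ k + y ^+ (3 * k + l - 2) != 0.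
    by rewrite gt_eqF // addr_gt0 // exprn_gt0.
  by apply: (mulIf Pn); rewrite xE mulVf.
have X0 : 0 < generic_X by rewrite invr_gt0 addr_gt0 ?exprn_gt0.
have [h1 h2 h3 h4] : beta_crit Esc Small.
  apply: (gasket_critical X0 _ hS hM).
  - by move=> b /hE[].
  - move=> b [m [g1 g2]]; apply: filterS2 (wt_gt_near g1) (wt_gt_near g2) => b' u1 u2.
    by exists m.
  - move=> b [m [g1 g2]]; apply: filterS2 (wt_lt_near g1) (wt_lt_near g2) => b' u1 u2.
    by exists m.
  (* At [beta = 0] the weights count walks, so they are at least 1, and one step of the recursion
     doubles this bound. *)
  - exists 1%N; rewrite oppr0 expR0 XS YS.
    have := (start_X ltr01).1; have := (start_Y ltr01).1; rewrite !expr1n.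
    move: (wX n 1 0) (wY n 1 0) => x y y1 x1.
    have := exprn_ege1 2 x1; have := exprn_ege1 k y1; have := exprn_ege1 (3 * k + l - 2) y1.
    have := exprn_ege1 (2 * k).+1 y1; have := exprn_ege1 (2 * k + l - 3) y1.
    by move: (x ^+ 2) (y ^+ _) (y ^+ _) (y ^+ _) (y ^+ _) => a a1 a2 a3 a4 *; split; nra.
  - have q0 : 0 < 1 / 4 :> R by lra.
    by have [b b0 h] := wt_small q0; exists b => //; exists 0%N.
split; [by move=> b /h1/hS | by move=> b b0 /(h2 b b0)/hE | exact: (hM _ h3 h4).1 | exact: (hM _
  h3 h4).2].
Qed.

End Generic.
End GasketBeta.

(** * Critical behaviour for N = 3 *)

Section Triangle.
Variable R : realType.
Local Notation s := (shift 0).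
Implicit Types (w b : R) (m : nat).

Let h4 : ~~ (4 %| 3)%N. Proof. by []. Qed.

Lemma triangle_sym w m : wY 0 w m = wX 0 w m /\ wy 0 w m = wx 0 w m.
Proof.
have e1 : - s + 0 = - s by rewrite addr0.
have e2 : - s + - s = s by apply/eqP.
have e3 : - s + s = 0 by rewrite addNr.
have e4 : - 0 = 0 :> 'I_3 by rewrite oppr0.
rewrite /wY /wy; split.
  have := (wt_rot h4 w m (- s) 0 (- s) s).1; rewrite e1 e2 => ->.
  by have := (wt_refl h4 w m 0 s 0).1; rewrite e4.
have := (wt_rot h4 w m (- s) 0 (- s) s).2; rewrite e1 e2 e3 => ->.
by have := (wt_refl h4 w m 0 s (- s)).2; rewrite e4 opprK.
Qed.

(** Here [gs 3 = 1], so the long way takes [2 = N - 1] steps and its end pieces are dependent. *)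
Let XS w m : wX 0 w m.+1 = wX 0 w m ^+ 2 + wX 0 w m * (2 * wx 0 w m * wX 0 w m - wx 0 w m ^+ 2).
Proof.
rewrite (rec_X h4) (triangle_sym w m).1 /ends.
have -> : gs 3 = 1%N by [].
by rewrite /=; ring.
Qed.

(** The intermediate cell of the long way owns the forbidden corner, hence one factor [wx] instead
    of [wX]. *)
Let xS w m : wx 0 w m.+1 = wX 0 w m ^+ 2 + wx 0 w m * (2 * wx 0 w m * wX 0 w m - wx 0 w m ^+ 2).
Proof.
have e : s = 0 + 1%:R by apply/eqP.
rewrite {1}/wx [X in wt _ _ _ X]e (rec_avoid h4) // (triangle_sym w m).1 (triangle_sym w m).2
  /ends /=.
rewrite big_geq // big_nat1.
have -> : (- 0 + 1%:R == - - s) = true by [].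
by ring.
Qed.

Lemma triangle_critical : [/\
  forall b, beta_c R 3 < b -> wx 0 (expR (- b)) @ \oo --> (0 : R) /\
    (fun m => wX 0 (expR (- b)) m - wx 0 (expR (- b)) m) @ \oo --> (0 : R),
  forall b, 0 <= b -> b < beta_c R 3 -> wx 0 (expR (- b)) @ \oo --> +oo /\
    (fun m => wX 0 (expR (- b)) m - wx 0 (expR (- b)) m) @ \oo --> +oo,
  wx 0 (expR (- beta_c R 3)) @ \oo --> tau R &
  (fun m => wX 0 (expR (- beta_c R 3)) m - wx 0 (expR (- beta_c R 3)) m) @ \oo --> (0 : R)].
Proof.
have [/andP[t0 t1] tE] := tauE R.
(* Comparison with [tau] is equivalent to the quadratic thresholds of the triangle recursion and is
   visibly open in [b]. *)
pose Esc b := exists m, tau R < wx 0 (expR (- b)) m.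
pose Small b := exists m, wX 0 (expR (- b)) m < tau R.
have e0 b : 0 < expR (- b) :> R by exact: expR_gt0.
have pos w : 0 < w -> 0 < wx 0 w 0 /\ wx 0 w 0 < wX 0 w 0.
  move=> w0; split; first by apply: lt_le_trans (start_X h4 w0).2; exact: exprn_gt0.
  by rewrite -subr_gt0; exact: (start_visits h4 w0).1.
have ge0 b m : 0 <= wx 0 (expR (- b)) m /\ 0 <= wX 0 (expR (- b)) m.
  by split; apply: (wt_ge0 h4); exact: expR_ge0.
have gt_tau (v : R) : 0 <= v -> (tau R < v) = (1 < v + v ^+ 2).
  move=> v0; apply/idP/idP => h; first by rewrite -tE ltrD // ltrXn2r // ?nnegrE ltW.
  rewrite ltNge; apply/negP => h'; move: h; rewrite ltNge -tE lerD // lerXn2r // nnegrE //.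
  exact: ltW.
have lt_tau (v : R) : 0 <= v -> (v < tau R) = (v + v ^+ 2 < 1).
  move=> v0; apply/idP/idP => h; first by rewrite -tE ltrD // ltrXn2r // ?nnegrE ltW.
  rewrite ltNge; apply/negP => h'; move: h; rewrite ltNge -tE lerD // lerXn2r // nnegrE //.
  exact: ltW.
have hE b : Esc b -> wx 0 (expR (- b)) @ \oo --> +oo /\
    (fun m => wX 0 (expR (- b)) m - wx 0 (expR (- b)) m) @ \oo --> +oo.
  move=> [m h]; have [p1 p2] := pos _ (e0 b); apply: (triangle_escape p1 p2 (XS _) (xS _) (m := m)).
  by rewrite -gt_tau //; exact: (ge0 b m).1.
have hS b : Small b -> wx 0 (expR (- b)) @ \oo --> (0 : R) /\
    (fun m => wX 0 (expR (- b)) m - wx 0 (expR (- b)) m) @ \oo --> (0 : R).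
  move=> [m h]; have [p1 p2] := pos _ (e0 b); apply: (triangle_vanish p1 p2 (XS _) (xS _) (m := m)).
  by rewrite -lt_tau //; exact: (ge0 b m).2.
have hM b : ~ Esc b -> ~ Small b -> wx 0 (expR (- b)) @ \oo --> tau R /\
    (fun m => wX 0 (expR (- b)) m - wx 0 (expR (- b)) m) @ \oo --> (0 : R).
  move=> ne ns; have [p1 p2] := pos _ (e0 b);
    apply: (triangle_limit p1 p2 (XS _) (xS _) t0 tE) => m h.
    by apply: ne; exists m; rewrite gt_tau //; exact: (ge0 b m).1.
  by apply: ns; exists m; rewrite lt_tau //; exact: (ge0 b m).2.
have sum b (l : R) : wx 0 (expR (- b)) @ \oo --> l ->
    (fun m => wX 0 (expR (- b)) m - wx 0 (expR (- b)) m) @ \oo --> (0 : R) ->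
    wX 0 (expR (- b)) @ \oo --> l /\ wY 0 (expR (- b)) @ \oo --> l.
  move=> h1 h2; have h3 : wX 0 (expR (- b)) @ \oo --> l.
    rewrite -[l]addr0; have -> : wX 0 (expR (- b)) =
      (fun m => wx 0 (expR (- b)) m + (wX 0 (expR (- b)) m - wx 0 (expR (- b)) m)).
      by apply/funext => m; ring.
    exact: cvgD.
  split=> //; have -> : wY 0 (expR (- b)) = wX 0 (expR (- b)) => //.
  by apply/funext => m; rewrite (triangle_sym _ m).1.
have [h1 h2 h3 h5] : beta_crit 0 Esc Small.
  apply: (gasket_critical h4 t0 (L' := tau R)).
  - move=> b [m h]; have [h' _] := hE b (ex_intro _ m h).
    apply: (ger_cvgy (f := wx 0 (expR (- b)))) h'; apply: nearW => k.
    by apply: (wx_le_wX h4); exact: e0.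
  - by move=> b /hS[u1 u2]; exact: sum.
  - by move=> b e sm; have [u1 u2] := hM b e sm; exact: sum.
  - by move=> b [m g1]; apply: filterS (wt_gt_near h4 g1) => b' u1; exists m.
  - by move=> b [m g1]; apply: filterS (wt_lt_near h4 g1) => b' u1; exists m.
  - exists 0%N; rewrite oppr0 expR0; apply: lt_le_trans t1 _.
    by have := (start_X h4 (@ltr01 R)).2; rewrite expr1n.
  - by have [b b0 [h _]] := wt_small h4 t0; exists b => //; exists 0%N.
split; [by move=> b /h1/hS | by move=> b b0 /(h2 b b0)/hE | exact: (hM _ h3 h5).1 | exact: (hM _
  h3 h5).2].
Qed.

End Triangle.

(** * Critical behaviour for N = 5 *)

Section Pentagon.
Variable R : realType.
Local Notation s := (shift 2).
Implicit Types (w b : R) (m : nat).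

Let h4 : ~~ (4 %| 5)%N. Proof. by []. Qed.

Let XS w m : wX 2 w m.+1 = wX 2 w m ^+ 2 * (wY 2 w m + wY 2 w m ^+ 2).
Proof.
rewrite (rec_X h4) /ends; have -> : gs 5 = 2%N by [].
by rewrite /= expr1; ring.
Qed.

(** Here [2 * gs 5 = 4 = N - 1]: the way through the cell of the third corner has dependent end
    pieces, while the other way has no intermediate cell. *)
Let YS w m : wY 2 w m.+1 =
  wY 2 w m ^+ 3 * (2 * wx 2 w m * wX 2 w m - wx 2 w m ^+ 2) + wX 2 w m ^+ 2.
Proof.
rewrite (rec_Y h4) /ends; have -> : gs 5 = 2%N by [].
by rewrite /=; ring.
Qed.

(** The forbidden corner is owned by one of the two intermediate cells of the backward way and by
    none on the forward way. *)
Let xS w m : wx 2 w m.+1 = wX 2 w m ^+ 2 * (wY 2 w m + wY 2 w m * wy 2 w m).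
Proof.
have e : s = 0 + 2%:R by apply/eqP.
rewrite {1}/wx [X in wt _ _ _ X]e (rec_avoid h4) // /ends /=.
rewrite big_nat1 big_nat_recr //= big_nat1.
have -> : (- 0 + 1 == - - s) = false by [].
by ring.
Qed.

Let yS w m : wy 2 w m.+1 =
  wY 2 w m ^+ 2 * wy 2 w m * (2 * wx 2 w m * wX 2 w m - wx 2 w m ^+ 2) + wX 2 w m ^+ 2.
Proof.
have e : s = - s + 4%:R by apply/eqP.
rewrite {1}/wy [X in wt _ _ _ X]e (rec_avoid h4) // /ends /=.
rewrite !big_nat_recr //= !big_geq //.
by ring.
Qed.

Variables (phi theta : R).
Hypotheses (theta0 : 0 < theta) (thetaE : theta ^+ 5 + 2 * theta ^+ 4 = 1)
  (phiE : phi = (theta * (1 + theta))^-1).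

Local Notation infinite w := (pentagon_infinite (wX 2 w) (wY 2 w) (wx 2 w) (wy 2 w)).
Local Notation converge w := (pentagon_cvg (wX 2 w) (wY 2 w) (wx 2 w) (wy 2 w)).

Let pos w : 0 < w -> [/\ 0 < wx 2 w 0, wx 2 w 0 < wX 2 w 0, 0 < wy 2 w 0 & wy 2 w 0 < wY 2 w 0].
Proof.
move=> w0; have [h1 h2] := start_visits h4 w0; split.
- by apply: lt_le_trans (start_X h4 w0).2; exact: exprn_gt0.
- by rewrite -subr_gt0.
- by apply: lt_le_trans (start_Y h4 w0).2; exact: exprn_gt0.
- by rewrite -subr_gt0.
Qed.

Let total_cvg w (l l' : R) : converge w l l' -> wX 2 w @ \oo --> l /\ wY 2 w @ \oo --> l'.
Proof.
have sum (u v : R^nat) (a : R) : v @ \oo --> a -> (fun m => u m - v m) @ \oo --> (0 : R) ->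
  u @ \oo --> a.
  move=> va uv; rewrite -[a]addr0; have -> : u = (fun m => v m + (u m - v m)).
    by apply/funext => m; ring.
  exact: cvgD.
by move=> [h1 h2 h3 h5]; split; [exact: sum h1 h2 | exact: sum h3 h5].
Qed.

Lemma pentagon_critical : [/\
  forall b, beta_c R 5 < b -> converge (expR (- b)) 0 0,
  forall b, 0 <= b -> b < beta_c R 5 -> infinite (expR (- b)) &
  converge (expR (- beta_c R 5)) phi theta].
Proof.
pose Esc b := exists m, 1 < wX 2 (expR (- b)) m /\ 1 < wY 2 (expR (- b)) m.
pose Small b := exists m, wX 2 (expR (- b)) m < phi /\ wY 2 (expR (- b)) m < theta.
have e0 b : 0 < expR (- b) :> R by exact: expR_gt0.
have hE b : Esc b -> infinite (expR (- b)).
  move=> [m [g1 g2]]; have [p1 p2 p3 p4] := pos (e0 b).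
  exact: (pentagon_escape p1 p2 p3 p4 (XS _) (YS _) (xS _) (yS _) g1 g2).
have hS b : Small b -> converge (expR (- b)) 0 0.
  move=> [m [g1 g2]]; have [p1 p2 p3 p4] := pos (e0 b).
  exact: (pentagon_vanish p1 p2 p3 p4 (XS _) (YS _) (xS _) (yS _) theta0 thetaE phiE g1 g2).
have hM b : ~ Esc b -> ~ Small b -> converge (expR (- b)) phi theta.
  move=> ne ns; have [p1 p2 p3 p4] := pos (e0 b).
  apply: (pentagon_limit p1 p2 p3 p4 (XS _) (YS _) (xS _) (yS _) theta0 thetaE phiE) => m g.
    by apply: ne; exists m.
  by apply: ns; exists m.
have phi0 : 0 < phi by rewrite phiE invr_gt0 mulr_gt0 // addr_gt0.
have [h1 h2 h3 h5] : beta_crit 2 Esc Small.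
  apply: (gasket_critical h4 phi0 (L' := theta)).
  - move=> b /hE[h' _ _ _]; apply: (ger_cvgy (f := wx 2 (expR (- b)))) h'; apply: nearW => k.
    by apply: (wx_le_wX h4); exact: e0.
  - by move=> b /hS /total_cvg.
  - by move=> b e sm; exact: total_cvg (hM b e sm).
  - move=> b [m [g1 g2]]; apply: filterS2 (wt_gt_near h4 g1) (wt_gt_near h4 g2) => b' u1 u2.
    by exists m.
  - move=> b [m [g1 g2]]; apply: filterS2 (wt_lt_near h4 g1) (wt_lt_near h4 g2) => b' u1 u2.
    by exists m.
  - exists 1%N; rewrite oppr0 expR0 XS YS.
    have [p1 p2 p3 p4] := pos (@ltr01 R).
    have := (start_X h4 (@ltr01 R)).2; have := (start_Y h4 (@ltr01 R)).1; rewrite !expr1n.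
    move: (wX 2 1 0) (wY 2 1 0) (wx 2 1 0) p1 p2 p4 => X Y x x0 xX _ Y1 x1.
    have X1 : 1 <= X by lra.
    have X2 := exprn_ege1 2 X1; have Y2 := exprn_ege1 2 Y1; have Y3 := exprn_ege1 3 Y1.
    have c1 : 1 <= 2 * x * X - x ^+ 2 by nra.
    by move: (X ^+ 2) (Y ^+ 2) (Y ^+ 3) (2 * x * X - _) X2 Y2 Y3 c1 => a a1 a2 a3 *; split; nra.
  - have q0 : 0 < Num.min phi theta by rewrite lt_min phi0.
    have [b b0] := wt_small h4 q0; rewrite !lt_min => -[/andP[g1 _] /andP[_ g2]].
    by exists b => //; exists 0%N.
split; [by move=> b /h1/hS | by move=> b b0 /(h2 b b0)/hE | exact: (hM _ h3 h5)].
Qed.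

End Pentagon.

Section CrossingVectors.
Variables (R : realType) (n : nat).
Local Notation N := n.+3.
Hypothesis hN4 : ~~ (4 %| N)%N.
Local Notation s := (shift n).
Implicit Types (m : nat) (beta : R).

Lemma ga_corner m : [/\ ga R N m 0 = corner R m (0 : 'I_N), ga R N m (Posz (gs N)) = corner R m s
  & ga R N m (- Posz (gs N)) = corner R m (- s)].
Proof.
split=> //; apply/esym; first by apply: (cornerE R hN4); exact: shift_gs.
by apply: (cornerE R hN4); apply: eqN_trans (eqN_opp _) (eqN_oppm (shift_gs n)).
Qed.

Lemma X_E beta : X_ N beta = wX n (expR (- beta)).
Proof.
by apply/funext => m; have [e1 e2 _] := ga_corner m; rewrite /X_ e1 e2 cross_total.
Qed.

Lemma Y_E beta : Y_ N beta = wY n (expR (- beta)).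
Proof.
by apply/funext => m; have [_ e2 e3] := ga_corner m; rewrite /Y_ e2 e3 cross_total.
Qed.

End CrossingVectors.

Section SmallVectors.
Variable R : realType.
Implicit Types (m : nat) (beta : R).

Let h3 : ~~ (4 %| 3)%N. Proof. by []. Qed.
Let h5 : ~~ (4 %| 5)%N. Proof. by []. Qed.

(** The other two corners are [u + shift 0] and [u - shift 0] in one of two orders, which the
    reflection exchanges. *)
Lemma triangle_pair w m (u v t : 'I_3) : uniq [:: u; v; t] ->
  wt w m u v pred0 = wX 0 w m /\ wt w m u v (pred1 (corner R m t)) = wx 0 w m.
Proof.
move=> uvt; have : (v == u + shift 0) && (t == u - shift 0) || (v == u - shift 0) && (t == u +
  shift 0).
  by move: uvt; case: u v t => [[|[|[|//]]] ?] [[|[|[|//]]] ?] [[|[|[|//]]] ?].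
have [r0 r1] : wt w m (- 0) (- shift 0) pred0 = wX 0 w m /\
    wt w m (- 0) (- shift 0) (pred1 (corner R m (- - shift 0))) = wx 0 w m.
  by split; [exact: (wt_refl h3 w m 0 (shift 0) 0).1 | exact: (wt_refl h3 w m 0 (shift 0) (-
    shift 0)).2].
rewrite oppr0 in r0 r1; rewrite opprK in r1.
case/orP => /andP[/eqP -> /eqP ->];
  rewrite -[X in wt w m X _ pred0]addr0 -[X in wt w m X _ (pred1 _)]addr0.
  by rewrite (wt_rot h3 w m u 0 (shift 0) 0).1 (wt_rot h3 w m u 0 (shift 0) (- shift 0)).2.
by rewrite (wt_rot h3 w m u 0 (- shift 0) 0).1 (wt_rot h3 w m u 0 (- shift 0) (shift 0)).2.
Qed.

Lemma x3_E (u v t : 'I_3) beta : uniq [:: u; v; t] -> x3 u v t beta = wx 0 (expR (- beta)).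
Proof.
move=> uvt; apply/funext => m; have ut : u != t.
  by move: uvt; rewrite /= !inE negb_or => /andP[/andP[]].
by rewrite /x3 (cross_avoids h3 m beta v ut) (triangle_pair _ m uvt).2.
Qed.

Lemma y3_E (u v t : 'I_3) beta : uniq [:: u; v; t] ->
  y3 u v t beta = (fun m => wX 0 (expR (- beta)) m - wx 0 (expR (- beta)) m).
Proof.
move=> uvt; apply/funext => m; have ut : u != t.
  by move: uvt; rewrite /= !inE negb_or => /andP[/andP[]].
by rewrite /y3 (cross_visits h3 m beta v ut) (triangle_pair _ m uvt).1 (triangle_pair _ m uvt).2.
Qed.

Lemma pentagon_E beta : [/\ phi1 beta = wx 2 (expR (- beta)),
  phi2 beta = (fun m => wX 2 (expR (- beta)) m - wx 2 (expR (- beta)) m),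
  theta1 beta = wy 2 (expR (- beta)) &
  theta2 beta = (fun m => wY 2 (expR (- beta)) m - wy 2 (expR (- beta)) m)].
Proof.
have n1 : 0 != - shift 2 by [].
have n2 : - shift 2 != 0 by [].
split; apply/funext => m; have [e1 e2 e3] := ga_corner R h5 m; rewrite -[gs 5]/2%N in e2 e3.
- by rewrite /phi1 e1 e2 e3 (cross_avoids h5 m beta _ n1).
- by rewrite /phi2 e1 e2 e3 (cross_visits h5 m beta _ n1).
- by rewrite /theta1 e1 e2 e3 (cross_avoids h5 m beta _ n2).
- by rewrite /theta2 e1 e2 e3 (cross_visits h5 m beta _ n2).
Qed.

End SmallVectors.

Lemma tau_root (R : realType) (d : nat) (y : R) : (0 < d)%N -> y = tau R `^ (1 / d%:R) ->
  0 < y /\ y ^+ d = tau R.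
Proof.
have [/andP[t0 _] _] := tauE R; move=> d0 ->; split; first exact: powR_gt0.
rewrite -powR_mulrn; last exact: powR_ge0.
by rewrite -powRrM div1r mulVf ?pnatr_eq0 -?lt0n // powRr1 // ltW.
Qed.

Theorem theorem5 (R : realType) (N : nat) (hN : (3 <= N)%N)
    (hN4 : ~~ (4 %| N)%N) (u v t : 'I_3) (huvt : uniq [:: u; v; t]) :
  (forall (beta : R) (c : R^nat), beta_c R N < beta ->
     c \in crossing_vector N u v t beta -> c @ \oo --> (0 : R)) /\
  (forall (beta : R) (c : R^nat), 0 <= beta -> beta < beta_c R N ->
     c \in crossing_vector N u v t beta -> c @ \oo --> +oo) /\
  (N = 3%N ->
     (x3 u v t (beta_c R N) @ \oo --> tau R) /\
     (y3 u v t (beta_c R N) @ \oo --> (0 : R))) /\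
  (N = 5%N ->
     exists theta : R,
       [/\ 0 < theta, theta ^+ 5 + 2 * theta ^+ 4 = 1
         & [/\ phi1 (beta_c R N) @ \oo --> (theta * (1 + theta))^-1,
               phi2 (beta_c R N) @ \oo --> (0 : R),
               theta1 (beta_c R N) @ \oo --> theta
             & theta2 (beta_c R N) @ \oo --> (0 : R)]]) /\
  (N = 6%N \/ N = 9%N ->
     (X_ N (beta_c R N) @ \oo --> tau R `^ (1 / (N%:R / 3))) /\
     (Y_ N (beta_c R N) @ \oo --> tau R `^ (1 / (N%:R / 3)))) /\
  (forall k l : nat, N = (4 * k + l)%N -> (1 <= l <= 3)%N ->
     N \notin [:: 3; 5; 6; 9]%N ->
     exists Y : R,
       [/\ 0 < Y < 1, Y ^+ N + 2 * Y ^+ (2 * k + 2) = 1,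
           (forall Y' : R, 0 < Y' < 1 ->
              Y' ^+ N + 2 * Y' ^+ (2 * k + 2) = 1 -> Y' = Y),
           X_ N (beta_c R N) @ \oo --> (Y ^+ k + Y ^+ (3 * k + l - 2))^-1
         & Y_ N (beta_c R N) @ \oo --> Y]).
Proof.
have [theta /andP[th0 th1] thE] := @root_exists R 5 4 isT isT.
have [P1 P2 P3] := pentagon_critical th0 thE (erefl _).
have [T1 T2 T3 T4] := triangle_critical R.
case: N hN hN4 => [//|[//|[//|n]]] hN hN4.
have generic k l (Y : R) : n.+3 = (4 * k + l)%N -> (1 <= l <= 3)%N -> (5 < n.+3)%N -> 0 < Y ->
    Y ^+ n.+3 + 2 * Y ^+ (2 * k + 2) = 1 ->
      _ := fun e h h' Y0 YE => generic_critical hN4 e h h' Y0 YE.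
(* The cases 6 and 9 are included: off criticality, all N other than 3 and 5 are treated
   together. *)
have some_generic : n.+3 != 3 -> n.+3 != 5 -> exists k l (Y : R),
    [/\ n.+3 = (4 * k + l)%N, (1 <= l <= 3)%N, (5 < n.+3)%N, 0 < Y &
    Y ^+ n.+3 + 2 * Y ^+ (2 * k + 2) = 1].
  move=> n3 n5; have [Y /andP[Y0 Y1] YE] := @root_exists R n.+3 (2 * (n.+3 %/ 4) + 2) isT
    ltac:(lia).
  by exists (n.+3 %/ 4)%N, (n.+3 %% 4)%N, Y; split=> //; lia.
split.
  move=> b c bb; rewrite /crossing_vector.
  have [n3|n3] := eqVneq n.+3 3.
    case: n3 bb => -> /T1[h1 h2]; rewrite !inE => /orP[]/eqP ->; first by rewrite x3_E.
    by rewrite y3_E.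
  have [n5|n5] := eqVneq n.+3 5.
    case: n5 bb => -> /P1[h1 h2 h3 h4]; have [-> -> -> ->] := pentagon_E b.
    by rewrite !inE => /or4P[]/eqP ->.
  have [k [l [Y [e h h' Y0 YE]]]] := some_generic n3 n5.
  have [/(_ b bb)[h1 h2] _ _ _] := generic k l Y e h h' Y0 YE.
  by rewrite (X_E hN4) (Y_E hN4) !inE => /orP[]/eqP ->.
split.
  move=> b c b0 bb; rewrite /crossing_vector.
  have [n3|n3] := eqVneq n.+3 3.
    case: n3 bb => -> /(T2 b b0)[h1 h2]; rewrite !inE => /orP[]/eqP ->; first by rewrite x3_E.
    by rewrite y3_E.
  have [n5|n5] := eqVneq n.+3 5.
    case: n5 bb => -> /(P2 b b0)[h1 h2 h3 h4]; have [-> -> -> ->] := pentagon_E b.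
    by rewrite !inE => /or4P[]/eqP ->.
  have [k [l [Y [e h h' Y0 YE]]]] := some_generic n3 n5.
  have [_ /(_ b b0 bb)[h1 h2] _ _] := generic k l Y e h h' Y0 YE.
  by rewrite (X_E hN4) (Y_E hN4) !inE => /orP[]/eqP ->.
split; first by case=> ->; rewrite x3_E // y3_E.
split.
  case=> ->; exists theta; split=> //; have [-> -> -> ->] := pentagon_E (beta_c R 5).
  exact: P3.
split.
  have [/andP[t0 t1] tE] := tauE R.
  (* With [Y ^+ d = tau], [d = 2] or 3, the equations [Y ^+ 6 + 2 * Y ^+ 4 = 1] and
     [Y ^+ 9 + 2 * Y ^+ 6 = 1] both become this one. *)
  have t3 : tau R ^+ 3 + 2 * tau R ^+ 2 = 1.
    have -> : tau R ^+ 3 + 2 * tau R ^+ 2 = tau R * (tau R + tau R ^+ 2) + tau R ^+ 2 by ring.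
    by rewrite tE mulr1 tE.
  rewrite (X_E hN4) (Y_E hN4); case=> E.
    have eN : n.+3%:R / 3 = 2%:R :> R by rewrite E; field.
    rewrite eN; set Y := tau R `^ _; have [Y0 Y2] := tau_root (isT : (0 < 2)%N) (erefl Y).
    have YE : Y ^+ n.+3 + 2 * Y ^+ (2 * 1 + 2) = 1.
      by rewrite E -[6%N]/(2 * 3)%N -[(2 * 1 + 2)%N]/(2 * 2)%N !exprM Y2.
    have [_ _ h1 h2] := generic 1%N 2%N Y E isT ltac:(by rewrite E) Y0 YE; split=> //.
    (* The two limits coincide because [Y * (Y + Y ^+ 3) = tau + tau ^+ 2 = 1]; the case 9 is the
       same with [Y ^+ 3 = tau]. *)
    suff <- : generic_X 1 2 Y = Y by [].
    apply: mulr1_eq; rewrite -[(3 * 1 + 2 - 2)%N]/3%N -tE -Y2; ring.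
  have eN : n.+3%:R / 3 = 3%:R :> R by rewrite E; field.
  rewrite eN; set Y := tau R `^ _; have [Y0 Y3] := tau_root (isT : (0 < 3)%N) (erefl Y).
  have YE : Y ^+ n.+3 + 2 * Y ^+ (2 * 2 + 2) = 1.
    by rewrite E -[9%N]/(3 * 3)%N -[(2 * 2 + 2)%N]/(3 * 2)%N !exprM Y3.
  have [_ _ h1 h2] := generic 2%N 1%N Y E isT ltac:(by rewrite E) Y0 YE; split=> //.
  suff <- : generic_X 2 1 Y = Y by [].
  apply: mulr1_eq; rewrite -[(3 * 2 + 1 - 2)%N]/5%N -tE -Y3; ring.
move=> k l e h; rewrite !inE !negb_or => /and4P[n3 n5 _ _].
have [Y /andP[Y0 Y1] YE] := @root_exists R n.+3 (2 * k + 2) isT ltac:(lia).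
have h' : (5 < n.+3)%N by lia.
have [_ _ h1 h2] := generic k l Y e h h' Y0 YE.
exists Y; split=> //; first by rewrite Y0.
- by move=> y /andP[y0 y1] yE; exact: (root_unique (isT : (0 < n.+3)%N) y0 Y0 yE YE).
- by rewrite (X_E hN4).
- by rewrite (Y_E hN4).
Qed.
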